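(* Let $\mu_-\le 0\le \mu_+$, $\mu_-<\mu_+$, and let $\mathcal{C}=\mathcal{C}_{\gamma_-,\gamma_+}$ with $-\pi/2\le\gamma_-<0<\gamma_+\le\pi/2$. Let $X$ be a Lévy process on $\mathbb{R}$ with characteristic exponent $\psi$ such that $\psi$ is analytic in $i(\mu_-,\mu_+)+(\mathcal{C}\cup\{0\})$ and, for some $\nu\in(0,2)$, the following bound holds: for all $\gamma_{1,-}\in(\gamma_-,0)$ and $\gamma_{1,+}\in(0,\gamma_+)$ there exist $C,R>0$ such that $|\psi(\rho e^{i\varphi})|\le C\rho^\nu$ for all $\varphi\in[\gamma_{1,-},\gamma_{1,+}]$ and $\rho>R$. Then the Lévy measure of $X$ is absolutely continuous, $F(dx)=f(x)dx$, with $f\in C^\infty(\mathbb{R}\setminus\{0\})$, and $$f(x)=-\frac{1}{2\pi}\int_{\mathcal{L}^-}e^{-ix\xi}\psi(\xi)\,d\xi,\quad x>0,\qquad\qquad f(x)=-\frac{1}{2\pi}\int_{\mathcal{L}^+}e^{-ix\xi}\psi(\xi)\,d\xi,\quad x<0,$$ where $\mathcal{L}^\pm\subset i(\mu_-,\mu_+)+(\mathcal{C}\cup\{0\})$ are regular contours whose wings point upward for $\mathcal{L}^+$ and downward for $\mathcal{L}^-$, for instance $\mathcal{L}^\pm=i\theta+(e^{i(\pi-\omega)}\mathbb{R}_+\cup e^{i\omega}\mathbb{R}_+)$ with $\theta\in(\mu_-,\mu_+)$ and $\omega$ sufficiently small in absolute value, $\omega>0$ for $\mathcal{L}^+$ and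 $\omega<0$ for $\mathcal{L}^-$.
   Context: The characteristic exponent is defined by $\mathbb{E}[e^{i\xi X_t}]=e^{-t\psi(\xi)}$, so that $\psi(\xi)=\frac{\sigma^2}{2}\xi^2-ib\xi+\int_{\mathbb{R}\setminus 0}(1-e^{ix\xi}+\mathbf{1}_{(-1,1)}(x)ix\xi)F(dx)$; its analytic continuation is also denoted $\psi$. Cones: $\mathcal{C}_{\gamma_-,\gamma_+}=\{e^{i\varphi}\rho : \rho>0,\ \varphi\in(\gamma_-,\gamma_+)\cup(\pi-\gamma_+,\pi-\gamma_-)\}$. The contours are passed from left to right (i.e., in the direction of increasing $\Re\xi$).
   Formalization: When μ_-=0 or μ_+=0, so that 0 is only a boundary point of the domain, the continued ψ is also assumed continuous at 0 (otherwise false); ''regular contours'' means piecewise C^1, increasing real part, wings of bounded slope in closed subsectors. *)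

(* Defs.v *)
From HB Require Import structures.
From mathcomp Require Import all_boot all_order all_algebra.
From mathcomp Require Import all_classical all_reals all_analysis.
From mathcomp Require Import complex.

Set Implicit Arguments.
Unset Strict Implicit.
Unset Printing Implicit Defensive.

Import Order.TTheory GRing.Theory Num.Theory.
Import numFieldNormedType.Exports.

Local Open Scope classical_set_scope.
Local Open Scope ring_scope.
Local Open Scope complex_scope.

Section complex_analysis.
Context {R : realType}.

Definition cexp (z : R[i]) : R[i] :=
  (expR (complex.Re z))%:C * (cos (complex.Im z) +i* sin (complex.Im z)).

Definition polar (rho phi : R) : R[i] := rho%:C * cexp ('i%C * phi%:C).

Definition cintegrable d (T : measurableType d)
    (mu : {measure set T -> \bar R}) (D : set T) (g : T -> R[i]) : Prop :=
  mu.-integrable D (EFin \o (fun x => complex.Re (g x))) /\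
  mu.-integrable D (EFin \o (fun x => complex.Im (g x))).

(* meaningful only under [cintegrable mu D g] *)
Definition cintegral d (T : measurableType d)
    (mu : {measure set T -> \bar R}) (D : set T) (g : T -> R[i]) : R[i] :=
  Rintegral mu D (fun x => complex.Re (g x)) +i*
  Rintegral mu D (fun x => complex.Im (g x)).

(* [R[i]^o] is [R[i]] with the topology of its norm. *)
Definition analytic_at (g : R[i] -> R[i]) (z : R[i]) : Prop :=
  exists a : nat -> R[i], exists2 r : R, 0 < r &
    forall w : R[i], `|w - z| < r%:C ->
      series (fun n => a n * (w - z) ^+ n : R[i]^o) @ \oo --> (g w : R[i]^o).

Definition real_line : set (R[i]) := [set x%:C | x in [set: R]].

(* [psi], restricted to the real line, is continued analytically to [D]. If a
   point of the real line lies only on the boundary of [D] (below, 0 when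
   mum = 0 or mup = 0), a continuation has to attain its values there
   continuously. *)
Definition analytic_continuation_to (D : set (R[i])) (psi : R[i] -> R[i])
    : Prop :=
  (forall z, D z -> analytic_at psi z) /\
  {within (D `|` real_line : set (R[i]^o)),
     continuous (psi : R[i]^o -> R[i]^o)}.

End complex_analysis.

Section levy.
Context {R : realType}.

Definition mutually_independent d (T : measurableType d) (P : probability T R)
    (n : nat) (Y : 'I_n -> T -> R) : Prop :=
  forall B : 'I_n -> set R, (forall i, measurable (B i)) ->
    P [set w | forall i, B i (Y i w)] =
    (\prod_(i < n) P [set w | B i (Y i w)])%E.

(* The time set is [0, +oo[: [X t] is irrelevant for t < 0. *)
Definition levy_process d (T : measurableType d) (P : probability T R)
    (X : R -> {RV P >-> R}) : Prop :=
  [/\ {ae P, forall w, X 0 w = 0},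
      forall (n : nat) (t : nat -> R), 0 <= t 0%N ->
        (forall k, t k <= t k.+1) ->
        mutually_independent P (fun (k : 'I_n) w => X (t k.+1) w - X (t k) w),
      forall (s t : R) (B : set R), 0 <= s -> 0 <= t -> measurable B ->
        P [set w | B (X (s + t) w - X s w)] = P [set w | B (X t w)],
      forall t eps : R, 0 <= t -> 0 < eps ->
        (fun s => P [set w | eps < `|X s w - X t w|])
          @ within [set s | 0 <= s] (nbhs t) --> 0%E
    & {ae P, forall w,
        (forall t : R, 0 <= t -> X s w @[s --> t^'+] --> X t w) /\
        (forall t : R, 0 < t -> cvg (X s w @[s --> t^'-]))}].

(* E[exp(i xi X_t)] = exp(- t psi(xi)) for all t >= 0 determines [psi] on the
   real line, and not only up to multiples of 2 i pi / t. *)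
Definition characteristic_exponent d (T : measurableType d)
    (P : probability T R) (X : R -> {RV P >-> R}) (psi : R[i] -> R[i]) : Prop :=
  forall t xi : R, 0 <= t ->
    cintegral P setT (fun w => cexp ('i%C * (xi * X t w)%:C)) =
    cexp (- (t%:C * psi xi%:C)).

Definition levy_khintchine_integrand (xi x : R) : R[i] :=
  1 - cexp ('i%C * (x * xi)%:C)
  + (if x \in `](-1), 1[ then 'i%C * (x * xi)%:C else 0).

(* [F] is a measure on R \ {0}, seen as a measure on R that does not charge 0. *)
Definition levy_measure_of (psi : R[i] -> R[i])
    (F : {measure set (measurableTypeR R) -> \bar R}) : Prop :=
  [/\ F [set 0] = 0%E,
      (\int[F]_(x in [set~ 0%R]) (Num.min 1 (x ^+ 2))%:E < +oo)%E
    & exists sigma b : R, forall xi : R,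
        psi xi%:C = (sigma ^+ 2 / 2 * xi ^+ 2)%:C - 'i%C * (b * xi)%:C
          + cintegral F [set~ (0 : R)] (levy_khintchine_integrand xi)].

End levy.

Section contours.
Context {R : realType}.

Definition cone (gm gp : R) : set (R[i]) :=
  [set z | exists rho phi : R,
    [/\ 0 < rho, gm < phi < gp \/ pi - gp < phi < pi - gm
      & z = polar rho phi]].

Definition closed_cone (a b : R) : set (R[i]) :=
  [set z | exists rho phi : R,
    [/\ 0 < rho, a <= phi <= b \/ pi - b <= phi <= pi - a
      & z = polar rho phi]].

(* i ]mum, mup[ + (cone gm gp U {0}) *)
Definition strip_plus_cone (mum mup gm gp : R) : set (R[i]) :=
  [set z | exists (theta : R) (w : R[i]),
    [/\ mum < theta < mup, (cone gm gp `|` [set 0]) w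
      & z = 'i%C * theta%:C + w]].

Definition piecewise_C1 (g : R -> R) : Prop :=
  [/\ continuous g,
      exists s : seq R, forall t, t \notin s ->
        derivable g t 1 /\ {for t, continuous (derive1 g)}
    & forall t, cvg (derive1 g u @[u --> t^'+]) /\ cvg (derive1 g u @[u --> t^'-])].

Definition curve_derivative (L : R -> R[i]) (t : R) : R[i] :=
  derive1 (fun u => complex.Re (L u)) t +i* derive1 (fun u => complex.Im (L u)) t.

(* A piecewise C1 curve in [D], passed from left to right, whose two wings
   lie eventually in the sectors a <= arg <= b and pi - b <= arg <= pi - a and
   have a bounded slope there. *)
Definition regular_contour (D : set (R[i])) (a b : R) (L : R -> R[i]) : Prop :=
  [/\ piecewise_C1 (fun t => complex.Re (L t)) /\
      piecewise_C1 (fun t => complex.Im (L t)),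
      {homo (fun t => complex.Re (L t)) : s t / s < t},
      complex.Re (L t) @[t --> +oo] --> +oo /\
      complex.Re (L t) @[t --> -oo] --> -oo,
      forall t, D (L t)
    & exists t0 K : R, forall t, t0 <= `|t| ->
        closed_cone a b (L t) /\
        `|complex.Im (curve_derivative L t)|
          <= K * complex.Re (curve_derivative L t)].

Definition upward_contour (mum mup gm gp : R) (L : R -> R[i]) : Prop :=
  exists a b : R, [/\ 0 < a, a <= b, b < gp
    & regular_contour (strip_plus_cone mum mup gm gp) a b L].

Definition downward_contour (mum mup gm gp : R) (L : R -> R[i]) : Prop :=
  exists a b : R, [/\ gm < a, a <= b, b < 0
    & regular_contour (strip_plus_cone mum mup gm gp) a b L].

(* i theta + (exp(i (pi - omega)) R_+ U exp(i omega) R_+) *)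
Definition broken_line (theta omega t : R) : R[i] :=
  'i%C * theta%:C
  + (if 0 <= t then polar t omega else polar (- t) (pi - omega)).

Definition contour_integrand (g : R[i] -> R[i]) (L : R -> R[i]) (t : R) : R[i] :=
  g (L t) * curve_derivative L t.

Definition contour_integrable (g : R[i] -> R[i]) (L : R -> R[i]) : Prop :=
  cintegrable (@lebesgue_measure R) setT (contour_integrand g L).

Definition contour_integral (g : R[i] -> R[i]) (L : R -> R[i]) : R[i] :=
  cintegral (@lebesgue_measure R) setT (contour_integrand g L).

Definition smooth_off_0 (f : R -> R) : Prop :=
  forall (n : nat) (x : R), x != 0 -> derivable (derive1n n f) x 1.

End contours.

(* Main.v *)
Require Import Defs.
From HB Require Import structures.
From mathcomp Require Import all_boot all_order all_algebra.
From mathcomp Require Import all_classical all_reals all_analysis complex.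
From mathcomp Require Import measurable_realfun.
From mathcomp Require Import ring lra.
Import Order.TTheory GRing.Theory Num.Theory.
Import numFieldNormedType.Exports.
Set Implicit Arguments.
Unset Strict Implicit.
Unset Printing Implicit Defensive.
Local Open Scope classical_set_scope.
Local Open Scope ring_scope.
Local Open Scope complex_scope.

(** The Levy-Khintchine formula gives psi(-xi) = conj(psi(xi)) on the real
    line, hence psi(- conj z) = conj(psi(z)) on the domain by the identity
    theorem. The domain being star-shaped about 0, exp(- i x z) psi(z) has a
    primitive there; in a sector where exp(- i x z) decays, this primitive has
    a limit at infinity, the same in all directions. The integral over any
    admissible contour is therefore 2 Re A(x), where A(x) is the integral over
    a half-line, and f(x) = - Re A(x) / pi is smooth by differentiation under
    the integral sign.

    To identify F, put h_e(y) = - (1 / pi) Re int_0^oo exp(- (e + i y) xi)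
    psi(xi) dxi. Rotating the half-line shows that h_e tends to f as e -> 0,
    uniformly on [p, q] when 0 is not in [p, q]. By the Levy-Khintchine formula
    and Fubini's theorem, the integral of h_e over [p, q] is int K_e dF + o(1),
    where K_e(x) is the mass that the Cauchy law of scale e centred at x gives
    to [p, q], minus its first-order expansion in x at 0. This is a second-order
    Taylor remainder of arctan, so |K_e(x)| <= C min(1, x^2) uniformly in e, and
    dominated convergence yields
    int_p^q f = F(]p, q[) + (F {p} + F {q}) / 2. *)

(** * Complex numbers, componentwise limits and derivatives *)

(** The obstacle at the origin: when [mum = 0] or [mup = 0], 0 is only a boundary point of the
    domain, where psi is continuous but need not be analytic. The primitive is therefore the
    integral along the segment from 0, and Cauchy's theorem is proved for triangles with vertex 0 by
    shrinking them to 0, which asks for continuity alone at that vertex. Half-lines are indexed by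
    their slope, so that sectors become intervals and decay becomes an inequality affine in the
    slope. The obstacle at infinity: the Levy-Khintchine formula is given on the real line only,
    where exp(- i y xi) psi(xi) is in general not integrable, whereas f is an integral along a
    tilted half-line, on which the formula says nothing. The factor exp(- e xi) connects the two: it
    makes the integral over the real half-line converge and puts that half-line in one sector of
    decay with the tilted one. Keeping [p, q] off 0 serves twice: the Gaussian and drift terms
    integrate to Cauchy kernels and their derivatives at p and q, which vanish with e, and F,
    possibly infinite near 0, is finite there. *)

Notation Re := complex.Re.
Notation Im := complex.Im.
Notation normc := ComplexField.Normc.normc.

Section complex_basics.
Context {R : realType}.
Implicit Types z w : R[i].

Lemma normcE0 z : `|z| = (normc z)%:C.
Proof. by []. Qed.

Lemma normc_ge0 z : 0 <= normc z.
Proof. by case: z => a b; exact: sqrtr_ge0. Qed.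

Lemma ReM z w : Re (z * w) = Re z * Re w - Im z * Im w.
Proof. by case: z w => a b [c d]. Qed.

Lemma ImM z w : Im (z * w) = Re z * Im w + Im z * Re w.
Proof. by case: z w => a b [c d]. Qed.

Lemma ReD z w : Re (z + w) = Re z + Re w.
Proof. by case: z w => a b [c d]. Qed.

Lemma ImD z w : Im (z + w) = Im z + Im w.
Proof. by case: z w => a b [c d]. Qed.

Lemma ReN z : Re (- z) = - Re z.
Proof. by case: z => a b. Qed.

Lemma ImN z : Im (- z) = - Im z.
Proof. by case: z => a b. Qed.

Lemma eqC z w : Re z = Re w -> Im z = Im w -> z = w.
Proof. by case: z w => a b [c d] /= -> ->. Qed.


Lemma Re_conj z : Re z^*%C = Re z.
Proof. by case: z. Qed.

Lemma Im_conj z : Im z^*%C = - Im z.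
Proof. by case: z. Qed.

Lemma normc_sqr z : normc z ^+ 2 = Re z ^+ 2 + Im z ^+ 2.
Proof. by case: z => a b; rewrite /= sqr_sqrtr// addr_ge0 ?sqr_ge0. Qed.

Lemma normc_Re z : `|Re z| <= normc z.
Proof.
rewrite -(@ler_pXn2r _ 2) ?nnegrE ?normc_ge0// normc_sqr real_normK ?num_real//.
by rewrite lerDl sqr_ge0.
Qed.

Lemma normc_Im z : `|Im z| <= normc z.
Proof.
rewrite -(@ler_pXn2r _ 2) ?nnegrE ?normc_ge0// normc_sqr real_normK ?num_real//.
by rewrite lerDr sqr_ge0.
Qed.

Lemma normc_leD z : normc z <= `|Re z| + `|Im z|.
Proof.
rewrite -(@ler_pXn2r _ 2) ?nnegrE ?normc_ge0 ?addr_ge0// normc_sqr.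
rewrite sqrrD !real_normK ?num_real// addrAC lerDl mulrn_wge0// mulr_ge0//.
Qed.

Lemma normc_triangle z w : normc (z + w) <= normc z + normc w.
Proof. exact: le_normcD. Qed.

Lemma normcM z w : normc (z * w) = normc z * normc w.
Proof. exact: ComplexField.Normc.normcM. Qed.

Lemma normc_opp z : normc (- z) = normc z.
Proof. exact: normcN. Qed.

Lemma normc_real (x : R) : normc x%:C = `|x|.
Proof. by rewrite /= expr0n addr0 sqrtr_sqr. Qed.

Lemma normc_conj z : normc z^*%C = normc z.
Proof. by case: z => a b /=; rewrite sqrrN. Qed.

Lemma normcX z n : normc (z ^+ n) = normc z ^+ n.
Proof.
elim: n => [|n ih]; first by rewrite !expr0 ComplexField.Normc.normc1.
by rewrite !exprS normcM ih.
Qed.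

Lemma normc_sum n (f : 'I_n -> R[i]) :
  normc (\sum_(i < n) f i) <= \sum_(i < n) normc (f i).
Proof.
elim: n f => [|n ih] f; first by rewrite !big_ord0 ComplexField.Normc.normc0.
by rewrite !big_ord_recr/= (le_trans (normc_triangle _ _))// lerD2r.
Qed.

Lemma normc_eq0 z : normc z = 0 -> z = 0.
Proof. exact: ComplexField.Normc.eq0_normc. Qed.

Lemma normc_cexp z : normc (cexp z) = expR (Re z).
Proof.
rewrite /cexp normcM normc_real ger0_norm ?expR_ge0//=.
by rewrite cos2Dsin2 sqrtr1 mulr1.
Qed.

Lemma Re_cexp z : Re (cexp z) = expR (Re z) * cos (Im z).
Proof. by rewrite /cexp ReM /=; ring. Qed.

Lemma Im_cexp z : Im (cexp z) = expR (Re z) * sin (Im z).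
Proof. by rewrite /cexp ImM /=; ring. Qed.

Definition ReImE := (Re_cexp, Im_cexp, ReD, ImD, ReN, ImN, ReM, ImM).

Opaque cexp.

Lemma cexpD z w : cexp (z + w) = cexp z * cexp w.
Proof.
by apply: eqC; rewrite !ReImE expRD ?cosD ?sinD; ring.
Qed.

Lemma cexp_conj z : cexp z^*%C = (cexp z)^*%C.
Proof.
by apply: eqC; rewrite !(Re_conj, Im_conj, Re_cexp, Im_cexp) ?cosN ?sinN ?mulrN.
Qed.

Lemma Re_polar (rho phi : R) : Re (polar rho phi) = rho * cos phi.
Proof. by rewrite /polar !ReImE /= !(mul0r,mul1r,subr0,addr0,add0r,sub0r,oppr0) expR0 mul1r. Qed.

Lemma Im_polar (rho phi : R) : Im (polar rho phi) = rho * sin phi.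
Proof. by rewrite /polar !ReImE /= !(mul0r,mul1r,subr0,addr0,add0r,sub0r,oppr0) expR0 mul1r. Qed.


Opaque polar.

(** Limits, and below derivatives and integrals, are taken componentwise, so that the results on
    real-valued functions apply to each component. *)
Definition ccvg {T} (F : set_system T) (f : T -> R[i]) (l : R[i]) : Prop :=
  (Re (f t) @[t --> F] --> Re l) /\ (Im (f t) @[t --> F] --> Im l).

Section ccvg.
Context {T : Type} {F : set_system T} {FF : Filter F}.
Implicit Types f g : T -> R[i].

Lemma ccvg_cst z : ccvg F (fun=> z) z.
Proof. by split; exact: cvg_cst. Qed.

Lemma ccvgD f g a b : ccvg F f a -> ccvg F g b -> ccvg F (fun t => f t + g t) (a + b).
Proof.
move=> [f1 f2] [g1 g2]; split.
  by under eq_fun do rewrite ReD; rewrite ReD; exact: cvgD.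
by under eq_fun do rewrite ImD; rewrite ImD; exact: cvgD.
Qed.

Lemma ccvgN f a : ccvg F f a -> ccvg F (fun t => - f t) (- a).
Proof.
move=> [f1 f2]; split.
  by under eq_fun do rewrite ReN; rewrite ReN; exact: cvgN.
by under eq_fun do rewrite ImN; rewrite ImN; exact: cvgN.
Qed.

Lemma ccvgM f g a b : ccvg F f a -> ccvg F g b -> ccvg F (fun t => f t * g t) (a * b).
Proof.
move=> [f1 f2] [g1 g2]; split.
  by under eq_fun do rewrite ReM; rewrite ReM; apply: cvgB; exact: cvgM.
by under eq_fun do rewrite ImM; rewrite ImM; apply: cvgD; exact: cvgM.
Qed.

Lemma ccvg_real (f : T -> R) (a : R) : f @ F --> a -> ccvg F (fun t => (f t)%:C) a%:C.
Proof. by move=> fa; split => //=; exact: cvg_cst. Qed.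

Lemma ccvg_cexp f a : ccvg F f a -> ccvg F (fun t => cexp (f t)) (cexp a).
Proof.
move=> [f1 f2]; split.
  under eq_fun do rewrite Re_cexp; rewrite Re_cexp; apply: cvgM.
    by apply: (cvg_comp _ _ f1); exact: continuous_expR.
  by apply: (cvg_comp _ _ f2); exact: continuous_cos.
under eq_fun do rewrite Im_cexp; rewrite Im_cexp; apply: cvgM.
  by apply: (cvg_comp _ _ f1); exact: continuous_expR.
by apply: (cvg_comp _ _ f2); exact: continuous_sin.
Qed.

Lemma ccvg_normcP f a :
  ccvg F f a <-> (forall e : R, 0 < e -> \forall t \near F, normc (f t - a) < e).
Proof.
split=> [[f1 f2] e e0|fa].
  have e20 : 0 < e / 2 by rewrite divr_gt0.
  move/cvgrPdist_lt : f1 => /(_ _ e20); move/cvgrPdist_lt : f2 => /(_ _ e20).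
  apply: filterS2 => t h1 h2.
  rewrite (le_lt_trans (normc_leD _))// !ReImE distrC [ltLHS]addrC distrC.
  by rewrite addrC [ltRHS]splitr ltrD// distrC.
split; apply/cvgrPdist_lt => e /fa; apply: filterS => t; rewrite distrC.
  by apply: le_lt_trans; rewrite -ReN -ReD normc_Re.
by apply: le_lt_trans; rewrite -ImN -ImD normc_Im.
Qed.

Lemma ccvg_unique f a b : ProperFilter F -> ccvg F f a -> ccvg F f b -> a = b.
Proof.
move=> PF [f1 f2] [g1 g2]; apply: eqC.
  by apply: cvg_unique f1 g1; exact: Rhausdorff.
by apply: cvg_unique f2 g2; exact: Rhausdorff.
Qed.

Lemma ccvg_normc f a : ccvg F f a -> normc (f t) @[t --> F] --> normc a.
Proof.
move/ccvg_normcP => fa; apply/cvgrPdist_lt => e /fa; apply: filterS => t.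
apply: le_lt_trans; rewrite ler_distlC.
have h1 := normc_triangle (f t) (a - f t).
have h2 := normc_triangle (f t - a) a.
have h3 := normc_opp (f t - a).
rewrite opprB in h3; rewrite addrC addrNK h3 in h1; rewrite addrNK in h2.
by apply/andP; split; lra.
Qed.

End ccvg.

Lemma nbhsC_normcP z (A : set R[i]) :
  nbhs (z : R[i]^o) A <-> exists2 d : R, 0 < d & forall w, normc (w - z) < d -> A w.
Proof.
split.
  move=> /nbhs_normP[e /= e0 eA].
  have eE : e = (Re e)%:C by move: e0; rewrite ltcE/= => /andP[/eqP e0 _]; case: e e0 {eA} => a b /= ->.
  exists (Re e); first by move: e0; rewrite ltcE => /andP[].
  move=> w wz; apply: eA => /=.
  by rewrite eE normcE0 ltcR -opprB normc_opp.
move=> [d d0 dA]; apply/(@nbhs_normP _ R[i]^o); exists d%:C; first by rewrite /= ltcR.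
by move=> w /=; rewrite normcE0 ltcR -opprB normc_opp => /dA.
Qed.

(** Relative continuity: at a point such as 0, which may lie on the boundary of the domain, limits
    are taken along [S] only. *)
Definition ccont_on (S : set R[i]) (g : R[i] -> R[i]) : Prop :=
  forall z, S z -> ccvg (within S (nbhs (z : R[i]^o))) g (g z).

Lemma within_ccont_on (S : set R[i]) (g : R[i] -> R[i]) :
  {within (S : set R[i]^o), continuous (g : R[i]^o -> R[i]^o)} -> ccont_on S g.
Proof.
move=> /subspace_continuousP gc z Sz.
apply/ccvg_normcP => e e0.
have /cvgrPdist_lt/(_ e%:C) := gc z Sz.
rewrite ltcR => /(_ e0); apply: filterS => w.
by rewrite normcE0 ltcR -opprB normc_opp.
Qed.

Lemma ccont_on_comp {T} {F : set_system T} {FF : Filter F} S g (f : T -> R[i]) z :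
  ccont_on S g -> S z -> (\forall t \near F, S (f t)) -> ccvg F f z ->
  ccvg F (fun t => g (f t)) (g z).
Proof.
move=> gc Sz Sf fz.
have fw : f @ F --> within S (nbhs (z : R[i]^o)).
  move=> A /= /nbhsC_normcP[d d0 dA].
  move/ccvg_normcP : fz => /(_ _ d0) fz.
  by near=> t; apply: dA; near: t.
have [g1 g2] := gc z Sz.
by split; [exact: (cvg_comp f _ fw g1)|exact: (cvg_comp f _ fw g2)].
Unshelve. all: by end_near. Qed.

Lemma ccont_on_id S : ccont_on S id.
Proof.
move=> z Sz; apply/ccvg_normcP => e e0; apply/nbhsC_normcP; exists e => //.
Qed.

Lemma ccont_onW S S' g : S' `<=` S -> ccont_on S g -> ccont_on S' g.
Proof.
move=> SS gc z Sz; apply/ccvg_normcP => e e0.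
have /ccvg_normcP/(_ _ e0) := gc z (SS _ Sz).
by rewrite !near_withinE; apply: filterS => w + /SS.
Qed.

Definition cder (f : R -> R[i]) (t : R) (d : R[i]) : Prop :=
  is_derive t 1 (fun u => Re (f u)) (Re d) /\ is_derive t 1 (fun u => Im (f u)) (Im d).

Lemma is_derive_ext (f g : R -> R) (t a b : R) :
  is_derive t 1 f a -> f =1 g -> a = b -> is_derive t 1 g b.
Proof. by move=> h /funext <- <-. Qed.

Lemma cder_ext f g t a b : cder f t a -> f =1 g -> a = b -> cder g t b.
Proof. by move=> h /funext <- <-. Qed.

Lemma cder_cst z t : cder (fun=> z) t 0.
Proof. by split; exact: is_derive_cst. Qed.

Lemma cder_real (f : R -> R) (t a : R) : is_derive t 1 f a -> cder (fun u => (f u)%:C) t a%:C.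
Proof. by move=> fa; split => //=; exact: is_derive_cst. Qed.

Lemma cder_id t : cder (fun u => u%:C) t 1.
Proof. by apply: cder_real; exact: is_derive_id. Qed.

Lemma cderD f g t a b : cder f t a -> cder g t b -> cder (fun u => f u + g u) t (a + b).
Proof.
move=> [f1 f2] [g1 g2]; split.
  by apply: (is_derive_ext (is_deriveD f1 g1)) => [u|]; rewrite ReD.
by apply: (is_derive_ext (is_deriveD f2 g2)) => [u|]; rewrite ImD.
Qed.

Lemma cderN f t a : cder f t a -> cder (fun u => - f u) t (- a).
Proof.
move=> [f1 f2]; split.
  by apply: (is_derive_ext (is_deriveN f1)) => [u|]; rewrite ReN.
by apply: (is_derive_ext (is_deriveN f2)) => [u|]; rewrite ImN.
Qed.

Lemma cderM f g t a b : cder f t a -> cder g t b ->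
  cder (fun u => f u * g u) t (f t * b + a * g t).
Proof.
move=> [f1 f2] [g1 g2]; split.
  apply: (is_derive_ext (is_deriveB (is_deriveM f1 g1) (is_deriveM f2 g2))) => [u|].
    by rewrite ReM.
  by rewrite !ReImE /GRing.scale/=; ring.
apply: (is_derive_ext (is_deriveD (is_deriveM f1 g2) (is_deriveM f2 g1))) => [u|].
  by rewrite ImM.
by rewrite !ReImE /GRing.scale/=; ring.
Qed.

Lemma cder_cexp f t a : cder f t a -> cder (fun u => cexp (f u)) t (cexp (f t) * a).
Proof.
move=> [f1 f2].
have h1 := is_derive1_comp (is_derive_expR (Re (f t))) f1.
have h2 := is_derive1_comp (is_derive_cos (Im (f t))) f2.
have h3 := is_derive1_comp (is_derive_sin (Im (f t))) f2.
split.
  apply: (is_derive_ext (is_deriveM h1 h2)) => [u|]; first by rewrite Re_cexp.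
  by rewrite ReM Re_cexp Im_cexp /GRing.scale/=; ring.
apply: (is_derive_ext (is_deriveM h1 h3)) => [u|]; first by rewrite Im_cexp.
by rewrite ImM Re_cexp Im_cexp /GRing.scale/=; ring.
Qed.

Lemma is_derive_cvgP (f : R -> R) (t d : R) :
  is_derive t 1 f d <-> h^-1 * (f (h + t) - f t) @[h --> 0^'] --> d.
Proof.
split.
  move=> [df <-]; have := df; rewrite /derivable /derive.
  by under eq_fun do rewrite /= scaler1.
move=> h.
have h' : h^-1 *: ((f \o shift t) (h *: 1) - f t) @[h --> 0^'] --> d.
  by under eq_fun do rewrite /= scaler1.
split; first by apply/cvg_ex; exists d.
exact: cvg_lim h'.
Qed.

Lemma cderP f t d :
  cder f t d <-> ccvg 0^' (fun h : R => (h^-1)%:C * (f (h + t) - f t)) d.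
Proof.
rewrite /cder /ccvg !is_derive_cvgP.
have E1 : (fun h : R => Re ((h^-1)%:C * (f (h + t) - f t))) =
    (fun h : R => h^-1 * (Re (f (h + t)) - Re (f t))).
  by apply/funext => h; rewrite !ReImE/= mul0r subr0.
have E2 : (fun h : R => Im ((h^-1)%:C * (f (h + t) - f t))) =
    (fun h : R => h^-1 * (Im (f (h + t)) - Im (f t))).
  by apply/funext => h; rewrite !ReImE/= mul0r addr0.
by rewrite E1 E2.
Qed.

Lemma cder_ccvg f t d : cder f t d -> ccvg (nbhs t) f (f t).
Proof.
move=> [[h1 _] [h2 _]]; split.
  by move/derivable1_diffP : h1 => /differentiable_continuous.
by move/derivable1_diffP : h2 => /differentiable_continuous.
Qed.

End complex_basics.

(** * Power series *)

Section power_series.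
Context {R : realType}.
Implicit Types (z w u : R[i]) (g : R[i] -> R[i]) (a : nat -> R[i]).

Lemma cvg_ccvg {T} {F : set_system T} {FF : Filter F} (f : T -> R[i]) (l : R[i]) :
  (f : T -> R[i]^o) @ F --> (l : R[i]^o) -> ccvg F f l.
Proof.
move=> fl; apply/ccvg_normcP => e e0.
have /cvgrPdist_lt/(_ e%:C) := fl.
rewrite ltcR => /(_ e0); apply: filterS => w.
by rewrite normcE0 ltcR -opprB normc_opp.
Qed.

Lemma ccvg_normc_le {T} {F : set_system T} {FF : ProperFilter F} (f : T -> R[i]) l (B : R) :
  ccvg F f l -> (\forall t \near F, normc (f t) <= B) -> normc l <= B.
Proof.
move=> /ccvg_normc fl fB.
rewrite -(cvg_lim _ fl)//; apply: limr_le => //.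
by apply/cvg_ex; eexists; exact: fl.
Qed.

Definition psum a u (N : nat) : R[i] := \sum_(0 <= n < N) a n * u ^+ n.

(** A Cauchy estimate without contour integrals: at distance [r / 2] the partial sums converge,
    hence are bounded, and the terms are differences of consecutive partial sums. *)
Lemma analytic_bound g z : analytic_at g z ->
  exists a (rho M : R), [/\ 0 < rho, 0 <= M, (forall n, normc (a n) * rho ^+ n <= M) &
   forall w, normc (w - z) < rho -> ccvg \oo (psum a (w - z)) (g w)].
Proof.
move=> [a [r r0 ar]].
have hs w : normc (w - z) < r -> ccvg \oo (psum a (w - z)) (g w).
  by move=> wz; apply: cvg_ccvg; apply: ar; rewrite normcE0 ltcR.
pose rho := r / 2.
have rho0 : 0 < rho by rewrite divr_gt0.
have rhor : rho < r by rewrite /rho; lra.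
have h := hs (z + rho%:C).
rewrite addrAC subrr add0r normc_real gtr0_norm// in h.
have /cvg_seq_bounded [M [_ hM]] : cvg (normc (psum a rho%:C n) @[n --> \oo]).
  by apply/cvg_ex; eexists; exact: ccvg_normc (h rhor).
have M1 : M < `|M| + 1 by rewrite ltr_pwDr// ler_norm.
have {M1}hM n : normc (psum a rho%:C n) <= `|M| + 1.
  by have /= := hM _ M1 n I; rewrite ger0_norm ?normc_ge0.
exists a, rho, ((`|M| + 1) * 2); split => //.
- move=> n.
  have -> : normc (a n) * rho ^+ n = normc (psum a rho%:C n.+1 - psum a rho%:C n).
    by rewrite /psum big_nat_recr//= addrAC subrr add0r normcM normcX normc_real gtr0_norm.
  have := normc_triangle (psum a rho%:C n.+1) (- psum a rho%:C n).
  rewrite normc_opp; have := hM n.+1; have := hM n; lra.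
- by move=> w /lt_trans-/(_ _ rhor); exact: hs.
Qed.

Lemma sum_half_pow (c : R) N : 0 <= c -> \sum_(k < N) c * 2^-1 ^+ k <= c * 2.
Proof.
move=> c0.
suff : \sum_(k < N) c * 2^-1 ^+ k <= c * 2 * (1 - 2^-1 ^+ N).
  move/le_trans; apply; rewrite ler_piMr ?mulr_ge0// gerBl exprn_ge0//.
elim: N => [|N ih]; first by rewrite big_ord0 expr0 subrr mulr0.
rewrite big_ord_recr/= (le_trans (lerD ih (lexx _)))// exprS.
rewrite le_eqVlt; apply/orP; left; apply/eqP; lra.
Qed.

Lemma normc_subX u1 u2 (m : R) n : normc u1 <= m -> normc u2 <= m ->
  normc (u1 ^+ n.+1 - u2 ^+ n.+1) <= n.+1%:R * m ^+ n * normc (u1 - u2).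
Proof.
move=> h1 h2; have m0 : 0 <= m := le_trans (normc_ge0 _) h1.
elim: n => [|n ih]; first by rewrite !expr1 expr0 mulr1 mul1r.
have -> : u1 ^+ n.+2 - u2 ^+ n.+2 = u1 * (u1 ^+ n.+1 - u2 ^+ n.+1) + (u1 - u2) * u2 ^+ n.+1.
  by rewrite !exprS; ring.
rewrite (le_trans (normc_triangle _ _))// !normcM normcX.
have -> : n.+2%:R * m ^+ n.+1 * normc (u1 - u2) =
  m * (n.+1%:R * m ^+ n * normc (u1 - u2)) + normc (u1 - u2) * m ^+ n.+1.
  by rewrite -[n.+2%:R]natr1 exprS; ring.
apply: lerD.
  apply: ler_pM => //; exact: normc_ge0.
by apply: ler_wpM2l; [exact: normc_ge0|rewrite lerXn2r// nnegrE normc_ge0].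
Qed.

Lemma natr_le_expr2 n : n%:R <= 2 ^+ n :> R.
Proof. by rewrite -natrX ler_nat ltnW// ltn_expl. Qed.

(** The estimate holds for all pairs of points near [z], which yields the derivative at [z] and
    later its continuity, with no termwise differentiation. The terms of degree [k + 2] differ by at
    most [|a_(k+2)| (k+2) m^(k+1) |u1 - u2|]; as [k + 2 <= 2^(k+2)] and [m <= rho / 4], they are
    dominated by a geometric series of ratio 1/2. *)
Lemma analytic_strict_derivative g z : analytic_at g z ->
  exists (d : R[i]) (rho K : R), [/\ 0 < rho, 0 <= K &
   forall (m : R) w1 w2, m <= rho -> normc (w1 - z) <= m -> normc (w2 - z) <= m ->
     normc (g w1 - g w2 - d * (w1 - w2)) <= K * m * normc (w1 - w2)].
Proof.
move=> /analytic_bound[a [rho [M [rho0 M0 aM hs]]]].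
exists (a 1%N), (rho / 4), (8 * M / rho ^+ 2); split.
- by rewrite divr_gt0.
- by rewrite divr_ge0// ?mulr_ge0// ltW// exprn_gt0.
move=> m w1 w2 mrho h1 h2.
have m0 : 0 <= m := le_trans (normc_ge0 _) h1.
have rr : rho / 4 < rho by lra.
have c1 := hs w1 (le_lt_trans h1 (le_lt_trans mrho rr)).
have c2 := hs w2 (le_lt_trans h2 (le_lt_trans mrho rr)).
set u1 := w1 - z; set u2 := w2 - z.
have uE : w1 - w2 = u1 - u2 by rewrite /u1 /u2; ring.
rewrite uE; set d := normc (u1 - u2).
have d0 : 0 <= d := normc_ge0 _.
have cc : ccvg \oo (fun N => psum a u1 N - psum a u2 N - a 1%N * (u1 - u2))
   (g w1 - g w2 - a 1%N * (u1 - u2)).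
  apply: ccvgD; last by apply: ccvgN; exact: ccvg_cst.
  by apply: ccvgD => //; exact: ccvgN.
apply: (ccvg_normc_le cc); exists 2%N => // N /= N2.
rewrite -(subnKC N2) /psum !add2n !big_nat_recl//= !expr0 !expr1 !big_mkord.
set s1 := \sum_(i < _) _; set s2 := \sum_(i < _) _.
have -> : a 0%N * 1 + (a 1%N * u1 + s1) - (a 0%N * 1 + (a 1%N * u2 + s2)) -
   a 1%N * (u1 - u2) = s1 - s2 by ring.
rewrite -sumrB (le_trans (normc_sum _))//.
have c0 : 0 <= 4 * M * m / rho ^+ 2 * d.
  by rewrite !mulr_ge0// invr_ge0 exprn_ge0// ltW.
have -> : 8 * M / rho ^+ 2 * m * d = (4 * M * m / rho ^+ 2 * d) * 2 by ring.
apply: le_trans (sum_half_pow (N - 2)%N c0); apply: ler_sum => k _.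
rewrite -mulrBr normcM.
apply: (@le_trans _ _ (normc (a k.+2) * (k.+2%:R * m ^+ k.+1 * d))).
  by rewrite ler_wpM2l ?normc_ge0//; apply: normc_subX.
have ak : normc (a k.+2) <= M / rho ^+ k.+2 by rewrite ler_pdivlMr ?exprn_gt0.
apply: (@le_trans _ _ (M / rho ^+ k.+2 * (2 ^+ k.+2 * (m * (rho / 4) ^+ k) * d))).
  apply: ler_pM => //; rewrite ?normc_ge0 ?mulr_ge0 ?exprn_ge0//.
  apply: ler_wpM2r => //; apply: ler_pM; rewrite ?exprn_ge0 ?natr_le_expr2//.
  by rewrite exprS ler_wpM2l// lerXn2r// nnegrE ?divr_ge0// ltW.
have rn0 : rho != 0 by rewrite gt_eqF.
rewrite le_eqVlt; apply/orP; left; apply/eqP.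
have -> : (rho / 4) ^+ k = rho ^+ k * 2^-1 ^+ k / 2 ^+ k.
  rewrite !exprMn -mulrA; congr (_ * _); rewrite -exprVn -exprMn; congr (_ ^+ _).
  by rewrite -invfM -natrM.
rewrite (exprS rho) (exprS rho k) (exprS 2) (exprS 2 k) expr2.
have r1 : rho ^+ k != 0 by rewrite expf_neq0.
have r2 : 2 ^+ k != 0 :> R by rewrite expf_neq0.
by field; rewrite rn0 r1 r2.
Qed.

(** Strong induction on the coefficients: once those below [n] vanish, a zero at [z + u] gives
    [|a_n| |u|^n <= C |u|^(n+1)], and [u] can be taken as small as desired. *)
Lemma analytic_isolated_zero g z : analytic_at g z ->
  (forall e : R, 0 < e -> exists w, [/\ w != z, normc (w - z) < e & g w = 0]) ->
  exists2 rho : R, 0 < rho & forall w, normc (w - z) < rho -> g w = 0.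
Proof.
move=> /analytic_bound[a [rho [M [rho0 M0 aM hs]]]] zeros.
suff a0 n : a n = 0.
  exists rho => // w /hs hw.
  apply: (ccvg_unique _ hw); rewrite (_ : psum _ _ = fun=> 0); first exact: ccvg_cst.
  by apply/funext => N; rewrite /psum big1// => i _; rewrite a0 mul0r.
elim/ltn_ind: n => n ih.
apply: normc_eq0; apply/eqP; rewrite eq_le normc_ge0 andbT.
apply/ler_addgt0Pr => e e0; rewrite add0r.
pose C := M / rho ^+ n.+1 * 2.
have C0 : 0 <= C by rewrite !mulr_ge0// invr_ge0 exprn_ge0// ltW.
have e'0 : 0 < Num.min (rho / 2) (e / (C + 1)) by rewrite lt_min !divr_gt0// ltr_wpDl.
have [w [wz hw gw]] := zeros _ e'0.
move: hw; rewrite lt_min => /andP[hw1 hw2].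
set u := w - z in hw1 hw2.
have u0 : 0 < normc u.
  rewrite lt_neqAle normc_ge0 andbT eq_sym; apply: contra_neq wz => /normc_eq0.
  by move/eqP; rewrite subr_eq0 => /eqP.
have hwr : normc u < rho by lra.
have cu := hs w hwr; rewrite gw -/u in cu.
have cc : ccvg \oo (fun N => a n * u ^+ n - psum a u N) (a n * u ^+ n - 0).
  by apply: ccvgD; [exact: ccvg_cst|exact: ccvgN].
have : normc (a n * u ^+ n - 0) <= M / rho ^+ n.+1 * normc u ^+ n.+1 * 2.
  apply: (ccvg_normc_le cc); exists n.+1 => // N /= nN.
  rewrite -(subnKC nN) /psum (big_cat_nat (n:=n.+1)) ?leq_addr//= big_nat_recr//=.
  rewrite big_nat big1 => [|i /= /ih ->]; last by rewrite mul0r.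
  rewrite add0r opprD addrA subrr add0r normc_opp.
  rewrite -{1}[n.+1]add0n big_addn addKn big_mkord.
  rewrite (le_trans (normc_sum _))//.
  have c0 : 0 <= M / rho ^+ n.+1 * normc u ^+ n.+1.
    by rewrite !mulr_ge0// ?invr_ge0 exprn_ge0// ?normc_ge0// ltW.
  apply: le_trans (sum_half_pow (N - n.+1)%N c0); apply: ler_sum => k _.
  rewrite normcM normcX.
  have ak : normc (a (k + n.+1)%N) <= M / rho ^+ (k + n.+1) by rewrite ler_pdivlMr ?exprn_gt0.
  apply: (@le_trans _ _ (M / rho ^+ (k + n.+1) * normc u ^+ (k + n.+1))).
    by rewrite ler_wpM2r// exprn_ge0// normc_ge0.
  rewrite !exprD invfM.
  have -> : M * ((rho ^+ k)^-1 * (rho ^+ n.+1)^-1) * (normc u ^+ k * normc u ^+ n.+1) =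
    M / rho ^+ n.+1 * normc u ^+ n.+1 * ((normc u ^+ k) / rho ^+ k) by ring.
  rewrite ler_wpM2l// -exprVn -exprMn lerXn2r ?nnegrE ?divr_ge0 ?normc_ge0// ?ltW//.
  by rewrite ltr_pdivrMr//; lra.
rewrite subr0 normcM normcX exprS => h.
have : normc (a n) * normc u ^+ n <= (C * normc u) * normc u ^+ n.
  by apply: (le_trans h); rewrite /C !exprS le_eqVlt; apply/orP; left; apply/eqP; ring.
rewrite ler_pM2r ?exprn_gt0// => /le_trans; apply.
move: hw2; rewrite ltr_pdivlMr ?ltr_wpDl// => hw2.
by rewrite mulrC ltW// (le_lt_trans _ hw2)// ler_wpM2l ?ltW// ltrDl.
Qed.

End power_series.

(** * Holomorphic functions along curves *)

Section analytic.
Context {R : realType}.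
Implicit Types (z w : R[i]) (g : R[i] -> R[i]) (D : set R[i]).

Lemma ccvg_cvg {T} {F : set_system T} {FF : Filter F} (f : T -> R[i]) (l : R[i]) :
  ccvg F f l -> (f : T -> R[i]^o) @ F --> (l : R[i]^o).
Proof.
move=> /ccvg_normcP fl; apply/cvgrPdist_lt => e e0.
have eE : e = (Re e)%:C by case: e e0 => a b; rewrite ltcE/= => /andP[/eqP -> _].
have Re0 : 0 < Re e by move: e0; rewrite ltcE => /andP[].
move: (fl _ Re0); apply: filterS => w; rewrite eE normcE0 ltcR.
by rewrite -opprB normc_opp.
Qed.

Lemma ccvg_comp {T} {F : set_system T} {FF : Filter F} (f : T -> R[i]) g z l :
  ccvg (nbhs (z : R[i]^o)) g l -> ccvg F f z -> ccvg F (fun t => g (f t)) l.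
Proof.
move=> [g1 g2] fz; have fw := ccvg_cvg fz.
have {}fw := fw FF.
by split; [exact: (cvg_comp f _ fw g1)|exact: (cvg_comp f _ fw g2)].
Qed.

Lemma analytic_atP g z : analytic_at g z <->
  exists a (r : R), 0 < r /\ forall w, normc (w - z) < r -> ccvg \oo (psum a (w - z)) (g w).
Proof.
split=> [[a [r r0 ar]]|[a [r [r0 ar]]]].
  exists a, r; split => // w wz; apply: cvg_ccvg; apply: ar.
  by rewrite normcE0 ltcR.
exists a, r => // w wz; apply: ccvg_cvg; apply: ar.
by move: wz; rewrite normcE0 ltcR.
Qed.

(** Holomorphy in the form used by curve integrals: the chain rule along curves that are
    differentiable in a real parameter, with a continuous derivative. *)
Definition hol_on D g (dg : R[i] -> R[i]) : Prop :=
  [/\ forall (c : R -> R[i]) (t : R) (c' : R[i]), D (c t) -> cder c t c' ->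
        cder (fun u => g (c u)) t (dg (c t) * c'),
      ccont_on D dg & ccont_on D g].

Lemma analytic_hol D g : (forall z, D z -> analytic_at g z) -> exists dg, hol_on D g dg.
Proof.
move=> ana.
have : forall z, exists d, D z -> exists (rho K : R), [/\ 0 < rho, 0 <= K &
   forall (m : R) w1 w2, m <= rho -> normc (w1 - z) <= m -> normc (w2 - z) <= m ->
     normc (g w1 - g w2 - d * (w1 - w2)) <= K * m * normc (w1 - w2)].
  move=> z; have [Dz|nDz] := pselect (D z); last by exists 0.
  by have [d [rho [K h]]] := analytic_strict_derivative (ana _ Dz); exists d => _; exists rho, K.
move/choice => [dg hdg].
have z1 z : D z -> exists q : R[i] -> R[i], (forall w, g w - g z = q w * (w - z)) /\
     ccvg (nbhs (z : R[i]^o)) q (dg z).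
  move=> Dz; have [rho [K [rho0 K0 hK]]] := hdg z Dz.
  (* Caratheodory's form of the derivative: the quotient is continuous at [z], and the chain rule
     involves no division by increments of the curve, which may vanish. *)
  exists (fun w => if w == z then dg z else (g w - g z) / (w - z)); split.
    move=> v; have [->|vz] := eqVneq v z; first by rewrite !subrr mulr0.
    by rewrite divfK// subr_eq0.
  apply/ccvg_normcP => e e0; apply/nbhsC_normcP.
  exists (Num.min rho (e / (K + 1))); first by rewrite lt_min rho0 divr_gt0// ltr_wpDl.
  move=> v; rewrite lt_min => /andP[v1 v2].
  case: ifPn => [_|vz]; first by rewrite subrr ComplexField.Normc.normc0.
  have vz0 : 0 < normc (v - z).
    rewrite lt_neqAle normc_ge0 andbT eq_sym; apply: contra_neq vz => /normc_eq0.
    by move/eqP; rewrite subr_eq0 => /eqP.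
  have := hK _ v z (ltW v1) (lexx _); rewrite subrr ComplexField.Normc.normc0.
  move=> /(_ (normc_ge0 _)) h.
  rewrite -(ltr_pM2r vz0) -normcM mulrBl divfK ?subr_eq0//.
  apply: (le_lt_trans h); rewrite ltr_pM2r//.
  move: v2; rewrite ltr_pdivlMr ?ltr_wpDl// => v2; rewrite mulrC.
  by rewrite (le_lt_trans _ v2)// ler_wpM2l// ?ltW// ltrDl.
exists dg; split.
- move=> c t c' Dc cc'.
  have [q [qE qc]] := z1 _ Dc.
  have /cderP c1 := cc'.
  apply/cderP.
  have -> : (fun h : R => (h^-1)%:C * (g (c (h + t)) - g (c t))) =
    (fun h : R => q (c (h + t)) * ((h^-1)%:C * (c (h + t) - c t))).
    by apply/funext => h; rewrite qE; ring.
  apply: ccvgM c1.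
  have ct : ccvg 0^' (fun h : R => c (h + t)) (c t).
    have hh : h + t @[h --> 0^'] --> t.
      rewrite -[X in _ --> X]add0r.
      apply: cvgD; last exact: cvg_cst.
      exact: nbhs_dnbhs.
    have [h1 h2] := cder_ccvg cc'.
    by split; [exact: (cvg_comp _ _ hh h1)|exact: (cvg_comp _ _ hh h2)].
  exact: ccvg_comp qc ct.
- move=> z Dz; apply/ccvg_normcP => e e0; apply/nbhsC_normcP.
  have [rho [K [rho0 K0 hK]]] := hdg z Dz.
  have e'0 : 0 < Num.min rho (e / (K + 2)) by rewrite lt_min rho0 divr_gt0// ltr_wpDl.
  set m := Num.min _ _ in e'0.
  have mrho : m <= rho by rewrite ge_min lexx.
  have mE : m * (K + 2) <= e by rewrite -ler_pdivlMr ?ltr_wpDl// ge_min lexx orbT.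
  exists m => // w wz Dw.
  have [rho' [K' [rho'0 K'0 hK']]] := hdg w Dw.
  (* The derivatives at [z] and [w] are compared through the increment from [w] to [w + h]: [h] fits
     both neighbourhoods and keeps the error [K' * h] of the expansion at [w] below [m]. *)
  pose h := Num.min (Num.min rho' (m / (K' + 1))) (m - normc (w - z)).
  have h0 : 0 < h by rewrite !lt_min rho'0 subr_gt0 wz divr_gt0// ltr_wpDl.
  have h1 : h <= rho' by rewrite /h !ge_min lexx.
  have h2 : h * (K' + 1) <= m.
    by rewrite -ler_pdivlMr ?ltr_wpDl// /h !ge_min lexx orbT.
  have h3 : h <= m - normc (w - z) by rewrite /h !ge_min lexx orbT.
  pose v := w + h%:C.
  have vw : v - w = h%:C by rewrite /v; ring.
  have nvw : normc (v - w) = h by rewrite vw normc_real gtr0_norm.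
  have nvw' : normc (v - w) <= h by rewrite nvw.
  have vz : normc (v - z) <= m.
    have -> : v - z = (v - w) + (w - z) by ring.
    by have := normc_triangle (v - w) (w - z); lra.
  have a1 := hK m v w mrho vz (ltW wz).
  have a2 := hK' h v w h1 nvw'.
  rewrite subrr ComplexField.Normc.normc0 in a2; have {}a2 := a2 (ltW h0).
  rewrite nvw in a1 a2.
  have a3 : normc (dg w - dg z) * h <= (K * m + K' * h) * h.
    have -> : normc (dg w - dg z) * h = normc ((g v - g w - dg z * (v - w)) +
       - (g v - g w - dg w * (v - w))).
      rewrite -{1}nvw -normcM; congr normc; ring.
    rewrite (le_trans (normc_triangle _ _))// normc_opp mulrDl lerD//.
  rewrite ler_pM2r// in a3.
  apply: (le_lt_trans a3); apply: lt_le_trans mE.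
  rewrite mulrDr [m * K]mulrC ltrD2l.
  by apply: (@le_lt_trans _ _ m); [rewrite mulrC; lra|lra].
- move=> z Dz; have [q [qE qc]] := z1 _ Dz.
  have idc : ccvg (within D (nbhs (z : R[i]^o))) id z := @ccont_on_id _ D z Dz.
  have qc' : ccvg (within D (nbhs (z : R[i]^o))) q (dg z) by exact: ccvg_comp qc idc.
  suff : ccvg (within D (nbhs (z : R[i]^o))) (fun w => g z + q w * (w - z)) (g z + dg z * (z - z)).
    rewrite subrr mulr0 addr0; congr ccvg; apply/funext => w.
    by rewrite -qE addrC subrK.
  apply: ccvgD; first exact: ccvg_cst.
  apply: ccvgM => //; apply: ccvgD => //; exact: ccvg_cst.
Qed.

End analytic.

(** * The domain of analyticity *)

Section geometry.
Context {R : realType}.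
Implicit Types (z w : R[i]).

(** A direction is recorded by its tangent, which makes rays polynomial; a bound of the cone equal
    to [pi / 2] in absolute value then restricts nothing. *)
Definition slope (gm gp m : R) : Prop := gm < atan m < gp.

Lemma tan_bounds (phi : R) : - (pi / 2) < phi < pi / 2 -> 0 < cos phi /\ atan (tan phi) = phi.
Proof.
move=> h; split; first exact: cos_gt0_pihalf.
by apply: tanK; rewrite in_itv.
Qed.

(** The two halves of the cone mirror each other, so that [|Re z|] treats both at once: the slope is
    [tan phi] on the right and [tan (pi - phi)] on the left. *)
Lemma strip_plus_coneP (mum mup gm gp : R) z :
  - (pi / 2) <= gm -> gm < 0 -> 0 < gp -> gp <= pi / 2 ->
  strip_plus_cone mum mup gm gp z <->
  exists theta m : R, [/\ mum < theta < mup, slope gm gp m & Im z = theta + `|Re z| * m].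
Proof.
move=> hgm gm0 gp0 hgp; split.
  move=> [theta [w [ht hw ->]]]; exists theta.
  have R1 : Re ('i%C * theta%:C + w) = Re w by rewrite !ReImE/=; ring.
  have I1 : Im ('i%C * theta%:C + w) = theta + Im w by rewrite !ReImE/=; ring.
  rewrite R1 I1; case: hw => [[rho [phi [rho0 hphi ->]]]|->]; last first.
    by exists 0; split => //; [rewrite /slope atan0 gm0 gp0|rewrite /= mulr0].
  rewrite Re_polar Im_polar; case: hphi => /andP[p1 p2].
    have [c0 tE] := @tan_bounds phi ltac:(lra).
    exists (tan phi); split => //; first by rewrite /slope tE p1.
    by rewrite ger0_norm ?mulr_ge0 ?ltW// /tan mulrA -[rho * _ * _]mulrA [cos _ * _]mulrC mulrA mulfK// gt_eqF.
  have [c0 tE] := @tan_bounds (pi - phi) ltac:(lra).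
  have cE : cos phi = - cos (pi - phi).
    by rewrite cosB cospi sinpi; ring.
  have sE : sin phi = sin (pi - phi).
    by rewrite sinB cospi sinpi; ring.
  exists (tan (pi - phi)); split => //; first by rewrite /slope tE; apply/andP; split; lra.
  rewrite cE mulrN normrN ger0_norm ?mulr_ge0 ?ltW// /tan sE.
  by congr (_ + _); field; rewrite gt_eqF.
move=> [theta [m [ht hm zE]]]; exists theta, (z - 'i%C * theta%:C).
split; [exact: ht| |by rewrite addrC subrK].
have R1 : Re (z - 'i%C * theta%:C) = Re z by rewrite !ReImE/=; ring.
have I1 : Im (z - 'i%C * theta%:C) = `|Re z| * m by rewrite !ReImE/= zE; ring.
set w := z - _ in R1 I1 *.
have [x0|x0|x0] := ltgtP (Re z) 0; last first.
- right; apply: eqC; rewrite ?R1 ?I1 x0//= normr0 mul0r//.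
- left; have c0 : 0 < cos (atan m).
    by apply: (proj1 (tan_bounds _)); rewrite atan_gtNpi2 atan_ltpi2.
  exists (Re z / cos (atan m)), (atan m); split; [by rewrite divr_gt0|by left|].
  have tE := @atanK R m.
  apply: eqC; rewrite ?R1 ?I1 ?(Re_polar,Im_polar).
    by rewrite divfK// gt_eqF.
  by rewrite gtr0_norm// -{1}tE /tan; ring.
- left; have c0 : 0 < cos (atan m).
    by apply: (proj1 (tan_bounds _)); rewrite atan_gtNpi2 atan_ltpi2.
  exists (- Re z / cos (atan m)), (pi - atan m); split.
  + by rewrite divr_gt0// oppr_gt0.
  + by right; move: hm => /andP[]; lra.
  have tE := @atanK R m.
  apply: eqC; rewrite ?R1 ?I1 ?(Re_polar,Im_polar).
    by rewrite cosB cospi sinpi; field; rewrite gt_eqF.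
  by rewrite sinB cospi sinpi ltr0_norm// -{1}tE /tan; ring.
Qed.

Definition dom (mum mup gm gp : R) : set R[i] := [set z |
  exists theta m : R, [/\ mum < theta < mup, slope gm gp m & Im z = theta + `|Re z| * m]].

Definition refl z : R[i] := - z^*%C.

Lemma Re_refl z : Re (refl z) = - Re z. Proof. by rewrite ReN Re_conj. Qed.
Lemma Im_refl z : Im (refl z) = Im z. Proof. by rewrite ImN Im_conj opprK. Qed.

Section dom.
Context {mum mup gm gp : R} (mum0 : mum <= 0) (mup0 : 0 <= mup) (mu_lt : mum < mup)
  (gm0 : gm < 0) (gp0 : 0 < gp).
Let D := dom mum mup gm gp.

Lemma slope_cvx m1 m2 v : 0 <= v <= 1 -> slope gm gp m1 -> slope gm gp m2 ->
  slope gm gp ((1 - v) * m1 + v * m2).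
Proof.
move=> /andP[v0 v1]; wlog m12 : m1 m2 v v0 v1 / m1 <= m2.
  move=> wl h1 h2; have [|/ltW] := leP m1 m2; first by move/wl; apply.
  move=> /(wl _ _ (1 - v)) h.
  have -> : (1 - v) * m1 + v * m2 = (1 - (1 - v)) * m2 + (1 - v) * m1 by ring.
  by apply: h => //; lra.
move=> /andP[h1 h2] /andP[h3 h4]; apply/andP; split.
  by apply: (lt_le_trans h1); apply: le_atan; nra.
by apply: le_lt_trans h4; apply: le_atan; nra.
Qed.

Lemma itv_scale th (t : R) : mum < th < mup -> 0 < t <= 1 -> mum < t * th < mup.
Proof.
move=> /andP[h1 h2] /andP[t0 t1].
have h3 : t * mum < t * th by rewrite ltr_pM2l.
have h4 : t * th < t * mup by rewrite ltr_pM2l.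
have h5 : 0 <= (1 - t) * (- mum) by rewrite mulr_ge0// ?subr_ge0// oppr_ge0.
have h6 : 0 <= (1 - t) * mup by rewrite mulr_ge0// subr_ge0.
by apply/andP; split; lra.
Qed.

Lemma itv_cvx t1 t2 (v : R) : mum < t1 < mup -> mum < t2 < mup -> 0 <= v <= 1 ->
  mum < (1 - v) * t1 + v * t2 < mup.
Proof.
move=> /andP[h1 h2] /andP[h3 h4] /andP[v0 v1].
have [->|v0'] := eqVneq v 0; first by apply/andP; split; lra.
have {}v0 : 0 < v by rewrite lt_neqAle eq_sym v0'.
have h5 : v * mum < v * t2 by rewrite ltr_pM2l.
have h6 : v * t2 < v * mup by rewrite ltr_pM2l.
have h7 : (1 - v) * mum <= (1 - v) * t1 by rewrite ler_wpM2l ?subr_ge0// ltW.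
have h8 : (1 - v) * t1 <= (1 - v) * mup by rewrite ler_wpM2l ?subr_ge0// ltW.
by apply/andP; split; lra.
Qed.

Lemma dom_refl z : D z -> D (refl z).
Proof. by move=> [th [m [h1 h2 h3]]]; exists th, m; rewrite Re_refl Im_refl normrN. Qed.

(** Star-shapedness about 0, with [t = 0] excluded since 0 is outside the domain when [mum = 0] or
    [mup = 0]. *)
Lemma dom_scale z (t : R) : D z -> 0 < t <= 1 -> D (t%:C * z).
Proof.
move=> [th [m [h1 h2 h3]]] /andP[t0 t1]; exists (t * th), m; split => //.
  by apply: itv_scale => //; rewrite t0.
by rewrite !ReImE/= h3 !mul0r subr0 addr0 normrM (gtr0_norm t0); ring.
Qed.

Lemma dom_cvx z w v : 0 < Re z -> 0 < Re w -> D z -> D w -> 0 <= v <= 1 ->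
  D (z + v%:C * (w - z)).
Proof.
move=> z0 w0 [t1 [m1 [h1 h2 h3]]] [t2 [m2 [h4 h5 h6]]] v01.
have [v0 v1] := andP v01.
have RE : Re (z + v%:C * (w - z)) = (1 - v) * Re z + v * Re w by rewrite !ReImE/=; ring.
have R0 : 0 < Re (z + v%:C * (w - z)) by rewrite RE; nra.
exists ((1 - v) * t1 + v * t2).
(* The slope of the combination averages [m1] and [m2] with the shares of the two points in its real
   part. *)
pose v' := v * Re w / Re (z + v%:C * (w - z)).
exists ((1 - v') * m1 + v' * m2); split.
- exact: itv_cvx.
- apply: slope_cvx => //; apply/andP; split; first by rewrite divr_ge0 ?mulr_ge0// ltW.
  by rewrite ler_pdivrMr// RE; nra.
rewrite (gtr0_norm R0); set X := Re (z + _).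
have -> : X * ((1 - v') * m1 + v' * m2) = X * m1 - (X * v') * m1 + (X * v') * m2 by ring.
have -> : X * v' = v * Re w by rewrite /v' mulrC divfK// gt_eqF.
by rewrite /X RE !ReImE/= h3 h6 (gtr0_norm z0) (gtr0_norm w0); ring.
Qed.

Lemma dom_open z : D z -> exists2 d : R, 0 < d & forall w, normc (w - z) < d -> D w.
Proof.
move=> [t [m [/andP[h1 h2] h3 h4]]].
pose e := Num.min (t - mum) (mup - t).
have e0 : 0 < e by rewrite lt_min !subr_gt0 h1.
have [e1 e2] : e <= t - mum /\ e <= mup - t by split; rewrite ge_min lexx ?orbT.
have m1 : 0 < 1 + `|m| by rewrite ltr_wpDr.
exists (e / (1 + `|m|)); first by rewrite divr_gt0.
move=> w; rewrite ltr_pdivlMr// => hw.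
exists (Im w - `|Re w| * m), m; split; [|by []|by rewrite subrK].
suff : `|Im w - `|Re w| * m - t| < e.
  by rewrite ltr_distl => /andP[]; move=> *; apply/andP; split; lra.
apply: le_lt_trans hw.
have -> : Im w - `|Re w| * m - t = Im (w - z) + (`|Re z| - `|Re w|) * m.
  by rewrite ImD ImN h4; ring.
rewrite (le_trans (ler_normD _ _))// mulrDr mulr1 lerD ?normc_Im//.
rewrite normrM ler_wpM2r//.
by rewrite (le_trans (ler_dist_dist _ _))// distrC -ReN -ReD normc_Re.
Qed.

Lemma slope_open m : slope gm gp m -> exists2 d : R, 0 < d &
  forall m', `|m' - m| < d -> slope gm gp m'.
Proof.
move=> /andP[h1 h2].
have c := @continuous_atan R m.
have /cvgrPdist_lt c1 := c.
pose e := Num.min (atan m - gm) (gp - atan m).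
have e0 : 0 < e by rewrite lt_min !subr_gt0 h1.
have [e1 e2] : e <= atan m - gm /\ e <= gp - atan m by split; rewrite ge_min lexx ?orbT.
have /nbhs_ballP[d /= d0 hd] := c1 e e0.
exists d => // m' hm; have := hd m'; rewrite /ball/= distrC => /(_ hm).
by rewrite ltr_distl => /andP[? ?]; apply/andP; split; lra.
Qed.

(** Even when 0 is an end of the strip the open cone lies in the domain: a slight tilt of the slope
    makes up for a small vertical shift [t * th] into the strip. *)
Lemma dom_cone z m : Re z != 0 -> slope gm gp m -> Im z = `|Re z| * m -> D z.
Proof.
move=> x0 hm zE; have [d d0 hd] := slope_open hm.
have n0 : 0 < `|Re z| by rewrite normr_gt0.
pose th := (mum + mup) / 2.
pose t := Num.min 1 (d * `|Re z| / (`|th| + 1)).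
have t0 : 0 < t.
  by rewrite lt_min ltr01 divr_gt0// ?mulr_gt0// ltr_wpDl.
have t1 : t <= 1 by rewrite ge_min lexx.
have t2 : t * (`|th| + 1) <= d * `|Re z|.
  by rewrite -ler_pdivlMr ?ltr_wpDl// ge_min lexx orbT.
exists (t * th), (m - t * th / `|Re z|); split.
- apply: itv_scale; last by rewrite t0.
  by rewrite !midf_lt.
- apply: hd; rewrite addrAC subrr add0r normrN normrM normfV normr_id normrM (gtr0_norm t0).
  rewrite ltr_pdivrMr// (lt_le_trans _ t2)// ltr_pM2l// ltrDl//.
- by rewrite zE; field; rewrite gt_eqF.
Qed.

Lemma dom_real (x : R) : x != 0 -> D x%:C.
Proof.
move=> x0; apply: (@dom_cone _ 0) => //; first by rewrite /slope atan0 gm0.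
by rewrite mulr0.
Qed.

End dom.
End geometry.

(** * Reflection in the imaginary axis *)

Section reflection.
Context {R : realType}.
Implicit Types (z w : R[i]) (g : R[i] -> R[i]).

Lemma ccvg_conj {T} {F : set_system T} {FF : Filter F} (f : T -> R[i]) l :
  ccvg F f l -> ccvg F (fun t => (f t)^*%C) l^*%C.
Proof.
move=> [h1 h2]; split.
  by under eq_fun do rewrite Re_conj; rewrite Re_conj.
by under eq_fun do rewrite Im_conj; rewrite Im_conj; exact: cvgN.
Qed.

Lemma conjcX z n : (z ^+ n)^*%C = z^*%C ^+ n.
Proof. exact: (rmorphXn (@conjc R)). Qed.

Lemma refl_sub z w : refl z - refl w = refl (z - w).
Proof. by rewrite /refl rmorphB opprB opprK addrC. Qed.

(** Since [refl w - refl z] is minus the conjugate of [w - z], the reflected function has the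
    conjugate coefficients with alternating signs. *)
Lemma analytic_refl_sub g z : analytic_at g z -> analytic_at g (refl z) ->
  analytic_at (fun w => g w - (g (refl w))^*%C) z.
Proof.
move=> /analytic_atP[a [r [r0 ar]]] /analytic_atP[b [s [s0 bs]]].
apply/analytic_atP; exists (fun n => a n - (b n)^*%C * (-1) ^+ n), (Num.min r s).
split; first by rewrite lt_min r0.
move=> w; rewrite lt_min => /andP[wr ws].
have -> : psum (fun n : nat => a n - (b n)^*%C * (-1) ^+ n) (w - z) =
  (fun N => psum a (w - z) N - (psum b (refl w - refl z) N)^*%C).
  apply/funext => N; rewrite /psum rmorph_sum -sumrB; apply: eq_bigr => n _.
  rewrite rmorphM /= conjcX refl_sub /refl mulrBl; congr (_ - _).
  have -> : (- (w - z)^*%C)^*%C = - (w - z) :> R[i].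
    by apply: eqC; rewrite !(Re_conj, Im_conj, ReN, ImN) ?opprK.
  by rewrite [in RHS]exprNn mulrA.
apply: ccvgD; first exact: ar.
apply/ccvgN/ccvg_conj/bs; rewrite refl_sub /refl normc_opp normc_conj//.
Qed.

(** The supremum of the initial intervals on which [g] vanishes is an accumulation point of zeros,
    or the start of the segment; [g] vanishes around it, so that it can be moved further unless it
    is 1. *)
Lemma identity_segment g z w : (forall v : R, 0 <= v <= 1 -> analytic_at g (z + v%:C * (w - z))) ->
  (exists2 d : R, 0 < d & forall u : R[i], normc (u - z) < d -> g u = 0) -> g w = 0.
Proof.
move=> ana [d d0 gd].
have [->|wz] := eqVneq w z; first by apply: gd; rewrite subrr ComplexField.Normc.normc0.
have nwz : 0 < normc (w - z).
  rewrite lt_neqAle normc_ge0 andbT eq_sym; apply: contra_neq wz => /normc_eq0.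
  by move/eqP; rewrite subr_eq0 => /eqP.
set c := fun v : R => z + v%:C * (w - z).
have cc v v' : c v - c v' = (v - v')%:C * (w - z) by rewrite /c rmorphB /=; ring.
have ncc v v' : normc (c v - c v') = `|v - v'| * normc (w - z).
  by rewrite cc normcM normc_real.
pose S := [set t : R | 0 <= t <= 1 /\ forall v, 0 <= v <= t -> g (c v) = 0].
have S0 : S 0.
  split; first by rewrite lexx ler01.
  move=> v /andP[v0 v1]; have -> : v = 0 by apply/eqP; rewrite eq_le v0 v1.
  by apply: gd; rewrite /c mul0r addr0 subrr ComplexField.Normc.normc0.
have hS : has_sup S by split; [exists 0|exists 1 => t [/andP[]]].
set s := sup S.
have s0 : 0 <= s by apply: ub_le_sup => //; case: hS.
have s1 : s <= 1 by apply: ge_sup; [exists 0|move=> t [/andP[]]].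
have below v : 0 <= v < s -> g (c v) = 0.
  move=> /andP[v0 vs]; have [t [_ tS] vt] := sup_gt (proj1 hS) vs.
  by apply: tS; rewrite v0 ltW.
have [rho rho0 hrho] : exists2 rho : R, 0 < rho & forall u : R[i], normc (u - c s) < rho -> g u = 0.
  have [s00|sn0] := eqVneq s 0.
    by exists d => // u; rewrite s00 /c mul0r addr0; exact: gd.
  apply: analytic_isolated_zero; first by apply: ana; rewrite s0.
  move=> e e0.
  have sgt : 0 < s by rewrite lt_neqAle eq_sym sn0.
  pose h := Num.min s (e / normc (w - z)) / 2.
  have h0 : 0 < h by rewrite divr_gt0// lt_min sgt divr_gt0.
  have h1 : h < s.
    have : Num.min s (e / normc (w - z)) <= s by rewrite ge_min lexx.
    by rewrite /h; lra.
  have h2 : h * normc (w - z) < e.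
    rewrite -ltr_pdivlMr//.
    have : Num.min s (e / normc (w - z)) <= e / normc (w - z) by rewrite ge_min lexx orbT.
    have : 0 < e / normc (w - z) by rewrite divr_gt0.
    by rewrite /h; lra.
  exists (c (s - h)); split.
  + rewrite -subr_eq0 cc; apply/negP => /eqP/(congr1 (@ComplexField.Normc.normc R)).
    rewrite normcM normc_real ComplexField.Normc.normc0 => /eqP.
    rewrite mulf_eq0 gt_eqF ?orbF// ?(gt_eqF nwz)// normr_gt0.
    by rewrite subr_eq0 lt_eqF//; lra.
  + rewrite ncc; have -> : s - h - s = - h by ring.
    by rewrite normrN gtr0_norm.
  + by apply: below; apply/andP; split; lra.
have [s1'|sn1] := eqVneq s 1.
  have -> : w = c s by rewrite s1' /c; ring.
  by apply: hrho; rewrite subrr ComplexField.Normc.normc0.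
have slt : s < 1 by rewrite lt_neqAle sn1.
pose h := Num.min (1 - s) (rho / normc (w - z) / 2).
have h0 : 0 < h by rewrite lt_min subr_gt0 slt !divr_gt0.
have h1 : h <= 1 - s by rewrite /h ge_min lexx.
have h2 : h * normc (w - z) < rho.
  rewrite -ltr_pdivlMr//.
  have : h <= rho / normc (w - z) / 2 by rewrite /h ge_min lexx orbT.
  have : 0 < rho / normc (w - z) by rewrite divr_gt0.
  by lra.
suff : S (s + h).
  have hub : has_ubound S by case: hS.
  by move/(ub_le_sup hub) => H; exfalso; move: H; rewrite -/s; lra.
split; first by apply/andP; split; lra.
move=> v /andP[v0 vs]; have [vs'|vs'] := ltP v s; first by apply: below; rewrite v0.
apply: hrho; rewrite ncc ger0_norm ?subr_ge0//.
by apply: le_lt_trans h2; rewrite ler_pM2r//; lra.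
Qed.

(** Segments are used in the right half of the domain only, which is convex while the whole need not
    be. There the difference vanishes because its real zeros accumulate at 1; the imaginary axis is
    reached as a limit from the right, the left half by the symmetry of the difference itself. *)
Lemma reflection_symmetry (mum mup gm gp : R) g : mum <= 0 -> 0 <= mup -> mum < mup ->
  gm < 0 -> 0 < gp -> let D := dom mum mup gm gp in
  (forall z, D z -> analytic_at g z) ->
  (forall x : R, x != 0 -> g (- x)%:C = (g x%:C)^*%C) ->
  forall z, D z -> g (refl z) = (g z)^*%C.
Proof.
move=> mum0 mup0 mu_lt gm0 gp0 D ana gsym.
pose k w := g w - (g (refl w))^*%C.
have kana z : D z -> analytic_at k z.
  by move=> Dz; apply: analytic_refl_sub; apply: ana => //; exact: dom_refl.
have kreal (x : R) : x != 0 -> k x%:C = 0.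
  move=> x0; rewrite /k.
  have -> : refl x%:C = (- x)%:C by apply: eqC; rewrite /refl /= ?oppr0.
  by rewrite gsym// conjcK subrr.
have D1 : D 1 by apply: (@dom_real _ _ _ _ _ mum0 mup0 mu_lt gm0 gp0 1); rewrite oner_neq0.
have kpos z : 0 < Re z -> D z -> k z = 0.
  move=> z0 Dz; apply: (@identity_segment k 1).
    by move=> v v01; apply: kana; apply: dom_cvx => //=; rewrite ltr01.
  apply: analytic_isolated_zero; first exact: kana.
  move=> e e0; exists (1 + e / 2)%:C; split.
  - by rewrite -subr_eq0; apply/negP => /eqP/(congr1 (@complex.Re R)) /=; lra.
  - have -> : (1 + e / 2)%:C - 1 = (e / 2)%:C :> R[i] by apply: eqC; rewrite !ReImE/=; ring.
    by rewrite normc_real gtr0_norm; lra.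
  - by apply: kreal; rewrite gt_eqF//; lra.
have kzero z : Re z = 0 -> D z -> k z = 0.
  move=> z0 Dz.
  suff [rho rho0 h] : exists2 rho : R, 0 < rho & forall w, normc (w - z) < rho -> k w = 0.
    by apply: h; rewrite subrr ComplexField.Normc.normc0.
  apply: analytic_isolated_zero; first exact: kana.
  move=> e e0; have [d d0 hd] := dom_open Dz.
  pose h := Num.min d e / 2.
  have h0 : 0 < h by rewrite divr_gt0// lt_min d0.
  have hd' : h < d by have : Num.min d e <= d by [rewrite ge_min lexx]; rewrite /h; lra.
  have he : h < e by have : Num.min d e <= e by [rewrite ge_min lexx orbT]; rewrite /h; lra.
  have nh : normc (z + h%:C - z) = h.
    by rewrite addrAC subrr add0r normc_real gtr0_norm.
  exists (z + h%:C); split.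
  - by rewrite -subr_eq0; apply/negP => /eqP/(congr1 (@complex.Re R)); rewrite !ReImE/=; lra.
  - by rewrite nh.
  - apply: kpos; first by rewrite ReD z0 /= add0r.
    by apply: hd; rewrite nh.
have kk z : D z -> k z = 0.
  move=> Dz; have [x0|x0|x0] := ltgtP (Re z) 0; [|exact: kpos|exact: kzero].
  have : k (refl z) = 0.
    by apply: kpos; [rewrite Re_refl oppr_gt0|exact: dom_refl].
  have rK : refl (refl z) = z by apply: eqC; rewrite ?(Re_refl, Im_refl) ?opprK.
  rewrite /k rK => /eqP; rewrite subr_eq0 => /eqP ->.
  by rewrite conjcK subrr.
move=> z /kk /eqP; rewrite subr_eq0 => /eqP ->.
by rewrite conjcK.
Qed.

End reflection.

(** * Integrals along curves *)

Section curve_integrals.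
Context {R : realType}.
Implicit Types (z w : R[i]) (g : R[i] -> R[i]).
Notation leb := (@lebesgue_measure R).

Definition cint (a b : R) (k : R -> R[i]) : R[i] := cintegral leb `[a, b] k.

Definition ccont_itv (a b : R) (c : R -> R[i]) : Prop :=
  forall t, a <= t <= b -> ccvg (within `[a, b] (nbhs t)) c (c t).

Lemma ccont_itv_Re a b c : ccont_itv a b c -> {within `[a, b], continuous (fun t => Re (c t))}.
Proof.
move=> h; apply/subspace_continuousP => t; rewrite /= in_itv /= => /h[].
by [].
Qed.

Lemma ccont_itv_Im a b c : ccont_itv a b c -> {within `[a, b], continuous (fun t => Im (c t))}.
Proof.
move=> h; apply/subspace_continuousP => t; rewrite /= in_itv /= => /h[].
by [].
Qed.

Lemma ccont_itv_comp a b S g c : ccont_on S g -> (forall t, a <= t <= b -> S (c t)) ->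
  ccont_itv a b c -> ccont_itv a b (fun t => g (c t)).
Proof.
move=> gc Sc cc t tab; apply: (ccont_on_comp gc (Sc _ tab)); last exact: cc.
rewrite near_withinE; apply: nearW => u; rewrite /= in_itv/= => uab; exact: Sc.
Qed.

Lemma ccont_itv_cts a b (c : R -> R[i]) : (forall t, ccvg (nbhs t) c (c t)) -> ccont_itv a b c.
Proof.
move=> h t _; have [h1 h2] := h t.
by split; apply: cvg_trans; [|exact: h1| |exact: h2]; apply: cvg_app; exact: cvg_within.
Qed.

Lemma ccont_itv_integrable a b c : ccont_itv a b c -> cintegrable leb `[a, b] c.
Proof.
move=> h; split; apply: continuous_compact_integrable.
- exact: segment_compact.
- exact: ccont_itv_Re.
- exact: segment_compact.
- exact: ccont_itv_Im.
Qed.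

(** Differentiability is asked inside the interval only, since paths may start at 0, where only
    continuity is known. *)
Lemma cfundamental a b (c k : R -> R[i]) : a < b -> ccont_itv a b c -> ccont_itv a b k ->
  (forall t, a < t < b -> cder c t (k t)) -> cint a b k = c b - c a.
Proof.
move=> ab cc kc dc.
have main (r f : R -> R) : {within `[a, b], continuous f} -> {within `[a, b], continuous r} ->
    (forall t : R, a < t < b -> is_derive t 1 r (f t)) ->
    Rintegral leb `[a, b] f = r b - r a.
  move=> fc rc dr; rewrite /Rintegral (@continuous_FTC2 _ f r)//.
  - have /(continuous_within_itvP _ ab)[_ r1 r2] := rc.
    split => // t; rewrite in_itv /= => /dr h; exact: (@ex_derive _ _ _ _ _ _ _ h).
  - move=> t; rewrite in_itv /= => /dr h; rewrite derive1E; exact: derive_val.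
apply: eqC => /=.
  rewrite ReD ReN; apply: (main (fun t => Re (c t))) => [||t /dc[]//]; exact: ccont_itv_Re.
rewrite ImD ImN; apply: (main (fun t => Im (c t))) => [||t /dc[]//]; exact: ccont_itv_Im.
Qed.

Lemma fine_leb_itv (a b : R) : a <= b -> fine (leb `[a, b]) = b - a.
Proof.
move=> ab; rewrite lebesgue_measure_itv /= lte_fin; case: ltP => //= ba.
by rewrite (@le_anti _ _ a b) ?ab// subrr.
Qed.

Lemma leb_integrable_cst (a b B : R) : leb.-integrable `[a, b] (EFin \o (fun=> B)).
Proof.
apply: continuous_compact_integrable; first exact: segment_compact.
by apply: continuous_subspaceT => x; exact: cvg_cst.
Qed.

Lemma Rintegral_bound (f : R -> R) (a b B : R) : a <= b ->
  leb.-integrable `[a, b] (EFin \o f) -> (forall t, a <= t <= b -> `|f t| <= B) ->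
  `|Rintegral leb `[a, b] f| <= B * (b - a).
Proof.
move=> ab fi fB; rewrite (le_trans (le_normr_Rintegral _ fi))//.
rewrite -(fine_leb_itv ab) -Rintegral_cst//; apply: le_Rintegral => //.
- exact: integrable_norm.
- exact: leb_integrable_cst.
Qed.

(** The factor 2 is the price of bounding the two components separately. *)
Lemma cint_bound (k : R -> R[i]) (a b B : R) : a <= b ->
  cintegrable leb `[a, b] k -> (forall t, a <= t <= b -> normc (k t) <= B) ->
  normc (cint a b k) <= 2 * (B * (b - a)).
Proof.
move=> ab [k1 k2] kB; rewrite (le_trans (normc_leD _))// mulr_natl mulr2n lerD//.
  by apply: Rintegral_bound => // t /kB; apply: le_trans; exact: normc_Re.
by apply: Rintegral_bound => // t /kB; apply: le_trans; exact: normc_Im.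
Qed.

Lemma compact_bounded_above {X : topologicalType} (K : set X) (f : X -> R) : compact K ->
  (forall x, K x -> exists B : R, \forall y \near within K (nbhs x), f y <= B) ->
  exists B : R, forall x, K x -> f x <= B.
Proof.
move=> /compact_near_coveringP cK loc.
pose P (B : R) (x : X) := K x -> f x <= B.
have : \forall B \near +oo, K `<=` P B.
  apply: cK => x Kx; have [B hB] := loc x Kx.
  rewrite near_withinE in hB.
  exists ([set y | K y -> f y <= B], [set b | B <= b]) => /=.
    split; [exact: hB|apply: nbhs_pinfty_ge; exact: num_real].
  by move=> [y b] /= [h1 h2] Ky; apply: le_trans h2; exact: h1.
move=> [B [_ hB]]; exists (B + 1) => x Kx; apply: (hB (B + 1)) => //.
by rewrite ltrDl.
Qed.

Lemma compact_image_bounded {X : topologicalType} (K : set X) S g (c : X -> R[i]) :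
  compact K -> ccont_on S g -> (forall x, K x -> S (c x)) ->
  (forall x, K x -> ccvg (within K (nbhs x)) c (c x)) ->
  exists B : R, forall x, K x -> normc (g (c x)) <= B.
Proof.
move=> cK gc Sc cc; apply: compact_bounded_above => // x Kx.
exists (normc (g (c x)) + 1).
have h : ccvg (within K (nbhs x)) (fun y => g (c y)) (g (c x)).
  apply: (ccont_on_comp gc (Sc _ Kx)); last exact: cc.
  by rewrite near_withinE; apply: nearW.
have hn : normc (g (c y)) @[y --> within K (nbhs x)] --> normc (g (c x)) by exact: ccvg_normc h.
move/cvgrPdist_lt : hn => /(_ _ ltr01).
by apply: filterS => y; rewrite ltr_distlC => /andP[_ /ltW].
Qed.

Lemma cder_under_integral (K dK : R -> R -> R[i]) (a b s B : R) : a < s < b ->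
  (forall u v : R, a < u < b -> 0 <= v <= 1 -> cder (fun u => K u v) u (dK u v)) ->
  (forall u : R, a < u < b -> ccont_itv 0 1 (K u)) ->
  (forall u v : R, a < u < b -> 0 <= v <= 1 -> normc (dK u v) <= B) ->
  cder (fun u => cint 0 1 (K u)) s (cint 0 1 (dK s)).
Proof.
move=> sab dKE Kc dB.
have B0 : 0 <= B.
  by apply: le_trans (dB s 0 sab _); rewrite ?normc_ge0// lexx ler01.
have main (k dk : R -> R -> R) :
   (forall u v : R, a < u < b -> 0 <= v <= 1 -> is_derive u 1 (fun u => k u v) (dk u v)) ->
   (forall u : R, a < u < b -> {within `[0, 1], continuous (k u)}) ->
   (forall u v : R, a < u < b -> 0 <= v <= 1 -> `|dk u v| <= B) ->
   is_derive s 1 (fun u => Rintegral leb `[0, 1] (k u)) (Rintegral leb `[0, 1] (dk s)).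
  move=> h1 h2 h3.
  have inI u : `]a, b[%classic u -> a < u < b by rewrite /= in_itv.
  have in01 v : `[0, 1]%classic v -> 0 <= v <= 1 :> Prop by rewrite /= in_itv.
  have sI : `]a, b[%classic s by rewrite /= in_itv.
  have pE u v : `]a, b[%classic u -> `[0, 1]%classic v -> partial1of2 k u v = dk u v.
    move=> /inI uI /in01 vI; rewrite partial1of2E.
    by have h := h1 u v uI vI; exact: derive_val.
  have h4 u : `]a, b[%classic u -> leb.-integrable `[0, 1] (EFin \o k u).
    move=> /inI/h2 h; apply: continuous_compact_integrable => //; exact: segment_compact.
  have h5 u v : `]a, b[%classic u -> `[0, 1]%classic v -> derivable (k ^~ v) u 1.
    by move=> /inI uI /in01 vI; have h := h1 u v uI vI; exact: ex_derive.
  have h6 u v : `]a, b[%classic u -> `[0, 1]%classic v -> `|partial1of2 k u v| <= B.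
    by move=> uI vI; rewrite pE//; apply: h3; [exact: inI|exact: in01].
  have h7 : leb.-integrable `[0, 1] (EFin \o (fun=> B)).
    exact: leb_integrable_cst.
  have m01 : measurable (`[0, 1]%classic : set (measurableTypeR R)) by exact: measurable_itv.
  have := cvg_differentiation_under_integral m01 sI h4 h5 (fun=> B0) h7 h6.
  have -> : Rintegral leb `[0, 1] (partial1of2 k s) = Rintegral leb `[0, 1] (dk s).
    by apply: eq_Rintegral => v; rewrite inE => vI; exact: pE.
  by move=> h; apply/is_derive_cvgP.
split; [apply: (main (fun u v => Re (K u v)) (fun u v => Re (dK u v)))|
  apply: (main (fun u v => Im (K u v)) (fun u v => Im (dK u v)))].
- by move=> u v uI vI; have [] := dKE u v uI vI.
- by move=> u uI; apply: ccont_itv_Re; exact: Kc.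
- by move=> u v uI vI; rewrite (le_trans (normc_Re _))// dB.
- by move=> u v uI vI; have [] := dKE u v uI vI.
- by move=> u uI; apply: ccont_itv_Im; exact: Kc.
- by move=> u v uI vI; rewrite (le_trans (normc_Im _))// dB.
Qed.

Lemma ccont_under_integral (K : R -> R -> R[i]) (B : R) :
  (forall v : R, 0 <= v <= 1 -> ccont_itv 0 1 (fun u => K u v)) ->
  (forall u : R, 0 <= u <= 1 -> ccont_itv 0 1 (K u)) ->
  (forall u v : R, 0 <= u <= 1 -> 0 <= v <= 1 -> normc (K u v) <= B) ->
  ccont_itv 0 1 (fun u => cint 0 1 (K u)).
Proof.
move=> cu cv KB.
(* Clamping to [0, 1] extends the family to the open interval ](-1), 2[, so that the end points
   become interior and continuity relative to [0, 1] becomes plain continuity. *)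
pose cl (s : R) := Num.max 0 (Num.min s 1).
have cl01 s : 0 <= cl s <= 1.
  by rewrite /cl le_max lexx ge_max ler01 ge_min lexx orbT.
have clE s : 0 <= s <= 1 -> cl s = s.
  by move=> /andP[s0 s1]; rewrite /cl (min_idPl s1) (max_idPr s0).
have clc (s : R) : {for s, continuous cl}.
  apply: continuous_max; first exact: cvg_cst.
  by apply: continuous_min; [exact: cvg_id|exact: cvg_cst].
have main (k : R -> R -> R) :
   (forall v : R, 0 <= v <= 1 -> {within `[0, 1], continuous (k ^~ v)}) ->
   (forall u : R, 0 <= u <= 1 -> {within `[0, 1], continuous (k u)}) ->
   (forall u v : R, 0 <= u <= 1 -> 0 <= v <= 1 -> `|k u v| <= B) ->
   forall t : R, 0 <= t <= 1 -> 
   Rintegral leb `[0, 1] (k u) @[u --> within `[0, 1] (nbhs t)] --> Rintegral leb `[0, 1] (k t).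
  move=> h1 h2 h3 t t01.
  have m01 : measurable (`[0, 1]%classic : set (measurableTypeR R)) by exact: measurable_itv.
  have h4 u : `](-1), 2[%classic u -> leb.-integrable `[0, 1] (EFin \o k (cl u)).
    move=> _; apply: continuous_compact_integrable; [exact: segment_compact|exact: h2].
  have h5 : {ae leb, forall v, `[0, 1]%classic v -> {in `](-1), 2[%classic, continuous (fun u => k (cl u) v)}}.
    apply: aeW => v; rewrite /= in_itv/= => v01 u _.
    have /subspace_continuousP/(_ (cl u)) := h1 v v01.
    rewrite /= in_itv/= => /(_ (cl01 u)); apply: cvg_comp.
    move=> A /= hA; have := clc u _ hA; rewrite !nbhs_simpl /=.
    by apply: filterS => y; apply; rewrite /= in_itv/=.
  have h7 : leb.-integrable `[0, 1] (EFin \o (fun=> B)).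
    exact: leb_integrable_cst.
  have h6 u : `](-1), 2[%classic u -> {ae leb, forall v, `[0, 1]%classic v -> `|k (cl u) v| <= B}.
    by move=> _; apply: aeW => v; rewrite /= in_itv/= => v01; exact: h3.
  have := continuity_under_integral m01 h4 h5 h7 h6.
  move=> /(_ t); rewrite inE /= in_itv/= => /(_ ltac:(by move: t01 => /andP[? ?]; apply/andP; split; lra)).
  rewrite /continuous_at clE// => ct.
  apply: cvg_trans (cvg_trans (cvg_app _ (cvg_within _)) ct).
  apply: near_eq_cvg; rewrite near_withinE; apply: nearW => u; rewrite /= in_itv/= => u01.
  by rewrite clE.
move=> t t01; split; [apply: (main (fun u v => Re (K u v))) => //|
  apply: (main (fun u v => Im (K u v))) => //].
- by move=> v v01; apply: ccont_itv_Re (cu v v01).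
- by move=> v v01; apply: ccont_itv_Re (cv v v01).
- by move=> u v u01 v01; rewrite (le_trans (normc_Re _))// KB.
- by move=> v v01; apply: ccont_itv_Im (cu v v01).
- by move=> v v01; apply: ccont_itv_Im (cv v v01).
- by move=> u v u01 v01; rewrite (le_trans (normc_Im _))// KB.
Qed.

End curve_integrals.

(** * Primitives on star-shaped domains *)

Section primitive.
Context {R : realType}.
Implicit Types (z w : R[i]).
Notation leb := (@lebesgue_measure R).

Section ccont_itv.
Context {a b : R}.
Implicit Types c d : R -> R[i].

Lemma ccont_itv_cst z : ccont_itv a b (fun=> z).
Proof. by move=> t _; exact: ccvg_cst. Qed.

Lemma ccont_itv_id : ccont_itv a b (fun t => t%:C).
Proof. by apply: ccont_itv_cts => t; apply: ccvg_real; exact: cvg_id. Qed.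

Lemma ccont_itvD c d : ccont_itv a b c -> ccont_itv a b d -> ccont_itv a b (fun t => c t + d t).
Proof. by move=> h1 h2 t tab; exact: ccvgD (h1 t tab) (h2 t tab). Qed.

Lemma ccont_itvN c : ccont_itv a b c -> ccont_itv a b (fun t => - c t).
Proof. by move=> h1 t tab; exact: ccvgN (h1 t tab). Qed.

Lemma ccont_itvM c d : ccont_itv a b c -> ccont_itv a b d -> ccont_itv a b (fun t => c t * d t).
Proof. by move=> h1 h2 t tab; exact: ccvgM (h1 t tab) (h2 t tab). Qed.

Lemma ccont_itv_affine z w : ccont_itv a b (fun t => z + t%:C * w).
Proof.
apply: ccont_itvD (ccont_itv_cst _) _.
exact: ccont_itvM ccont_itv_id (ccont_itv_cst _).
Qed.

Lemma eq_cint c d : (forall t, a <= t <= b -> c t = d t) -> cint a b c = cint a b d.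
Proof.
move=> cd; rewrite /cint /cintegral; congr (_ +i* _).
  by apply: eq_Rintegral => t; rewrite inE /= in_itv /= => /cd ->.
by apply: eq_Rintegral => t; rewrite inE /= in_itv /= => /cd ->.
Qed.

Lemma cintB c d : cintegrable leb `[a, b] c -> cintegrable leb `[a, b] d ->
  cint a b (fun t => c t - d t) = cint a b c - cint a b d.
Proof.
move=> [c1 c2] [d1 d2]; apply: eqC; rewrite ?ReImE /=.
  rewrite -RintegralB//; apply: eq_Rintegral => t _; rewrite !ReImE//.
rewrite -RintegralB//; apply: eq_Rintegral => t _; rewrite !ReImE//.
Qed.

End ccont_itv.

Lemma cintZ a b z (c : R -> R[i]) : cintegrable leb `[a, b] c ->
  cint a b (fun t => z * c t) = z * cint a b c.
Proof.
move=> [c1 c2].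
have zi (p : R) (f : R -> R) : leb.-integrable `[a, b] (EFin \o f) ->
    leb.-integrable `[a, b] (EFin \o (fun t => p * f t)).
  have mI : measurable (`[a, b]%classic : set (measurableTypeR R)) by exact: measurable_itv.
  by move=> fi; exact: (integrableZl mI p fi).
apply: eqC; rewrite ?ReImE /=.
  rewrite -!RintegralZl// -RintegralB//; [|exact: zi..].
  by apply: eq_Rintegral => t _; rewrite !ReImE.
rewrite -!RintegralZl// -RintegralD//; [|exact: zi..].
by apply: eq_Rintegral => t _; rewrite !ReImE.
Qed.

Lemma cint_cst (z : R[i]) : cint 0 1 (fun=> z) = z.
Proof.
by apply: eqC; rewrite /= Rintegral_cst// fine_leb_itv// subr0 mulr1.
Qed.

Lemma cder_affine z w (t : R) : cder (fun u : R => z + u%:C * w) t w.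
Proof.
apply: (cder_ext (cderD (cder_cst z t) (cderM (cder_id t) (cder_cst w t)))) => //.
by ring.
Qed.

Lemma cder_scale w (t : R) : cder (fun u : R => u%:C * w) t w.
Proof.
by apply: (cder_ext (cderM (cder_id t) (cder_cst w t))) => //; ring.
Qed.

Definition prim (g : R[i] -> R[i]) z : R[i] := cint 0 1 (fun t => z * g (t%:C * z)).

Section star.
Context {D : set R[i]} {g dg : R[i] -> R[i]}.
Hypothesis gh : hol_on D g dg.
Hypothesis gc : ccont_on (D `|` [set 0]) g.
Hypothesis Dstar : forall z (t : R), D z -> 0 < t <= 1 -> D (t%:C * z).
Hypothesis Dopen : forall z, D z -> exists2 d : R, 0 < d & forall w, normc (w - z) < d -> D w.

Let D0scale z (t : R) : D z -> 0 <= t <= 1 -> (D `|` [set 0]) (t%:C * z).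
Proof.
move=> Dz /andP[t0 t1]; have [->|tn0] := eqVneq t 0; first by right; rewrite /= mul0r.
by left; apply: Dstar => //; rewrite t1 lt_neqAle eq_sym tn0 t0.
Qed.

Let ray_cont z : D z -> ccont_itv 0 1 (fun t => g (t%:C * z)).
Proof.
move=> Dz; apply: (ccont_itv_comp gc) => [t t01|]; first exact: D0scale.
exact: ccont_itvM ccont_itv_id (ccont_itv_cst _).
Qed.

(** Cauchy's theorem for the triangle 0, z, w. [A s] is the integral along the side opposite 0
    scaled by [s]. Its derivative under the integral, [dK s v], is also the derivative in [v] of
    [ze v * g (s%:C * ze v)], hence integrates to [w g(s w) - z g(s z)]; integrating over [s] from
    [A 0 = 0] gives the two other sides. *)
Lemma prim_segment z w : (forall v : R, 0 <= v <= 1 -> D (z + v%:C * (w - z))) ->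
  cint 0 1 (fun v => (w - z) * g (z + v%:C * (w - z))) = prim g w - prim g z.
Proof.
move=> Dseg; set h := w - z; set ze := fun v : R => z + v%:C * h.
have zec a b : ccont_itv a b ze by exact: ccont_itv_affine.
have z0 : ze 0 = z by rewrite /ze mul0r addr0.
have z1 : ze 1 = w by rewrite /ze /h; ring.
have Dz : D z by rewrite -z0; apply: Dseg; rewrite lexx ler01.
have Dw : D w by rewrite -z1; apply: Dseg; rewrite lexx ler01.
have [gd dgc gcD] := gh.
pose K (s v : R) := s%:C * h * g (s%:C * ze v).
pose dK (s v : R) := h * g (s%:C * ze v) + s%:C * h * (dg (s%:C * ze v) * ze v).
have Ksc (s : R) : 0 <= s <= 1 -> ccont_itv 0 1 (K s).
  move=> s01; apply: ccont_itvM (ccont_itv_cst _) _.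
  apply: (ccont_itv_comp gc) => [t t01|]; first by apply: D0scale => //; exact: Dseg.
  exact: ccont_itvM (ccont_itv_cst _) (zec _ _).
have Kvc (v : R) : 0 <= v <= 1 -> ccont_itv 0 1 (K^~ v).
  move=> v01; apply: ccont_itvM; last exact: ray_cont (Dseg _ v01).
  exact: ccont_itvM ccont_itv_id (ccont_itv_cst _).
have sq_cont (a b : R) (x : (R * R)%type) : ccvg (within (`[a, b] `*` `[0, 1]) (nbhs x))
    (fun x : (R * R)%type => x.1%:C * ze x.2) (x.1%:C * ze x.2).
  have c1 : ccvg (within (`[a, b] `*` `[0, 1]) (nbhs x)) (fun x : (R * R)%type => x.1%:C) x.1%:C.
    apply: ccvg_real; apply: cvg_trans (@cvg_fst _ _ (nbhs x.1) (nbhs x.2) _).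
    by apply: cvg_app; exact: cvg_within.
  have c2 : ccvg (within (`[a, b] `*` `[0, 1]) (nbhs x)) (fun x : (R * R)%type => x.2%:C) x.2%:C.
    apply: ccvg_real; apply: cvg_trans (@cvg_snd _ _ (nbhs x.1) (nbhs x.2) _).
    by apply: cvg_app; exact: cvg_within.
  apply: ccvgM => //; apply: ccvgD; first exact: ccvg_cst.
  by apply: ccvgM => //; exact: ccvg_cst.
have cpt (a b : R) : compact (`[a, b] `*` `[0, 1] : set (R * R)%type).
  by apply: compact_setX; exact: segment_compact.
have inK (a b : R) (x : (R * R)%type) : (`[a, b] `*` `[0, 1]) x -> a <= x.1 <= b /\ 0 <= x.2 <= 1.
  by move=> []; rewrite /= !in_itv.
have Kin (a b s v : R) : a <= s <= b -> 0 <= v <= 1 -> (`[a, b] `*` `[0, 1]) (s, v).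
  by move=> h1 h2; split; rewrite /= in_itv.
pose A (s : R) := cint 0 1 (K s).
have Ac : ccont_itv 0 1 A.
  have [B hB] := @compact_image_bounded _ _ _ _ _ _ (cpt 0 1) gc
     (fun x hx => D0scale (Dseg _ (inK _ _ _ hx).2) (inK _ _ _ hx).1) (fun x _ => sq_cont 0 1 x).
  apply: (@ccont_under_integral _ K (normc h * B)) => // u v u01 v01.
  rewrite /K !normcM normc_real ger0_norm; last by case/andP: u01.
  have h1 : normc (g (u%:C * ze v)) <= B by apply: (hB (u, v)); exact: Kin.
  apply: (@le_trans _ _ (normc h * normc (g (u%:C * ze v)))); last first.
    by rewrite ler_wpM2l// normc_ge0.
  by rewrite -mulrA ler_piMl ?mulr_ge0 ?normc_ge0//; case/andP: u01.
have dKv (s v : R) : 0 < s <= 1 -> 0 <= v <= 1 ->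
    cder (fun v => ze v * g (s%:C * ze v)) v (dK s v).
  move=> s01 v01.
  have c1 : cder (fun v => s%:C * ze v) v (s%:C * h).
    apply: (cder_ext (cderM (cder_cst s%:C v) (cder_affine z h v))) => //; ring.
  have c2 := gd _ _ _ (Dstar (Dseg _ v01) s01) c1.
  by apply: (cder_ext (cderM (cder_affine z h v) c2)) => //; rewrite /dK /ze; ring.
have dKs (s v : R) : 0 < s <= 1 -> 0 <= v <= 1 -> cder (K^~ v) s (dK s v).
  move=> s01 v01.
  have c2 := gd _ _ _ (Dstar (Dseg _ v01) s01) (cder_scale (ze v) s).
  by apply: (cder_ext (cderM (cder_scale h s) c2)) => //; rewrite /dK /ze; ring.
have dKc (s : R) : 0 < s <= 1 -> ccont_itv 0 1 (dK s).
  move=> s01.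
  have Ds v : 0 <= v <= 1 -> D (s%:C * ze v) by move=> v01; apply: Dstar => //; exact: Dseg.
  have sz : ccont_itv 0 1 (fun v => s%:C * ze v) by exact: ccont_itvM (ccont_itv_cst _) (zec _ _).
  apply: ccont_itvD.
    by apply: ccont_itvM (ccont_itv_cst _) _; exact: ccont_itv_comp gcD _ _.
  apply: ccont_itvM (ccont_itv_cst _) _; apply: ccont_itvM => //.
  exact: ccont_itv_comp dgc _ _.
have dA (s : R) : 0 < s < 1 -> cder A s (w * g (s%:C * w) - z * g (s%:C * z)).
  move=> /andP[s0 s1].
  have <- : cint 0 1 (dK s) = w * g (s%:C * w) - z * g (s%:C * z).
    have s01 : 0 < s <= 1 by rewrite s0 ltW.
    rewrite (@cfundamental _ 0 1 (fun v => ze v * g (s%:C * ze v)) (dK s)) ?z0 ?z1//.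
    - apply: ccont_itvM => //; apply: (ccont_itv_comp gcD) => [v v01|].
        by apply: Dstar => //; exact: Dseg.
      exact: ccont_itvM (ccont_itv_cst _) (zec _ _).
    - exact: dKc.
    - by move=> v /andP[v0 v1]; apply: dKv => //; rewrite !ltW.
  (* For [u] in [s/2, 1] the scaled sides stay in a compact subset of [D], away from 0, where [dg]
     is bounded. *)
  have Ds (x : (R * R)%type) : (`[s / 2, 1] `*` `[0, 1]) x -> D (x.1%:C * ze x.2).
    move=> /inK[/andP[h1 h2] h3]; apply: Dstar; first exact: Dseg.
    by rewrite h2 andbT; apply: lt_le_trans h1; rewrite divr_gt0.
  have [B1 hB1] := @compact_image_bounded _ _ _ _ _ _ (cpt (s / 2) 1) gcD Ds (fun x _ => sq_cont _ _ x).
  have [B2 hB2] := @compact_image_bounded _ _ _ _ _ _ (cpt (s / 2) 1) dgc Ds (fun x _ => sq_cont _ _ x).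
  have idc : ccont_on setT (@id R[i]) by exact: ccont_on_id.
  have sq2 (x : (R * R)%type) : ccvg (within (`[s / 2, 1] `*` `[0, 1]) (nbhs x))
      (fun x : (R * R)%type => ze x.2) (ze x.2).
    apply: ccvgD; first exact: ccvg_cst.
    apply: ccvgM; last exact: ccvg_cst.
    apply: ccvg_real; apply: cvg_trans (@cvg_snd _ _ (nbhs x.1) (nbhs x.2) _).
    by apply: cvg_app; exact: cvg_within.
  have [B3 hB3] := @compact_image_bounded _ _ _ _ _ _ (cpt (s / 2) 1) idc (fun x _ => I) (fun x _ => sq2 x).
  apply: (@cder_under_integral _ K dK (s / 2) 1 s (normc h * B1 + normc h * (B2 * B3))).
  - by rewrite s1 andbT; lra.
  - move=> u v /andP[u0 u1] v01; apply: dKs => //.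
    by rewrite (ltW u1) andbT (lt_trans _ u0)// divr_gt0.
  - move=> u /andP[u0 u1]; apply: Ksc.
    by rewrite (ltW u1) andbT ltW// (lt_trans _ u0)// divr_gt0.
  - move=> u v /andP[u0 u1] v01.
    have uv : (`[s / 2, 1] `*` `[0, 1]) (u, v) by apply: Kin => //; rewrite !ltW.
    have b1 := hB1 _ uv; have b2 := hB2 _ uv; have b3 := hB3 _ uv; rewrite /= in b1 b2 b3.
    have u0' : 0 <= u by rewrite ltW// (lt_trans _ u0)// divr_gt0.
    rewrite (le_trans (normc_triangle _ _))// !normcM normc_real (ger0_norm u0').
    apply: lerD; first by rewrite ler_wpM2l// normc_ge0.
    apply: ler_pM; rewrite ?mulr_ge0 ?normc_ge0//.
      by rewrite ler_piMl ?normc_ge0// ltW.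
    by apply: ler_pM; rewrite ?normc_ge0.
have rc y : D y -> ccont_itv 0 1 (fun t => y * g (t%:C * y)).
  by move=> Dy; apply: ccont_itvM (ccont_itv_cst _) _; exact: ray_cont.
have := @cfundamental _ 0 1 A (fun s => w * g (s%:C * w) - z * g (s%:C * z)) ltr01 Ac _ dA.
rewrite cintB; last 2 first.
- by apply: ccont_itv_integrable; exact: rc.
- by apply: ccont_itv_integrable; exact: rc.
have -> : A 0 = 0.
  rewrite /A -[RHS](cint_cst 0); apply: eq_cint => t _.
  by rewrite /K !mul0r.
rewrite subr0 /prim => ->; first by apply: eq_cint => t _; rewrite /K !mul1r.
by apply: ccont_itvD; [exact: rc|apply: ccont_itvN; exact: rc].
Qed.

(** By [prim_segment] the difference quotient is the mean of [g] over the segment from [z] to [w],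
    which tends to [g z]. *)
Lemma prim_quotient z : D z -> exists q : R[i] -> R[i], ccvg (nbhs (z : R[i]^o)) q (g z) /\
  exists2 d : R, 0 < d & forall w, normc (w - z) < d -> prim g w - prim g z = (w - z) * q w.
Proof.
move=> Dc; have [d d0 hd] := Dopen Dc.
pose q w := cint 0 1 (fun v => g (z + v%:C * (w - z))).
have Dseg w : normc (w - z) < d -> forall v : R, 0 <= v <= 1 -> D (z + v%:C * (w - z)).
  move=> wz v /andP[v0 v1]; apply: hd; rewrite addrAC subrr add0r normcM normc_real ger0_norm//.
  by rewrite (le_lt_trans _ wz)// ler_piMl ?normc_ge0.
have [_ _ gcD] := gh.
have gseg w : normc (w - z) < d -> ccont_itv 0 1 (fun v => g (z + v%:C * (w - z))).
  move=> wz; apply: (ccont_itv_comp gcD); first exact: Dseg.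
  exact: ccont_itv_affine.
have qE w : normc (w - z) < d -> prim g w - prim g z = (w - z) * q w.
  move=> wz; rewrite -prim_segment; last exact: Dseg.
  by rewrite cintZ//; apply: ccont_itv_integrable; exact: gseg.
exists q; split; last by exists d.
apply/ccvg_normcP => e e0.
have e3 : 0 < e / 3 by rewrite divr_gt0.
have /ccvg_normcP/(_ _ e3) := gcD z Dc.
rewrite near_withinE => /nbhsC_normcP[d' d'0 hd'].
apply/nbhsC_normcP; exists (Num.min d d'); first by rewrite lt_min d0.
move=> w; rewrite lt_min => /andP[w1 w2].
rewrite /q -[X in _ - X](cint_cst (g z)) -cintB; last 2 first.
- by apply: ccont_itv_integrable; exact: gseg.
- by apply: ccont_itv_integrable; exact: ccont_itv_cst.
apply: (@le_lt_trans _ _ (2 * (e / 3 * (1 - 0)))); last by lra.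
apply: cint_bound => //.
  apply: ccont_itv_integrable; apply: ccont_itvD; first exact: gseg.
  exact: (ccont_itvN (ccont_itv_cst _)).
move=> v v01; apply/ltW/hd'; last exact: Dseg.
move: v01 => /andP[v0 v1].
rewrite addrAC subrr add0r normcM normc_real ger0_norm//.
by rewrite (le_lt_trans _ w2)// ler_piMl ?normc_ge0.
Qed.

Lemma prim_cont : ccont_on D (prim g).
Proof.
move=> z Dz; have [q [qc [d d0 qE]]] := prim_quotient Dz.
have idc : ccvg (within D (nbhs (z : R[i]^o))) id z := @ccont_on_id _ D z Dz.
have qc' : ccvg (within D (nbhs (z : R[i]^o))) q (g z) by exact: ccvg_comp qc idc.
have lim : ccvg (within D (nbhs (z : R[i]^o))) (fun w => prim g z + (w - z) * q w) (prim g z + (z - z) * g z).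
  apply: ccvgD; first exact: ccvg_cst.
  by apply: ccvgM => //; apply: ccvgD => //; exact: ccvg_cst.
rewrite subrr mul0r addr0 in lim.
have ev : \forall w \near within D (nbhs (z : R[i]^o)), prim g z + (w - z) * q w = prim g w.
  rewrite near_withinE; apply/nbhsC_normcP; exists d => // w wz _.
  by rewrite -qE// addrC subrK.
have [l1 l2] := lim.
split; [apply: cvg_trans l1|apply: cvg_trans l2]; apply: near_eq_cvg;
  by apply: filterS ev => w ->.
Qed.

Lemma cder_prim (c : R -> R[i]) (t : R) c' : D (c t) -> cder c t c' ->
  cder (fun u => prim g (c u)) t (g (c t) * c').
Proof.
move=> Dc cc; set z := c t in Dc *; have [q [qc [d d0 qE]]] := prim_quotient Dc.
have ct : ccvg 0^' (fun h : R => c (h + t)) z.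
  have hh : h + t @[h --> 0^'] --> t.
    rewrite -[X in _ --> X]add0r.
    by apply: cvgD; [exact: nbhs_dnbhs|exact: cvg_cst].
  have [h1 h2] := cder_ccvg cc.
  by split; [exact: (cvg_comp _ _ hh h1)|exact: (cvg_comp _ _ hh h2)].
apply/cderP.
have lim : ccvg 0^' (fun h : R => q (c (h + t)) * ((h^-1)%:C * (c (h + t) - z))) (g z * c').
  by apply: ccvgM; [exact: ccvg_comp qc ct|exact/cderP].
have ev : \forall h \near 0^', normc (c (h + t) - z) < d.
  by move/ccvg_normcP : ct; apply.
have [l1 l2] := lim.
have lE : \forall h \near 0^', q (c (h + t)) * ((h^-1)%:C * (c (h + t) - z)) =
    (h^-1)%:C * (prim g (c (h + t)) - prim g z).
  by apply: filterS ev => h hE; rewrite qE//; ring.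
split; [apply: cvg_trans l1|apply: cvg_trans l2]; apply: near_eq_cvg;
  by apply: filterS lE => h ->.
Qed.

End star.
End primitive.

(** * Integrals over increasing unions *)

Section exhaustion.
Context d (T : measurableType d) {R : realType} (mu : {measure set T -> \bar R}).

(** Monotone convergence for [|h|] gives the integrability; the limit then follows for the positive
    and negative parts separately. *)
Lemma integrable_exhaustion (S : (set T)^nat) (h : T -> R) (M : R) :
  (forall n, measurable (S n)) -> (forall n m, (n <= m)%N -> S n `<=` S m) ->
  (forall n, mu.-integrable (S n) (EFin \o h)) ->
  (forall n, Rintegral mu (S n) (fun t => `|h t|) <= M) ->
  mu.-integrable (\bigcup_n S n) (EFin \o h) /\
  Rintegral mu (S n) h @[n --> \oo] --> Rintegral mu (\bigcup_n S n) h.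
Proof.
move=> mS Sle hS hM.
have Shomo : {homo S : n m / (n <= m)%N >-> (n <= m)%O}.
  by move=> n m nm; apply/subsetPset; exact: Sle.
have mhS n : measurable_fun (S n) (EFin \o h : T -> \bar R) by case/integrableP : (hS n).
have mSU : measurable (\bigcup_n S n) by exact: bigcup_measurable.
have mh : measurable_fun (\bigcup_n S n) (EFin \o h : T -> \bar R) by apply/measurable_fun_bigcup.
have hi : mu.-integrable (\bigcup_n S n) (EFin \o h).
  apply/integrableP; split => //.
  have c1 := @ge0_nondecreasing_set_cvg_integral _ _ _ S (fun t => `|(EFin \o h) t|%E) mu Shomo mS
     (fun n => measurableT_comp (@abse_measurable _ _) (mhS n)) (fun n x _ => abse_ge0 _).
  rewrite -(cvg_lim _ c1)//.
  apply: (@le_lt_trans _ _ M%:E); last exact: ltry.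
  apply: lime_le; first by apply/cvg_ex; eexists; exact: c1.
  apply: nearW => n.
  have := hM n; rewrite -lee_fin /Rintegral fineK//.
  by apply: integrable_fin_num => //; exact: integrable_norm.
split => //.
have lim (f : T -> \bar R) : measurable_fun (\bigcup_n S n) f -> (forall x, (0 <= f x)%E) ->
    (\int[mu]_(x in S n) f x)%E @[n --> \oo] --> (\int[mu]_(x in \bigcup_n S n) f x)%E.
  move=> mf f0; apply: ge0_nondecreasing_set_cvg_integral => //.
  by move=> i; apply: measurable_funS mf => //; exact: bigcup_sup.
rewrite /Rintegral; apply: fine_cvg; rewrite fineK; last exact: integrable_fin_num.
rewrite integralE; under eq_cvg do rewrite integralE.
apply: cvgeB.
- rewrite fin_num_adde_defl// fin_numN; exact: (integrable_neg_fin_num mSU hi).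
- by apply: lim => //; exact: measurable_funepos.
- by apply: lim => //; exact: measurable_funeneg.
Qed.

End exhaustion.

(** * The fundamental theorem of calculus with exceptional points *)

Section piecewise.
Context {R : realType}.
Notation leb := (@lebesgue_measure R).

Lemma integrable_oo_cc (a b : R) (h : R -> R) :
  leb.-integrable `]a, b[ (EFin \o h) -> leb.-integrable `[a, b] (EFin \o h).
Proof.
move=> /integrableP[mh hoo]; have [ab|ba] := leP a b; last first.
  by rewrite set_itv_ge ?bnd_simp -?ltNge//; exact: integrable_set0.
have mcc : measurable_fun (`[a, b]%classic : set (measurableTypeR R)) (EFin \o h : measurableTypeR R -> \bar R).
  have -> : `[a, b]%classic = `]a, b[ `|` [set a] `|` [set b] :> set (measurableTypeR R).
    apply/seteqP; split => x /=; rewrite !in_itv/=.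
      move=> /andP[]; rewrite le_eqVlt => /predU1P[->|ax]; first by left; right.
      by rewrite le_eqVlt => /predU1P[->|xb]; [right|left; left; rewrite ax].
    by move=> [[/andP[/ltW -> /ltW ->]|->]|->] //; rewrite lexx ?ab.
  apply/measurable_funU => //; first exact: measurableU.
  split; last exact: measurable_fun_set1.
  by apply/measurable_funU => //; split => //; exact: measurable_fun_set1.
apply/integrableP; split => //.
rewrite integral_itv_bndoo//; exact: measurableT_comp.
Qed.

Lemma integrable_pt (a : R) (h : R -> R) : leb.-integrable [set a] (EFin \o h).
Proof.
rewrite -set_itv1; apply: integrable_oo_cc.
by rewrite set_itv_ge ?bnd_simp ?ltxx//; exact: integrable_set0.
Qed.

Lemma Rintegral_oo_cc (a b : R) (h : R -> R) :
  leb.-integrable `]a, b[ (EFin \o h) -> Rintegral leb `[a, b] h = Rintegral leb `]a, b[ h.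
Proof.
by move=> /integrableP[mh _]; rewrite /Rintegral integral_itv_bndoo.
Qed.

(** The values of [h] at the end points are arbitrary, as those of [derive1] at a corner; replacing
    them by the one-sided limits gives a function continuous on [a, b] with the same integral. *)
Lemma fundamental_open (a b : R) (H h : R -> R) : a < b ->
  {within `[a, b], continuous H} ->
  (forall t, a < t < b -> is_derive t 1 H (h t) /\ {for t, continuous h}) ->
  cvg (h u @[u --> a^'+]) -> cvg (h u @[u --> b^'-]) ->
  leb.-integrable `[a, b] (EFin \o h) /\ Rintegral leb `[a, b] h = H b - H a.
Proof.
move=> ab Hc Hd ha hb.
pose la := lim (h u @[u --> a^'+]); pose lb := lim (h u @[u --> b^'-]).
pose h' t := if t == a then la else if t == b then lb else h t.
have h'E t : a < t < b -> h' t = h t.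
  by move=> /andP[at_ tb]; rewrite /h' (gt_eqF at_) (lt_eqF tb).
have nearab t : a < t < b -> \forall u \near t, h u = h' u.
  move=> tab; have : t \in `]a, b[ by rewrite in_itv.
  move/near_in_itvoo; apply: filterS => u; rewrite in_itv/= => uab.
  by rewrite h'E.
have h'c : {within `[a, b], continuous h'}.
  apply/(continuous_within_itvP _ ab); split.
  - move=> t; rewrite in_itv/= => tab; have [_ hc] := Hd t tab.
    rewrite /continuous_at h'E//; apply: cvg_trans hc.
    by apply: near_eq_cvg; exact: nearab.
  - rewrite {2}/h' eqxx; apply: cvg_trans ha; apply: near_eq_cvg.
    near=> u; rewrite h'E//; apply/andP; split; near: u; [exact: nbhs_right_gt|exact: nbhs_right_lt].
  - rewrite {2}/h' (gt_eqF ab) eqxx; apply: cvg_trans hb; apply: near_eq_cvg.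
    near=> u; rewrite h'E//; apply/andP; split; near: u; [exact: nbhs_left_gt|exact: nbhs_left_lt].
have i1 : leb.-integrable `[a, b] (EFin \o h').
  by apply: continuous_compact_integrable => //; exact: segment_compact.
have i2 : leb.-integrable `]a, b[ (EFin \o h').
  apply: integrableS i1 => //; exact: subset_itv_oo_cc.
have i3 : leb.-integrable `]a, b[ (EFin \o h).
  apply: eq_integrable i2 => // x; rewrite inE /= in_itv/= => xab.
  by rewrite h'E.
split; first exact: integrable_oo_cc.
have -> : Rintegral leb `[a, b] h = Rintegral leb `[a, b] h'.
  rewrite !Rintegral_oo_cc//; apply: eq_Rintegral => x; rewrite inE /= in_itv/= => xab.
  by symmetry; exact: h'E.
rewrite /Rintegral (@continuous_FTC2 _ h' H)//.
- have /(continuous_within_itvP _ ab)[_ r1 r2] := Hc.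
  split; [|exact: r1|exact: r2].
  by move=> t; rewrite in_itv /= => /Hd[[h0 _] _].
- move=> t; rewrite in_itv /= => tab; have [h0 _] := Hd t tab.
  by rewrite derive1E h'E//; exact: derive_val.
Unshelve. all: by end_near. Qed.

(** Induction on the exceptional points: one outside ]a, b[ is dropped, one inside cuts the interval
    in two. *)
Lemma piecewise_fundamental (s : seq R) (a b : R) (H h : R -> R) : a <= b ->
  {within `[a, b], continuous H} ->
  (forall t, a < t < b -> t \notin s -> is_derive t 1 H (h t) /\ {for t, continuous h}) ->
  (forall t, a <= t <= b -> cvg (h u @[u --> t^'+]) /\ cvg (h u @[u --> t^'-])) ->
  leb.-integrable `[a, b] (EFin \o h) /\ Rintegral leb `[a, b] h = H b - H a.
Proof.
elim: s a b => [|c s ih] a b; rewrite le_eqVlt => /predU1P[->|ab] Hc Hd hl.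
- rewrite set_itv1 Rintegral_set1 subrr; split => //.
  exact: integrable_pt.
- have [ha _] := hl a ltac:(by rewrite lexx ltW).
  have [_ hb] := hl b ltac:(by rewrite lexx ltW).
  apply: (fundamental_open ab Hc _ ha hb) => t tab.
  by apply: Hd tab _.
- rewrite set_itv1 Rintegral_set1 subrr; split => //.
  exact: integrable_pt.
have [/andP[ac cb]|nc] := boolP (a < c < b); last first.
  apply: ih => //; first exact: ltW.
  move=> t tab ts; apply: Hd => //; rewrite inE negb_or ts andbT.
  by apply: contraNneq nc => <-.
have [i1 e1] : leb.-integrable `[a, c] (EFin \o h) /\ Rintegral leb `[a, c] h = H c - H a.
  apply: ih; first exact: ltW.
  - apply: continuous_subspaceW Hc => x; rewrite /= !in_itv/= => /andP[-> /le_trans]; apply.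
    exact: ltW.
  - move=> t /andP[at_ tc] ts; apply: Hd; first by rewrite at_ (lt_trans tc).
    by rewrite inE negb_or ts (lt_eqF tc).
  - by move=> t /andP[at_ tc]; apply: hl; rewrite at_ (le_trans tc)// ltW.
have [i2 e2] : leb.-integrable `[c, b] (EFin \o h) /\ Rintegral leb `[c, b] h = H b - H c.
  apply: ih; first exact: ltW.
  - apply: continuous_subspaceW Hc => x; rewrite /= !in_itv/= => /andP[cx ->].
    by rewrite andbT (le_trans _ cx)// ltW.
  - move=> t /andP[ct tb] ts; apply: Hd; first by rewrite tb (lt_trans ac).
    by rewrite inE negb_or ts (gt_eqF ct).
  - by move=> t /andP[ct tb]; apply: hl; rewrite tb (le_trans _ ct)// ltW.
have i2' : leb.-integrable `]c, b] (EFin \o h).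
  by apply: integrableS i2 => // x; rewrite /= !in_itv/= => /andP[/ltW -> ->].
have abE : `[a, b]%classic = `[a, c] `|` `]c, b] :> set (measurableTypeR R).
  apply/seteqP; split => x /=; rewrite !in_itv/=.
    move=> /andP[ax xb]; have [xc|cx] := leP x c; [by left; rewrite ax|by right].
  move=> [/andP[-> xc]|/andP[cx ->]]; first by rewrite (le_trans xc)// ltW.
  by rewrite andbT ltW// (lt_trans ac).
have dj : [disjoint `[a, c]%classic & `]c, b]%classic].
  apply/disj_setPS => x [/=]; rewrite !in_itv/= => /andP[_ xc] /andP[cx _].
  by have := le_lt_trans xc cx; rewrite ltxx.
have iab : leb.-integrable `[a, b] (EFin \o h).
  have /integrableP[m1 f1] := i1; have /integrableP[m2 f2] := i2'.
  have mU : measurable_fun (`[a, b]%classic : set (measurableTypeR R)) (EFin \o h : _ -> \bar R).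
    by rewrite abE; apply/measurable_funU.
  apply/integrableP; split => //.
  rewrite abE ge0_integral_setU//; first exact: lte_add_pinfty.
  by rewrite -abE; exact: measurableT_comp.
split => //.
rewrite abE Rintegral_setU//; last by rewrite -abE.
rewrite e1 [X in _ + X](_ : _ = Rintegral leb `[c, b] h); last exact: Rintegral_itv_obnd_cbnd.
by rewrite e2; ring.
Qed.

End piecewise.

(** * Half-lines in the sector *)

Section rays.
Context {R : realType}.
Implicit Types (z w : R[i]).
Notation leb := (@lebesgue_measure R).

(** Parametrised by the real part, so that two half-lines are joined at the same parameter by a
    vertical segment. *)
Definition ray (m x : R) : R[i] := x +i* (x * m).

Lemma rayE m x : ray m x = x%:C * (1 +i* m).
Proof. by apply: eqC; rewrite !ReImE/=; ring. Qed.

Lemma slope_between (gm gp m1 m2 m : R) : slope gm gp m1 -> slope gm gp m2 -> m1 <= m <= m2 ->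
  slope gm gp m.
Proof.
move=> /andP[h1 _] /andP[_ h2] /andP[h3 h4]; apply/andP; split.
  by apply: (lt_le_trans h1); exact: le_atan.
by apply: le_lt_trans h2; exact: le_atan.
Qed.

Lemma ray_polar m x : ray m x = polar (x * Num.sqrt (1 + m ^+ 2)) (atan m).
Proof.
have h : 0 < 1 + m ^+ 2 by rewrite ltr_wpDr// sqr_ge0.
have sq : Num.sqrt (1 + m ^+ 2) != 0 by rewrite gt_eqF// sqrtr_gt0.
have c0 : cos (atan m) != 0 by rewrite cos_atan invr_neq0.
have sE : sin (atan m) = m * cos (atan m) by rewrite -{2}(atanK m) /tan mulfVK.
apply: eqC; rewrite ?(Re_polar, Im_polar) /= ?sE cos_atan; first by rewrite mulfK.
by rewrite mulrCA -mulrA mulfV// mulr1 mulrC.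
Qed.

Lemma ccvg_ray {T} {F : set_system T} {FF : Filter F} (u v : T -> R) (x m : R) :
  u @ F --> x -> v @ F --> m -> ccvg F (fun t => ray (v t) (u t)) (ray m x).
Proof. by move=> ux vm; split => //=; exact: cvgM. Qed.

(** The sector bound controls large arguments; what remains is compact and psi is continuous on it,
    0 included. The weight [1 + x ^+ 2] is crude, but any polynomial is absorbed by the exponential
    decay. *)
Lemma growth_of_sector_bound (mum mup gm gp nu : R) (psi : R[i] -> R[i]) :
  mum <= 0 -> 0 <= mup -> mum < mup -> gm < 0 -> 0 < gp -> 0 < nu < 2 ->
  ccont_on (dom mum mup gm gp `|` real_line) psi ->
  (forall g1m g1p : R, gm < g1m < 0 -> 0 < g1p < gp ->
      exists C R0 : R, [/\ 0 < C, 0 < R0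
        & forall phi rho : R, g1m <= phi <= g1p -> R0 < rho ->
            `|psi (polar rho phi)| <= (C * rho `^ nu)%:C]) ->
  forall m1 m2 : R, slope gm gp m1 -> slope gm gp m2 ->
  exists2 C : R, 0 <= C & forall x m, 0 <= x -> m1 <= m <= m2 ->
    normc (psi (ray m x)) <= C * (1 + x ^+ 2).
Proof.
move=> mum0 mup0 mu_lt gm0 gp0 /andP[nu0 nu2] psic hb m1 m2 s1 s2.
have [a1 a2] := andP s1; have [a3 a4] := andP s2.
(* [m1] and [m2] may have the same sign, whereas the sector of the bound must contain the direction
   0; hence [gm / 2] and [gp / 2]. *)
have [C [R0 [C0 R00 hC]]] := hb (Num.min (atan m1) (gm / 2)) (Num.max (atan m2) (gp / 2))
  ltac:(by rewrite lt_min a1 gt_min; apply/andP; split; [lra|apply/orP; right; lra])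
  ltac:(by rewrite gt_max a4 lt_max; apply/andP; split; [apply/orP; right; lra|lra]).
(* Beyond 1, [rho^nu] is at most [rho^2]. *)
pose X0 := Num.max R0 1.
pose K : set (R * R)%type := `[0, X0] `*` `[m1, m2].
have Kc : compact K by apply: compact_setX; exact: segment_compact.
have KS (x : (R * R)%type) : K x -> (dom mum mup gm gp `|` real_line) (ray x.2 x.1).
  move=> []; rewrite /= !in_itv/= => /andP[x0 _] xm.
  have [->|xn0] := eqVneq x.1 0.
    by right; exists 0 => //; rewrite /ray mul0r.
  left; apply: (@dom_cone _ _ _ _ _ mum0 mup0 mu_lt _ x.2) => //=.
    exact: slope_between s1 s2 xm.
  by rewrite ger0_norm.
have [B hB] := @compact_image_bounded _ _ _ _ _ _ Kc psic KS
  (fun x _ => ccvg_ray (cvg_trans (cvg_app _ (cvg_within _)) (@cvg_fst _ _ (nbhs x.1) (nbhs x.2) _))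
      (cvg_trans (cvg_app _ (cvg_within _)) (@cvg_snd _ _ (nbhs x.1) (nbhs x.2) _))).
pose M := Num.max (m1 ^+ 2) (m2 ^+ 2).
have M0 : 0 <= M by rewrite le_max sqr_ge0.
exists (`|B| + C * (1 + M)); first by rewrite addr_ge0// mulr_ge0 ?addr_ge0// ltW.
move=> x m x0 xm; have [m1m mm2] := andP xm.
have x2 : 0 <= x ^+ 2 by exact: sqr_ge0.
have mM : m ^+ 2 <= M.
  rewrite le_max; have [m0|m0] := leP 0 m; apply/orP; [right|left].
    by rewrite ler_sqr ?nnegrE// (le_trans m0).
  by rewrite -(sqrrN m) -(sqrrN m1) ler_sqr ?nnegrE ?oppr_ge0 ?lerN2 ?(ltW m0)// (le_trans m1m)// ltW.
rewrite mulrDl.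
have [xX|Xx] := leP x X0.
  have h1 : normc (psi (ray m x)) <= B by apply: (hB (x, m)); split; rewrite /= in_itv/= ?x0.
  have h2 : B <= `|B| := ler_norm B.
  have h3 : 0 <= `|B| by [].
  have h4 : 0 <= C * (1 + M) * (1 + x ^+ 2) by rewrite !mulr_ge0 ?addr_ge0// ltW.
  have h5 : 0 <= `|B| * x ^+ 2 by rewrite mulr_ge0.
  by rewrite mulrDr mulr1; lra.
set q := Num.sqrt (1 + m ^+ 2).
have qq : q ^+ 2 = 1 + m ^+ 2 by rewrite sqr_sqrtr// addr_ge0// sqr_ge0.
have q1 : 1 <= q by rewrite -sqrtr1 ler_sqrt ?ler_wpDr ?sqr_ge0// addr_ge0// sqr_ge0.
have [XR X1] : R0 <= X0 /\ 1 <= X0 by rewrite /X0 !le_max !lexx ?orbT.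
have xq : x <= x * q by rewrite ler_peMr.
have rho1 : 1 <= x * q by lra.
have hm : Num.min (atan m1) (gm / 2) <= atan m <= Num.max (atan m2) (gp / 2).
  by apply/andP; split; [rewrite ge_min le_atan|rewrite le_max le_atan].
have := hC (atan m) (x * q) hm ltac:(lra).
rewrite -ray_polar.
rewrite normcE0 lecR => /le_trans; apply.
have h6 : (x * q) `^ nu <= (x * q) ^+ 2.
  rewrite -powR_mulrn; last by lra.
  by apply: ler_powR => //; exact: ltW.
have h7 : (x * q) ^+ 2 <= (1 + M) * (1 + x ^+ 2).
  rewrite exprMn qq; have : (1 + m ^+ 2) * x ^+ 2 <= (1 + M) * x ^+ 2 by rewrite ler_wpM2r// lerD2l.
  by rewrite mulrDr mulr1 mulrC; lra.
have h8 : 0 <= `|B| * (1 + x ^+ 2) by rewrite mulr_ge0// addr_ge0.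
have h9 : C * (x * q) `^ nu <= C * ((1 + M) * (1 + x ^+ 2)).
  by rewrite ler_pM2l// (le_trans h6).
rewrite mulrA in h9; lra.
Qed.

Lemma poly_le_exp (k : R) : 0 < k -> exists2 C : R, 0 <= C & forall x, 0 <= x ->
  (1 + x ^+ 2) * expR (- (k * x)) <= C * expR (- (k / 2 * x)).
Proof.
move=> k0; exists (1 + 16 / k ^+ 2).
  by rewrite addr_ge0// divr_ge0// sqr_ge0.
move=> x x0.
have kx : 0 <= k / 4 * x by rewrite mulr_ge0// divr_ge0// ltW.
have h1 : 1 + (k / 4 * x) ^+ 2 <= expR (k / 2 * x).
  have -> : k / 2 * x = k / 4 * x + k / 4 * x by lra.
  rewrite expRD; have := expR_ge1Dx (k / 4 * x); set y := k / 4 * x in kx *; set e := expR y => ye.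
  by nra.
have h2 : 1 + x ^+ 2 <= (1 + 16 / k ^+ 2) * (1 + (k / 4 * x) ^+ 2).
  have -> : (1 + 16 / k ^+ 2) * (1 + (k / 4 * x) ^+ 2) = 1 + x ^+ 2 + (16 / k ^+ 2 + (k / 4 * x) ^+ 2).
    by field; rewrite gt_eqF.
  by rewrite lerDl addr_ge0 ?sqr_ge0// divr_ge0// sqr_ge0.
have -> : expR (- (k * x)) = expR (- (k / 2 * x)) * expR (- (k / 2 * x)).
  by rewrite -expRD; congr expR; lra.
rewrite mulrA ler_pM2r ?expR_gt0//.
rewrite expRN ler_pdivrMr ?expR_gt0//.
apply: (le_trans h2); rewrite ler_wpM2l//.
by rewrite addr_ge0// divr_ge0// sqr_ge0.
Qed.

Lemma is_derive_expRM (c t : R) : is_derive t 1 (fun x => expR (- (c * x))) (- c * expR (- (c * t))).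
Proof.
have h1 : is_derive t 1 (fun x : R => - c * x) (- c).
  have := is_deriveM (is_derive_cst (- c) t 1) (is_derive_id t 1).
  by move/is_derive_ext; apply => //; rewrite /GRing.scale/= mulr0 addr0 mulr1.
have := is_derive1_comp (is_derive_expR (- c * t)) h1.
move/is_derive_ext; apply => [x /=|]; first by rewrite mulNr.
by rewrite (mulNr c t) mulrC.
Qed.

Lemma expR_integrable (c : R) : 0 < c ->
  leb.-integrable `[0, +oo[ (EFin \o (fun x => expR (- (c * x)))).
Proof.
move=> c0.
have ct : continuous (fun x : R => expR (- (c * x))).
  move=> x; have [/derivable1_diffP h _] := is_derive_expRM c x.
  exact: differentiable_continuous.
apply/integrableP; split.
  apply/measurable_EFinP; apply: measurable_funTS.
  exact: continuous_measurable_fun.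
under eq_integral do rewrite /= ger0_norm ?expR_ge0//.
have F'E (x : R) : is_derive x 1 (fun x => - c^-1 * expR (- (c * x))) (expR (- (c * x))).
  have := is_deriveM (is_derive_cst (- c^-1) x 1) (is_derive_expRM c x).
  move/is_derive_ext; apply => //; rewrite /GRing.scale/= mulr0 addr0.
  by field; rewrite gt_eqF.
rewrite (@ge0_continuous_FTC2y _ _ (fun x => - c^-1 * expR (- (c * x))) 0 0).
- exact: ltry.
- by move=> x _; exact: expR_ge0.
- exact: continuous_subspaceT.
- rewrite -[X in _ --> X](mulr0 (- c^-1)); apply: cvgM; first exact: cvg_cst.
  apply: (@cvg_comp _ _ _ (fun x => c * x) (fun x => expR (- x)) _ +oo%R); last exact: cvgr_expR.
  by apply: gt0_cvgMry => //; exact: cvg_id.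
- by move=> x _; have [] := F'E x.
- by apply: cvg_at_right_filter; apply: cvgM; [exact: cvg_cst|exact: ct].
- by move=> x _; rewrite derive1E; have [_ ->] := F'E x.
Qed.

End rays.

(** * Integrals of exp(- s z) psi(z) along half-lines *)

Section laplace.
Context {R : realType}.
Implicit Types (z w s : R[i]).
Notation leb := (@lebesgue_measure R).

Lemma exhaustion_cvg d (T : measurableType d) (mu : {measure set T -> \bar R}) (S : (set T)^nat) (h : T -> R) :
  (forall n, measurable (S n)) -> (forall n m, (n <= m)%N -> S n `<=` S m) ->
  mu.-integrable (\bigcup_n S n) (EFin \o h) ->
  Rintegral mu (S n) h @[n --> \oo] --> Rintegral mu (\bigcup_n S n) h.
Proof.
move=> mS Sle hi.
have mSU : measurable (\bigcup_n S n) by exact: bigcup_measurable.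
have hS n : mu.-integrable (S n) (EFin \o h).
  by apply: integrableS hi => //; exact: bigcup_sup.
have hn := integrable_norm hi.
apply: (proj2 (@integrable_exhaustion _ _ _ mu S h (Rintegral mu (\bigcup_n S n) (fun t => `|h t|)) mS Sle hS _)) => n.
rewrite /Rintegral fine_le//.
- by apply: integrable_fin_num => //; exact: integrable_norm.
- exact: integrable_fin_num.
- apply: ge0_subset_integral => //; first by case/integrableP : hn.
  exact: bigcup_sup.
Qed.

Context {mum mup gm gp : R} {psi : R[i] -> R[i]}.
Hypothesis mum0 : mum <= 0.
Hypothesis mup0 : 0 <= mup.
Hypothesis mu_lt : mum < mup.
Hypothesis gm0 : gm < 0.
Hypothesis gp0 : 0 < gp.
Let D := dom mum mup gm gp.
Hypothesis psi_ana : forall z, D z -> analytic_at psi z.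
Hypothesis psi_cont : ccont_on (D `|` real_line) psi.
Hypothesis psi_growth : forall m1 m2 : R, slope gm gp m1 -> slope gm gp m2 ->
  exists2 C : R, 0 <= C & forall x m, 0 <= x -> m1 <= m <= m2 ->
    normc (psi (ray m x)) <= C * (1 + x ^+ 2).

(** The parameter is complex: [s = i x] gives the integrand of the contour integrals, [s = e + i y]
    its damped version. *)
Definition lap s z : R[i] := cexp (- (s * z)) * psi z.

Lemma ccont_on_lap (S : set R[i]) s : ccont_on S psi -> ccont_on S (lap s).
Proof.
move=> pc z Sz; apply: ccvgM; last exact: pc.
apply: ccvg_cexp; apply: ccvgN; apply: ccvgM; first exact: ccvg_cst.
exact: ccont_on_id Sz.
Qed.

Lemma hol_lap s : exists dg, hol_on D (lap s) dg.
Proof.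
have [dpsi [h1 h2 h3]] := analytic_hol psi_ana.
exists (fun z => cexp (- (s * z)) * (dpsi z - s * psi z)); split.
- move=> c t c' Dc cc.
  have e1 := cder_cexp (cderN (cderM (cder_cst s t) cc)).
  have e2 := cderM e1 (h1 _ _ _ Dc cc).
  by apply: (cder_ext e2) => //; ring.
- move=> z Dz; apply: ccvgM.
    apply: ccvg_cexp; apply: ccvgN; apply: ccvgM; first exact: ccvg_cst.
    exact: ccont_on_id Dz.
  apply: ccvgD; first exact: h2.
  by apply: ccvgN; apply: ccvgM; [exact: ccvg_cst|exact: h3].
- exact: ccont_on_lap.
Qed.

Let lapc0 s : ccont_on (D `|` [set 0]) (lap s).
Proof.
apply: ccont_onW (ccont_on_lap s psi_cont) => z [Dz|->]; first by left.
by right; exists 0.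
Qed.

Let Dray m x : slope gm gp m -> 0 < x -> D (ray m x).
Proof.
move=> sm x0; apply: (@dom_cone _ _ _ _ _ mum0 mup0 mu_lt _ m) => //=.
  by rewrite gt_eqF.
by rewrite gtr0_norm.
Qed.

Let Dray0 m x : slope gm gp m -> 0 <= x -> (D `|` real_line) (ray m x).
Proof.
move=> sm; rewrite le_eqVlt => /predU1P[<-|x0]; last by left; exact: Dray.
by right; exists 0 => //; rewrite /ray mul0r.
Qed.

(* The half-lines of slopes [m1 <= m <= m2] lie in the half-plane where
   [exp (- s z)] decays. *)
Definition sectorial s (m1 m2 k : R) : Prop :=
  [/\ slope gm gp m1, slope gm gp m2, 0 < k,
      k <= Re s - Im s * m1 & k <= Re s - Im s * m2].

(** The real part of [s * ray m x] is [x * (Re s - Im s * m)], affine in [m], so that the lower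
    bound [k] at both ends holds in between. Half of the rate [k] pays for the polynomial growth of
    psi. *)
Lemma lap_decay s m1 m2 k : sectorial s m1 m2 k -> exists2 C : R, 0 <= C &
  forall x m, 0 <= x -> m1 <= m <= m2 -> normc (lap s (ray m x)) <= C * expR (- (k / 2 * x)).
Proof.
move=> [s1 s2 k0 k1 k2].
have [C C0 hC] := psi_growth s1 s2.
have [C' C'0 hC'] := poly_le_exp k0.
exists (C * C') => [|x m x0 xm]; first by rewrite mulr_ge0.
rewrite /lap normcM normc_cexp.
have e1 : Re (- (s * ray m x)) <= - (k * x).
  have -> : Re (- (s * ray m x)) = - ((Re s - Im s * m) * x) by rewrite !ReImE/=; ring.
  rewrite lerN2 ler_wpM2r//; move: xm => /andP[m1m mm2].
  have [i0|i0] := leP 0 (Im s).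
    by rewrite (le_trans k2)// lerD2l lerN2 ler_wpM2l.
  by rewrite (le_trans k1)// lerD2l lerN2 ler_wnM2l// ltW.
apply: (@le_trans _ _ (expR (- (k * x)) * (C * (1 + x ^+ 2)))).
  by apply: ler_pM; rewrite ?expR_ge0 ?normc_ge0 ?ler_expR//; exact: hC.
have := ler_wpM2l C0 (hC' x x0) => h.
by rewrite mulrCA [expR _ * _]mulrC (le_trans h)// mulrA.
Qed.

(** The factor [1 +i* m] is the derivative of [ray m]. *)
Definition rint s m (x : R) : R[i] := (1 +i* m) * lap s (ray m x).

Definition rayint s m : R[i] := cintegral leb `[0, +oo[ (rint s m).

Lemma measurable_ray (g : R[i] -> R[i]) m : ccont_on (D `|` real_line) g -> slope gm gp m ->
  measurable_fun (`[0, +oo[%classic : set (measurableTypeR R)) (fun x => Re (g (ray m x))) /\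
  measurable_fun (`[0, +oo[%classic : set (measurableTypeR R)) (fun x => Im (g (ray m x))).
Proof.
move=> gc sm.
have h (t : R) : 0 <= t -> ccvg (within `[0, +oo[ (nbhs t)) (fun x => g (ray m x)) (g (ray m t)).
  move=> t0; apply: (ccont_on_comp gc (Dray0 sm t0)).
    by rewrite near_withinE; apply: nearW => x; rewrite /= in_itv/= andbT; exact: Dray0.
  apply: ccvg_ray; last exact: cvg_cst.
  exact: (cvg_within _).
split; apply: subspace_continuous_measurable_fun => //; apply/subspace_continuousP => t;
  by rewrite /= in_itv/= andbT => /h[].
Qed.

Lemma rint_measurable s m : slope gm gp m ->
  measurable_fun (`[0, +oo[%classic : set (measurableTypeR R)) (fun x => Re (rint s m x)) /\
  measurable_fun (`[0, +oo[%classic : set (measurableTypeR R)) (fun x => Im (rint s m x)).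
Proof.
move=> sm; apply: (@measurable_ray (fun z => (1 +i* m) * lap s z)) => //.
move=> z Sz; apply: ccvgM; first exact: ccvg_cst.
exact: (ccont_on_lap s psi_cont).
Qed.

Lemma rint_decay s m1 m2 k : sectorial s m1 m2 k -> exists2 C : R, 0 <= C &
  forall x m, 0 <= x -> m1 <= m <= m2 -> normc (rint s m x) <= C * expR (- (k / 2 * x)).
Proof.
move=> sect; have [C C0 hC] := lap_decay sect.
exists ((1 + (`|m1| + `|m2|)) * C) => [|x m x0 xm]; first by rewrite mulr_ge0// !addr_ge0.
rewrite /rint normcM -[leRHS]mulrA; apply: ler_pM; rewrite ?normc_ge0 ?hC//.
rewrite (le_trans (normc_leD _))//= normr1 lerD2l.
move: xm => /andP[m1m mm2]; rewrite ler_norml.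
have a1 := ler_norm m2; have a2 := ler_norm (- m1); rewrite normrN in a2.
have a3 := normr_ge0 m1; have a4 := normr_ge0 m2.
by apply/andP; split; lra.
Qed.

Lemma integrable_of_decay (h : R -> R) (C c : R) : 0 < c ->
  measurable_fun (`[0, +oo[%classic : set (measurableTypeR R)) h ->
  (forall x, 0 <= x -> `|h x| <= C * expR (- (c * x))) ->
  leb.-integrable `[0, +oo[ (EFin \o h).
Proof.
move=> c0 mh hC.
have mI : measurable (`[0, +oo[%classic : set (measurableTypeR R)) by exact: measurable_itv.
have hi := integrableZl mI C (expR_integrable c0).
apply: le_integrable hi => //; first exact/measurable_EFinP.
move=> x /=; rewrite in_itv/= andbT => x0; rewrite lee_fin.
by rewrite (le_trans (hC x x0))// ler_norm.
Qed.

Lemma rint_integrable s m1 m2 k m : sectorial s m1 m2 k -> m1 <= m <= m2 ->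
  cintegrable leb `[0, +oo[ (rint s m).
Proof.
move=> sect mm; have [C C0 hC] := rint_decay sect.
have sm : slope gm gp m by case: sect => s1 s2 _ _ _; exact: slope_between s1 s2 mm.
have k2 : 0 < k / 2 by case: sect => _ _ k0 _ _; rewrite divr_gt0.
have [M1 M2] := rint_measurable s sm.
split; apply: (@integrable_of_decay _ C _ k2) => // x x0.
  by rewrite (le_trans (normc_Re _))// hC.
by rewrite (le_trans (normc_Im _))// hC.
Qed.

Let gstar : forall z (t : R), D z -> 0 < t <= 1 -> D (t%:C * z).
Proof. by move=> z t; exact: (dom_scale mum0 mup0). Qed.

Let gopen : forall z, D z -> exists2 d : R, 0 < d & forall w, normc (w - z) < d -> D w.
Proof. by move=> z; exact: dom_open. Qed.

Lemma cder_prim_lap s (c : R -> R[i]) (t : R) c' : D (c t) -> cder c t c' ->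
  cder (fun u => prim (lap s) (c u)) t (lap s (c t) * c').
Proof.
have [dg gh] := hol_lap s.
exact: (cder_prim gh (lapc0 s) gstar gopen).
Qed.

Lemma prim_lap_cont s : ccont_on D (prim (lap s)).
Proof.
have [dg gh] := hol_lap s.
exact: (prim_cont gh (lapc0 s) gstar gopen).
Qed.

Lemma cder_ray m (t : R) : cder (ray m) t (1 +i* m).
Proof.
apply: (cder_ext (cder_scale (1 +i* m) t)) => // x.
by rewrite rayE.
Qed.

Lemma prim_ray s m1 m2 k m (x : R) : sectorial s m1 m2 k -> m1 <= m <= m2 -> 0 <= x ->
  cint 0 x (rint s m) = prim (lap s) (ray m x).
Proof.
move=> sect mm; rewrite le_eqVlt => /predU1P[<-|x0].
  have r0 : ray m 0 = 0 by rewrite /ray mul0r.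
  rewrite r0 /prim /cint set_itv1 /cintegral !Rintegral_set1.
  rewrite (_ : 0 +i* 0 = cint 0 1 (fun=> 0)); last by rewrite cint_cst.
  by apply: eq_cint => t _; rewrite mul0r.
have [C C0 hC] := lap_decay sect.
have sm : slope gm gp m by case: sect => s1 s2 _ _ _; exact: slope_between s1 s2 mm.
have k0 : 0 < k by case: sect.
have r0 : prim (lap s) (ray m 0) = 0.
  rewrite /prim -[RHS](cint_cst 0); apply: eq_cint => t _.
  by rewrite {1}/ray mul0r mul0r.
have rayc : ccont_itv 0 x (ray m).
  by apply: ccont_itv_cts => t; apply: ccvg_ray; [exact: cvg_id|exact: cvg_cst].
rewrite (@cfundamental _ 0 x (fun t => prim (lap s) (ray m t)) (rint s m) x0).
- by rewrite r0 subr0.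
- move=> t /andP[]; rewrite le_eqVlt => /predU1P[<- _|t0 tx]; last first.
    have h := cder_ccvg (cder_prim_lap s (Dray sm t0) (cder_ray m t)).
    by case: h => h1 h2; split; apply: cvg_trans; [|exact: h1| |exact: h2]; apply: cvg_app; exact: cvg_within.
  (* At 0, possibly outside the domain, the continuity of the primitive has to be proved by hand: it
     is at most a multiple of [u] at [ray m u]. *)
  apply/ccvg_normcP => e e0.
  pose d := e / ((1 + `|m|) * C * 2 + 1).
  have B0 : 0 <= (1 + `|m|) * C * 2 by rewrite !mulr_ge0// addr_ge0.
  have d0 : 0 < d by rewrite divr_gt0// ltr_wpDl.
  rewrite near_withinE.
  apply/nbhs_ballP; exists d => // u ud uI; rewrite r0 subr0.
  have {}ud : `|u| < d by move: ud; rewrite /ball /= sub0r normrN.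
  have /andP[u0 ux] : 0 <= u <= x by move: uI; rewrite /= in_itv.
  rewrite (ger0_norm u0) in ud.
  apply: (@le_lt_trans _ _ (2 * ((u * (1 + `|m|) * C) * (1 - 0)))).
    rewrite /prim; apply: cint_bound => //.
      apply: ccont_itv_integrable; apply: ccont_itvM (ccont_itv_cst _) _.
      apply: (ccont_itv_comp (ccont_on_lap s psi_cont)) => [v /andP[t0 t1]|].
        rewrite rayE mulrA -rmorphM -rayE; apply: Dray0 => //; exact: mulr_ge0.
      exact: ccont_itvM ccont_itv_id (ccont_itv_cst _).
    move=> v /andP[t0 t1]; rewrite normcM; apply: ler_pM; rewrite ?normc_ge0//.
      rewrite rayE normcM normc_real (ger0_norm u0) ler_wpM2l//.
      by rewrite (le_trans (normc_leD _))//= normr1.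
    rewrite rayE mulrA -rmorphM -rayE.
    have h := hC (v * u) m (mulr_ge0 t0 u0) mm.
    apply: (le_trans h); rewrite ler_piMr// expR_le1 oppr_le0.
    by apply: mulr_ge0; [rewrite divr_ge0 ?(ltW k0)|exact: mulr_ge0].
  rewrite subr0 mulr1.
  move: ud; rewrite ltr_pdivlMr ?ltr_wpDl// => ud.
  by nra.
- apply: ccont_itvM (ccont_itv_cst _) _.
  apply: (ccont_itv_comp (ccont_on_lap s psi_cont)) => // t /andP[t0 _].
  exact: Dray0.
- move=> t /andP[t0 _].
  have h := cder_prim_lap s (Dray sm t0) (cder_ray m t).
  by apply: (cder_ext h) => //; rewrite /rint mulrC.
Qed.

(** The vertical segment at abscissa [x] has length O(x) and the integrand is O(exp(- k x / 2)) on
    it; this is why the limit at infinity does not depend on the direction. *)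
Lemma prim_vertical s m1 m2 k : sectorial s m1 m2 k -> exists2 C : R, 0 <= C &
  forall m m' x, m1 <= m <= m2 -> m1 <= m' <= m2 -> 0 < x ->
  normc (prim (lap s) (ray m x) - prim (lap s) (ray m' x)) <= C * (x * expR (- (k / 2 * x))).
Proof.
move=> sect; have [C C0 hC] := lap_decay sect.
exists (2 * (`|m1| + `|m2| + (`|m1| + `|m2|)) * C) => [|m m' x hm hm' x0].
  by rewrite !mulr_ge0// !addr_ge0.
have [s1 s2 _ _ _] := sect.
have xn0 : x != 0 by rewrite gt_eqF.
have segE (v : R) : ray m' x + v%:C * (ray m x - ray m' x) = ray ((1 - v) * m' + v * m) x.
  by apply: eqC; rewrite !ReImE/=; ring.
have between (v : R) : 0 <= v <= 1 -> m1 <= (1 - v) * m' + v * m <= m2.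
  move=> /andP[v0 v1]; move: hm hm' => /andP[? ?] /andP[? ?].
  by apply/andP; split; nra.
have Dseg (v : R) : 0 <= v <= 1 -> D (ray m' x + v%:C * (ray m x - ray m' x)).
  by move=> v01; rewrite segE; apply: Dray => //; exact: slope_between s1 s2 (between v v01).
have [dg gh] := hol_lap s.
rewrite -(prim_segment gh (lapc0 s) gstar Dseg).
have nd : normc (ray m x - ray m' x) <= x * (`|m1| + `|m2| + (`|m1| + `|m2|)).
  rewrite (le_trans (normc_leD _))// !ReImE/= subrr normr0 add0r -mulrBr normrM gtr0_norm//.
  rewrite ler_wpM2l ?(ltW x0)//.
  move: hm hm' => /andP[? ?] /andP[? ?].
  have a1 := ler_norm m2; have a2 := ler_norm (- m1); rewrite normrN in a2.
  have a3 := normr_ge0 m1; have a4 := normr_ge0 m2.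
  by rewrite ler_norml; apply/andP; split; lra.
have h := @cint_bound _ (fun v => (ray m x - ray m' x) * lap s (ray m' x + v%:C * (ray m x - ray m' x))) 0 1
   (x * (`|m1| + `|m2| + (`|m1| + `|m2|)) * (C * expR (- (k / 2 * x)))) ler01 _ _.
apply: (le_trans (h _ _)).
- apply: ccont_itv_integrable; apply: ccont_itvM (ccont_itv_cst _) _.
  apply: (ccont_itv_comp (lapc0 s)); last exact: ccont_itv_affine.
  by move=> v v01; left; exact: Dseg.
- move=> v v01; rewrite normcM; apply: ler_pM; rewrite ?normc_ge0// segE.
  by apply: hC (ltW x0) (between v v01).
- by rewrite subr0 mulr1; lra.
Qed.

(** The slopes [w n] vary because the wing of a contour need not be straight. *)
Lemma ray_limit s m1 m2 k m (u w : nat -> R) : sectorial s m1 m2 k -> m1 <= m <= m2 ->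
  (forall n n', (n <= n')%N -> u n <= u n') -> u @ \oo --> +oo ->
  (forall n, m1 <= w n <= m2) ->
  ccvg \oo (fun n => prim (lap s) (ray (w n) (u n))) (rayint s m).
Proof.
move=> sect mm umono uy wm.
have [i1 i2] := rint_integrable sect mm.
have Sle n n' : (n <= n')%N -> `[0, u n]%classic `<=` `[0, u n']%classic.
  move=> nn' x; rewrite /= !in_itv/= => /andP[-> xu]; exact: le_trans xu (umono _ _ nn').
have SU : \bigcup_n `[0, u n]%classic = `[0, +oo[%classic :> set R.
  apply/seteqP; split => x /=.
    by move=> [n _]; rewrite /= !in_itv/= => /andP[->].
  rewrite in_itv/= andbT => x0.
  have /cvgryPge/(_ x)[n _ hn] := uy.
  by exists n => //=; rewrite in_itv/= x0; apply: hn => /=.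
have mS n : measurable (`[0, u n]%classic : set (measurableTypeR R)) by exact: measurable_itv.
have c0 : ccvg \oo (fun n => cint 0 (u n) (rint s m)) (rayint s m).
  split; rewrite /cint /rayint /cintegral /= -SU.
    by apply: exhaustion_cvg => //; rewrite SU.
  by apply: exhaustion_cvg => //; rewrite SU.
have upos : \forall n \near \oo, 0 < u n by move/cvgryPgt : uy; apply.
have c1 : ccvg \oo (fun n => prim (lap s) (ray m (u n))) (rayint s m).
  have [h1 h2] := c0.
  split; [apply: cvg_trans h1|apply: cvg_trans h2]; apply: near_eq_cvg;
  by apply: filterS upos => n un; rewrite (prim_ray sect)// ltW.
have [C C0 hC] := prim_vertical sect.
have k0 : 0 < k by case: sect.
have c2 : ccvg \oo (fun n => prim (lap s) (ray (w n) (u n)) - prim (lap s) (ray m (u n))) 0.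
  apply/ccvg_normcP => e e0.
  (* By [1 + t <= exp t] at [t = k x / 4], [x exp(- k x / 2)] is at most
     [(4 / k) exp(- k x / 4)]. *)
  have lim0 : C * (4 / k) * expR (- (k / 4 * u n)) @[n --> \oo] --> 0.
    rewrite -[X in _ --> X](mulr0 (C * (4 / k))); apply: cvgM; first exact: cvg_cst.
    have uk : (fun n => k / 4 * u n) @ \oo --> +oo.
      have kid : (fun x : R => k / 4 * x) @ +oo --> +oo.
        by apply: gt0_cvgMry; [rewrite divr_gt0|exact: cvg_id].
      exact: (cvg_comp _ _ uy kid).
    exact: (cvg_comp _ _ uk (@cvgr_expR R)).
  have /cvgrPdist_lt/(_ _ e0) := lim0.
  apply: filterS2 upos => n un; rewrite sub0r normrN => h.
  rewrite subr0 (le_lt_trans (hC _ _ _ (wm n) mm un))//.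
  apply: le_lt_trans h; apply: le_trans (ler_norm _).
  rewrite -(mulrA C); apply: ler_wpM2l => //.
  have -> : k / 2 * u n = k / 4 * u n + k / 4 * u n by lra.
  rewrite opprD expRD mulrA ler_wpM2r ?expR_ge0//.
  rewrite expRN ler_pdivrMr ?expR_gt0//.
  have := expR_ge1Dx (k / 4 * u n).
  move=> h; apply: (@le_trans _ _ (4 / k * (k / 4 * u n))).
    by rewrite le_eqVlt; apply/orP; left; apply/eqP; field; rewrite gt_eqF.
  by rewrite ler_wpM2l ?divr_ge0 ?(ltW k0)//; lra.
have := ccvgD c2 c1; rewrite add0r => c3.
suff -> : (fun n => prim (lap s) (ray (w n) (u n))) = (fun n =>
   prim (lap s) (ray (w n) (u n)) - prim (lap s) (ray m (u n)) + prim (lap s) (ray m (u n))) by exact: c3.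
by apply/funext => n; rewrite subrK.
Qed.

(** Rotation of the half-line: one and the same sequence of values of the primitive converges to
    both integrals. *)
Lemma rayint_slope s m1 m2 k m m' : sectorial s m1 m2 k -> m1 <= m <= m2 -> m1 <= m' <= m2 ->
  rayint s m = rayint s m'.
Proof.
move=> sect hm hm'.
have um n n' : (n <= n')%N -> n%:R <= n'%:R :> R by rewrite ler_nat.
have uy : (fun n => n%:R : R) @ \oo --> +oo by exact: cvgr_idn.
have c1 := ray_limit (w := fun=> m) sect hm um uy (fun=> hm).
have c2 := ray_limit (w := fun=> m) sect hm' um uy (fun=> hm).
exact: ccvg_unique c1 c2.
Qed.

End laplace.

(** * Contour integrals *)

Section contours.
Context {R : realType}.
Implicit Types (z w s : R[i]).
Notation leb := (@lebesgue_measure R).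

Lemma itv_split (a c b : R) (h : R -> R) : a <= c -> c <= b -> leb.-integrable `[a, b] (EFin \o h) ->
  Rintegral leb `[a, b] h = Rintegral leb `[a, c] h + Rintegral leb `[c, b] h.
Proof.
move=> ac cb hi.
have abE : `[a, b]%classic = `[a, c] `|` `]c, b] :> set (measurableTypeR R).
  apply/seteqP; split => x /=; rewrite !in_itv/=.
    move=> /andP[ax xb]; have [xc|cx] := leP x c; [by left; rewrite ax|by right].
  move=> [/andP[-> xc]|/andP[cx ->]]; first by rewrite (le_trans xc).
  by rewrite andbT (le_trans ac)// ltW.
have dj : [disjoint `[a, c]%classic & `]c, b]%classic].
  apply/disj_setPS => x [/=]; rewrite !in_itv/= => /andP[_ xc] /andP[cx _].
  by have := le_lt_trans xc cx; rewrite ltxx.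
have i2 : leb.-integrable `]c, b] (EFin \o h).
  apply: integrableS hi => // x; rewrite /= !in_itv/= => /andP[/ltW cx ->].
  by rewrite andbT (le_trans ac).
rewrite {1}abE Rintegral_setU//; last by rewrite -abE.
by congr (_ + _); exact: Rintegral_itv_obnd_cbnd.
Qed.

Lemma is_derive_derive1 (f : R -> R) (t : R) : derivable f t 1 -> is_derive t 1 f (derive1 f t).
Proof. by move=> d; rewrite derive1E; apply: DeriveDef. Qed.

Lemma tan_le (a phi : R) : - (pi / 2) < a -> a <= phi -> phi < pi / 2 -> tan a <= tan phi.
Proof.
move=> h1 h2 h3; rewrite leNgt; apply/negP => /lt_atan.
have [_ ->] := @tan_bounds R phi ltac:(by apply/andP; split; lra).
have [_ ->] := @tan_bounds R a ltac:(by apply/andP; split; lra).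
by rewrite ltNge h2.
Qed.

Lemma closed_cone_ray (a b : R) z : - (pi / 2) < a -> a <= b -> b < pi / 2 -> closed_cone a b z ->
  (0 < Re z -> exists2 w : R, tan a <= w <= tan b & z = ray w (Re z)) /\
  (Re z < 0 -> exists2 w : R, tan a <= w <= tan b & refl z = ray w (- Re z)).
Proof.
move=> ha ab hb [rho [phi [rho0 hphi ->]]].
rewrite Re_polar.
case: hphi => /andP[p1 p2].
  have [c0 tE] := @tan_bounds R phi ltac:(by apply/andP; split; lra).
  split; last by rewrite ltNge (ltW (mulr_gt0 rho0 c0)).
  move=> _; exists (tan phi); first by rewrite !tan_le//; lra.
  apply: eqC; rewrite ?(Re_polar, Im_polar)//= /tan.
  by field; rewrite gt_eqF.
have [c0 tE] := @tan_bounds R (pi - phi) ltac:(by apply/andP; split; lra).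
have cE : cos phi = - cos (pi - phi) by rewrite cosB cospi sinpi; ring.
have sE : sin phi = sin (pi - phi) by rewrite sinB cospi sinpi; ring.
split; first by rewrite cE mulrN oppr_gt0 ltNge (ltW (mulr_gt0 rho0 c0)).
move=> _; exists (tan (pi - phi)); first by rewrite !tan_le//; lra.
apply: eqC; rewrite ?(Re_refl, Im_refl, Re_polar, Im_polar)//= /tan cE sE.
by field; rewrite gt_eqF.
Qed.

Context {mum mup gm gp : R} {psi : R[i] -> R[i]}.
Hypothesis mum0 : mum <= 0.
Hypothesis mup0 : 0 <= mup.
Hypothesis mu_lt : mum < mup.
Hypothesis gm0 : gm < 0.
Hypothesis gp0 : 0 < gp.
Let D := dom mum mup gm gp.
Hypothesis psi_ana : forall z, D z -> analytic_at psi z.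
Hypothesis psi_cont : ccont_on (D `|` real_line) psi.
Hypothesis psi_growth : forall m1 m2 : R, slope gm gp m1 -> slope gm gp m2 ->
  exists2 C : R, 0 <= C & forall x m, 0 <= x -> m1 <= m <= m2 ->
    normc (psi (ray m x)) <= C * (1 + x ^+ 2).
Hypothesis psi_refl : forall z, (D `|` [set 0]) z -> psi (refl z) = (psi z)^*%C.

(** This relies on a purely imaginary parameter: [- i y refl z] is then the conjugate of
    [- i y z]. *)
Lemma lap_refl (y : R) z : (D `|` [set 0]) z ->
  lap (psi := psi) ('i%C * y%:C) (refl z) = (lap (psi := psi) ('i%C * y%:C) z)^*%C.
Proof.
move=> Dz; rewrite /lap psi_refl//.
have -> : - ('i%C * y%:C * refl z) = (- ('i%C * y%:C * z))^*%C.
  by apply: eqC; rewrite !(Re_refl, Im_refl, Re_conj, Im_conj, ReImE)/=; ring.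
by rewrite cexp_conj -rmorphM.
Qed.

Lemma prim_lap_refl (y : R) z : D z ->
  prim (lap (psi := psi) ('i%C * y%:C)) (refl z) = refl (prim (lap (psi := psi) ('i%C * y%:C)) z).
Proof.
move=> Dz.
have E (t : R) : 0 <= t <= 1 -> refl z * lap (psi := psi) ('i%C * y%:C) (t%:C * refl z) =
    refl (z * lap (psi := psi) ('i%C * y%:C) (t%:C * z)).
  move=> /andP[t0 t1].
  have tE : t%:C * refl z = refl (t%:C * z).
    rewrite /refl rmorphM mulrN; congr (- (_ * _)).
    by apply: eqC; rewrite ?(Re_conj,Im_conj)/= ?oppr0.
  have D0 : (D `|` [set 0]) (t%:C * z).
    move: t0; rewrite le_eqVlt => /predU1P[<-|t0]; first by right; rewrite /= mul0r.
    by left; apply: dom_scale => //; rewrite t0.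
  by rewrite tE lap_refl// /refl mulNr -rmorphM.
rewrite /prim (eq_cint E); apply: eqC; rewrite ?(Re_refl, Im_refl) /cint /cintegral/=.
  have zc : ccont_itv 0 1 (fun t => z * lap (psi := psi) ('i%C * y%:C) (t%:C * z)).
    apply: ccont_itvM (ccont_itv_cst _) _.
    apply: (ccont_itv_comp (ccont_on_lap _ psi_cont)); last first.
      exact: ccont_itvM ccont_itv_id (ccont_itv_cst _).
    move=> t /andP[]; rewrite le_eqVlt => /predU1P[<- _|t0 t1].
      by right; exists 0 => //; rewrite mul0r.
    by left; apply: dom_scale => //; rewrite t0.
  have [zi _] := ccont_itv_integrable zc.
  rewrite -mulN1r -RintegralZl//; apply: eq_Rintegral => t _.
  by rewrite Re_refl mulN1r.
by under eq_Rintegral do rewrite Im_refl.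
Qed.

Lemma derive1_nondecreasing_ge0 (X : R -> R) t : {homo X : u v / u <= v} -> 0 <= derive1 X t.
Proof.
move=> Xm; rewrite /derive1.
have [c|nc] := pselect (cvg (h^-1 *: (X (h + t) - X t) @[h --> 0^'])); last first.
  (* Where the difference quotient diverges, its [lim] is the default value 0. *)
  by rewrite (dvgP nc).
apply: limr_ge => //; near=> h.
have h0 : h != 0 by near: h; exact: nbhs_dnbhs_neq.
rewrite /GRing.scale/=; have [hp|hn|/eqP] := ltgtP 0 h; last by rewrite eq_sym (negbTE h0).
  by rewrite mulr_ge0 ?invr_ge0 ?(ltW hp)// subr_ge0 Xm// lerDr ltW.
by rewrite mulr_le0 ?invr_le0 ?(ltW hn)// subr_le0 Xm// gerDr ltW.
Unshelve. all: by end_near. Qed.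

Lemma Rintegral_le_primitive (ss : seq R) (p q : R) (h E e : R -> R) : p <= q ->
  leb.-integrable `[p, q] (EFin \o h) -> (forall t, p <= t <= q -> `|h t| <= e t) ->
  continuous E ->
  (forall t, t \notin ss -> is_derive t 1 E (e t) /\ {for t, continuous e}) ->
  (forall t, cvg (e u @[u --> t^'+]) /\ cvg (e u @[u --> t^'-])) ->
  Rintegral leb `[p, q] (fun t => `|h t|) <= E q - E p.
Proof.
move=> pq hi he Ec Ed el.
have [i1 <-] := @piecewise_fundamental _ ss p q E e pq (continuous_subspaceT Ec)
  (fun t _ ts => Ed t ts) (fun t _ => el t).
by apply: le_Rintegral => //; exact: integrable_norm.
Qed.

(* The primitive of [lap s] tends to [rayint s m] along the right wing and, by
   reflection, to minus its conjugate along the left wing. *)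
Lemma contour_value (S : set R[i]) (L : R -> R[i]) (a b y k m1 m2 m : R) :
  let s := 'i%C * y%:C in
  S `<=` D -> - (pi / 2) < a -> a <= b -> b < pi / 2 -> m1 <= tan a -> tan b <= m2 ->
  sectorial (gm := gm) (gp := gp) s m1 m2 k -> m1 <= m <= m2 -> regular_contour S a b L ->
  contour_integrable (lap (psi := psi) s) L /\
  contour_integral (lap (psi := psi) s) L = (2 * Re (rayint (psi := psi) s m))%:C.
Proof.
move=> s SD ha ab hb m1a bm2 sect mm [[pX pY] Xinc [Xy XNy] SL [t0 [K wing]]].
set X := fun t => Re (L t); set Y := fun t => Im (L t).
have [Xc [s1 s1X] Xl] := pX; have [Yc [s2 s2Y] Yl] := pY.
set g := lap (psi := psi) s; set k' := contour_integrand g L.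
pose ss := s1 ++ s2.
have nss t : t \notin ss -> t \notin s1 /\ t \notin s2.
  by rewrite mem_cat negb_or => /andP.
have DL t : D (L t) by apply: SD.
have Lc t : ccvg (nbhs t) L (L t) by split; [exact: Xc|exact: Yc].
have Ld t : t \notin ss -> cder L t (curve_derivative L t).
  move=> /nss[h1 h2]; have [d1 _] := s1X t h1; have [d2 _] := s2Y t h2.
  by split; [exact: is_derive_derive1 d1|exact: is_derive_derive1 d2].
have [dg gh] := hol_lap psi_ana s.
have Hd t : t \notin ss -> cder (fun u => prim g (L u)) t (k' t).
  by move=> ts; apply: (cder_prim_lap mum0 mup0 psi_ana psi_cont s (DL t)); exact: Ld.
pose H t := prim g (L t).
have Hc t : ccvg (nbhs t) H (H t).
  apply: (ccont_on_comp (prim_lap_cont mum0 mup0 psi_ana psi_cont s) (DL t)) => //; exact: nearW.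
have gLc t : ccvg (nbhs t) (fun u => g (L u)) (g (L t)).
  by case: gh => _ _ gc; apply: (ccont_on_comp gc (DL t)) => //; exact: nearW.
have k'c t : t \notin ss -> ccvg (nbhs t) k' (k' t).
  move=> /nss[h1 h2]; apply: ccvgM => //.
  by split; [have [_] := s1X t h1|have [_] := s2Y t h2].
have k'r t : cvg (Re (k' u) @[u --> t^'+]) /\ cvg (Im (k' u) @[u --> t^'+]).
  have [/cvg_ex[l1 h1] _] := Xl t; have [/cvg_ex[l2 h2] _] := Yl t.
  have h3 : ccvg t^'+ (curve_derivative L) (l1 +i* l2) by split.
  have h4 : ccvg t^'+ (fun u => g (L u)) (g (L t)).
    by have [q1 q2] := gLc t; split; exact: cvg_at_right_filter.
  have [q1 q2] := ccvgM h4 h3.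
  by split; apply/cvg_ex; eexists; [exact: q1|exact: q2].
have k'l t : cvg (Re (k' u) @[u --> t^'-]) /\ cvg (Im (k' u) @[u --> t^'-]).
  have [_ /cvg_ex[l1 h1]] := Xl t; have [_ /cvg_ex[l2 h2]] := Yl t.
  have h3 : ccvg t^'- (curve_derivative L) (l1 +i* l2) by split.
  have h4 : ccvg t^'- (fun u => g (L u)) (g (L t)).
    by have [q1 q2] := gLc t; split; exact: cvg_at_left_filter.
  have [q1 q2] := ccvgM h4 h3.
  by split; apply/cvg_ex; eexists; [exact: q1|exact: q2].
have ftc (p q : R) : p <= q -> cintegrable leb `[p, q] k' /\ cint p q k' = H q - H p.
  move=> pq.
  have [i1 e1] := @piecewise_fundamental _ ss p q (fun t => Re (H t)) (fun t => Re (k' t)) pq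
    (continuous_subspaceT (fun t => proj1 (Hc t)))
    (fun t _ ts => conj (proj1 (Hd t ts)) (proj1 (k'c t ts)))
    (fun t _ => conj (proj1 (k'r t)) (proj1 (k'l t))).
  have [i2 e2] := @piecewise_fundamental _ ss p q (fun t => Im (H t)) (fun t => Im (k' t)) pq
    (continuous_subspaceT (fun t => proj2 (Hc t)))
    (fun t _ ts => conj (proj2 (Hd t ts)) (proj2 (k'c t ts)))
    (fun t _ => conj (proj2 (k'r t)) (proj2 (k'l t))).
  by split => //; apply: eqC; rewrite /cint /cintegral !ReImE/= ?e1 ?e2.
have [C C0 hC] := lap_decay psi_growth sect.
have k0 : 0 < k by case: sect.
have k20 : 0 < k / 2 by rewrite divr_gt0.
(* Beyond [T] the conditions on the wings hold and the real part of [L t] has the sign of [t]. *)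
have [T [T0 Tt0 TX TNX]] : exists T : nat, [/\ (0 < T)%N, t0 <= T%:R, 0 < X T%:R & X (- T%:R) < 0].
  have /cvgryPgt/(_ 0)[A [_ hA]] := Xy.
  have /cvgrNyPlt/(_ 0)[A' [_ hA']] := XNy.
  pose M := `|A| + `|A'| + `|t0|.
  have M0 : 0 <= M by rewrite !addr_ge0.
  have := archi_boundP M0; set N := Num.bound M => MN.
  have a1 := ler_norm A; have a2 := ler_norm (- A'); have a3 := ler_norm t0; rewrite normrN in a2.
  have b1 := normr_ge0 A; have b2 := normr_ge0 A'; have b3 := normr_ge0 t0.
  have NN : N%:R <= N.+1%:R :> R by rewrite ler_nat.
  exists N.+1; split=> //; rewrite /M in MN; first lra.
    by apply: hA; lra.
  by apply: hA'; lra.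
have Xmono : {homo X : u v / u <= v}.
  by move=> u v; rewrite le_eqVlt => /predU1P[->//|/Xinc /ltW].
have XT t : T%:R <= t -> 0 < X t by move=> Tt; apply: lt_le_trans TX _; exact: Xmono.
have XNT t : t <= - T%:R -> X t < 0 by move=> tT; apply: le_lt_trans TNX; exact: Xmono.
have wingr t : T%:R <= t -> exists2 w : R, m1 <= w <= m2 & L t = ray w (X t).
  move=> Tt.
  have [cc _] := wing t (le_trans Tt0 (le_trans Tt (ler_norm _))).
  have [/(_ (XT _ Tt))[w /andP[w1 w2] wE] _] := closed_cone_ray ha ab hb cc.
  by exists w => //; rewrite (le_trans m1a)// (le_trans w2).
have wingl t : t <= - T%:R -> exists2 w : R, m1 <= w <= m2 & refl (L t) = ray w (- X t).
  move=> tT.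
  have Tt : T%:R <= `|t| by rewrite -normrN (le_trans _ (ler_norm _))// lerNr.
  have [cc _] := wing t (le_trans Tt0 Tt).
  have [_ /(_ (XNT _ tT))[w /andP[w1 w2] wE]] := closed_cone_ray ha ab hb cc.
  by exists w => //; rewrite (le_trans m1a)// (le_trans w2).
pose cd t := derive1 X t.
have cd0 t : 0 <= cd t by exact: derive1_nondecreasing_ge0.
pose B := C * (1 + `|K|).
have B0 : 0 <= B by rewrite mulr_ge0// addr_ge0.
(* The bounded slope of the wings makes the derivative of the real part control the speed of the
   curve. *)
have cdle t : t0 <= `|t| -> normc (curve_derivative L t) <= (1 + `|K|) * cd t.
  move=> /wing[_ h]; rewrite (le_trans (normc_leD _))// mulrDl mul1r.
  apply: lerD; first by rewrite /= ger0_norm//; exact: cd0.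
  by apply: (le_trans h); apply: ler_wpM2r (ler_norm _); exact: cd0.
have kr t : T%:R <= t -> normc (k' t) <= B * expR (- (k / 2 * X t)) * cd t.
  move=> Tt; rewrite normcM.
  have [w wm wE] := wingr t Tt.
  have h1 : normc (g (L t)) <= C * expR (- (k / 2 * X t)).
    by rewrite wE; apply: hC wm; exact: ltW (XT _ Tt).
  have h2 := cdle t (le_trans Tt0 (le_trans Tt (ler_norm _))).
  have -> : B * expR (- (k / 2 * X t)) * cd t = (C * expR (- (k / 2 * X t))) * ((1 + `|K|) * cd t).
    by rewrite /B; ring.
  by apply: ler_pM; rewrite ?normc_ge0.
have kl t : t <= - T%:R -> normc (k' t) <= B * expR (- (- (k / 2) * X t)) * cd t.
  move=> tT; rewrite normcM.
  have [w wm wE] := wingl t tT.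
  have Tt : T%:R <= `|t| by rewrite -normrN (le_trans _ (ler_norm _))// lerNr.
  have h1 : normc (g (L t)) <= C * expR (- (- (k / 2) * X t)).
    rewrite -normc_conj -lap_refl; last by left; exact: DL.
    rewrite wE mulNr -mulrN; apply: hC wm; rewrite oppr_ge0; exact: ltW (XNT _ tT).
  have h2 := cdle t (le_trans Tt0 Tt).
  have -> : B * expR (- (- (k / 2) * X t)) * cd t = (C * expR (- (- (k / 2) * X t))) * ((1 + `|K|) * cd t).
    by rewrite /B; ring.
  by apply: ler_pM; rewrite ?normc_ge0.
(* The majorant is the derivative of [- (B / c) * expR (- (c * X t))], so that its integral is
   explicit; [c] is [k / 2] on the right wing and [- (k / 2)] on the left one. *)
have bound (c p q : R) (h : R -> R) : c != 0 -> p <= q -> leb.-integrable `[p, q] (EFin \o h) ->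
    (forall t, p <= t <= q -> `|h t| <= B * expR (- (c * X t)) * cd t) ->
    Rintegral leb `[p, q] (fun t => `|h t|) <= - (B / c) * expR (- (c * X q)) - - (B / c) * expR (- (c * X p)).
  move=> c0 pq hi hle.
  have ec t : {for t, continuous (fun u => B * expR (- (c * X u)))}.
    apply: cvgM; first exact: cvg_cst.
    apply: (@cvg_comp _ _ _ (fun u => - (c * X u)) expR); last exact: continuous_expR.
    by apply: cvgN; apply: cvgM; [exact: cvg_cst|exact: Xc].
  apply: (@Rintegral_le_primitive ss p q h (fun t => - (B / c) * expR (- (c * X t)))
    (fun t => B * expR (- (c * X t)) * cd t) pq hi hle).
  - move=> t; apply: cvgM; first exact: cvg_cst.
    apply: (@cvg_comp _ _ _ (fun u => - (c * X u)) expR); last exact: continuous_expR.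
    by apply: cvgN; apply: cvgM; [exact: cvg_cst|exact: Xc].
  - move=> t /nss[h1 _]; have [d1 d2] := s1X t h1; split.
      have hX : is_derive t 1 X (cd t) by exact: is_derive_derive1 d1.
      have := is_deriveM (is_derive_cst (- (B / c)) t 1) (is_derive1_comp (is_derive_expRM c (X t)) hX).
      move/is_derive_ext; apply => //; rewrite /GRing.scale/= mulr0 addr0.
      by field.
    by apply: cvgM; [exact: ec|exact: d2].
  - move=> t; have [/cvg_ex[l1 h1] /cvg_ex[l2 h2]] := Xl t; split.
      apply/cvg_ex; eexists; apply: cvgM; last exact: h1.
      by apply: cvg_at_right_filter; exact: ec.
    apply/cvg_ex; eexists; apply: cvgM; last exact: h2.
    by apply: cvg_at_left_filter; exact: ec.
pose Sn n : set R := `[- (T + n)%:R, (T + n)%:R]%classic.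
have Sle n n' : (n <= n')%N -> Sn n `<=` Sn n'.
  move=> nn' x; rewrite /Sn /= !in_itv/= => /andP[x1 x2].
  have : (T + n)%:R <= (T + n')%:R :> R by rewrite ler_nat leq_add2l.
  by move=> h; apply/andP; split; lra.
have SU : \bigcup_n Sn n = setT.
  apply/seteqP; split => // x _.
  have := archi_boundP (normr_ge0 x); set N := Num.bound _ => xN.
  exists N => //; rewrite /Sn /= in_itv/= -ler_norml (le_trans (ltW xN))// ler_nat leq_addl//.
have mS n : measurable (Sn n : set (measurableTypeR R)) by exact: measurable_itv.
have TTn n : T%:R <= (T + n)%:R :> R by rewrite ler_nat leq_addr.
have Tn0 n : - (T + n)%:R <= (T + n)%:R :> R by rewrite (le_trans (y := 0))// oppr_le0.
(* Each wing contributes at most [B / (k / 2)], however far it is followed, and the middle piece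
   [-T, T] is fixed. *)
have expo (h : R -> R) : (forall p q, p <= q -> leb.-integrable `[p, q] (EFin \o h)) ->
    (forall t, `|h t| <= normc (k' t)) ->
    leb.-integrable setT (EFin \o h) /\ Rintegral leb (Sn n) h @[n --> \oo] --> Rintegral leb setT h.
  move=> hi hk'.
  rewrite -SU; apply: (@integrable_exhaustion _ _ _ leb Sn h
     (B / (k / 2) + (Rintegral leb `[- T%:R, T%:R] (fun t => `|h t|) + B / (k / 2)))) => // n.
    exact: hi.
  have T1 := TTn n; have T2 : 0 <= T%:R :> R by [].
  have hn p q : p <= q -> leb.-integrable `[p, q] (EFin \o (fun t => `|h t|)).
    by move=> /hi h1; exact: integrable_norm h1.
  have A1 : - (T + n)%:R <= - T%:R :> R by rewrite lerN2.
  have A2 : - T%:R <= T%:R :> R by rewrite (le_trans (y := 0))// oppr_le0.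
  have A3 := le_trans A2 T1.
  rewrite /Sn (itv_split A1 A3 (hn _ _ (Tn0 n))) (itv_split A2 T1 (hn _ _ A3)).
  have Bk : 0 <= B / (k / 2) by rewrite divr_ge0// ltW.
  apply: lerD; last apply: lerD => //.
    apply: le_trans (@bound (- (k / 2)) _ _ h _ _ _ _) _.
    - by rewrite oppr_eq0 gt_eqF.
    - exact: A1.
    - exact: hi.
    - by move=> t /andP[_ tT]; apply: le_trans (kl _ tT).
    - rewrite invrN mulrN opprK -mulNr; set e1 := expR _; set e2 := expR _.
      have e1' : e1 <= 1.
        have h0 : k / 2 * X (- T%:R) <= 0 by rewrite pmulr_rle0// (ltW TNX).
        by rewrite /e1 expR_le1 opprK.
      have e2' : 0 <= e2 by exact: expR_ge0.
      by rewrite -mulrBr ler_piMr// lerBlDr (le_trans e1')// lerDl.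
  apply: le_trans (@bound (k / 2) _ _ h _ _ _ _) _.
  - by rewrite gt_eqF.
  - exact: TTn.
  - by apply: hi.
  - by move=> t /andP[Tt _]; apply: le_trans (kr _ Tt).
  - rewrite !mulNr opprK addrC -mulrBr; set e2 := expR _; set e1 := expR _.
    have e1' : 0 <= e1 by exact: expR_ge0.
    have e2' : e2 <= 1 by rewrite /e2 expR_le1 oppr_le0 mulr_ge0 ?(ltW k20)// (ltW TX).
    by rewrite ler_piMr// lerBlDr (le_trans e2')// lerDl.
have [i1 c1] := expo (fun t => Re (k' t)) (fun p q pq => proj1 (proj1 (ftc p q pq))) (fun t => normc_Re _).
have [i2 c2] := expo (fun t => Im (k' t)) (fun p q pq => proj2 (proj1 (ftc p q pq))) (fun t => normc_Im _).
split; first by split.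
have lim : ccvg \oo (fun n => cint (- (T + n)%:R) (T + n)%:R k') (contour_integral g L) by split.
have lim' : ccvg \oo (fun n => H (T + n)%:R - H (- (T + n)%:R)) (contour_integral g L).
  suff -> : (fun n => H (T + n)%:R - H (- (T + n)%:R)) = (fun n => cint (- (T + n)%:R) (T + n)%:R k') by exact: lim.
  by apply/funext => n; rewrite (proj2 (ftc _ _ (Tn0 n))).
have toy : (fun n => (T + n)%:R : R) @ \oo --> +oo.
  apply/cvgryPge => A; near=> n; apply: (@le_trans _ _ n%:R); last by rewrite ler_nat leq_addl.
  by near: n; exact: nbhs_infty_ger.
have xr : (fun n => X (T + n)%:R) @ \oo --> +oo := cvg_comp _ _ toy Xy.
have xl : (fun n => - X (- (T + n)%:R)) @ \oo --> +oo.
  have h1 : (fun n => - (T + n)%:R : R) @ \oo --> -oo.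
    exact: (proj2 (cvgNrNy (fun n => (T + n)%:R : R)) toy).
  have h2 : (fun n => X (- (T + n)%:R)) @ \oo --> -oo := cvg_comp _ _ h1 XNy.
  exact: (proj2 (cvgNry (fun n => X (- (T + n)%:R))) h2).
have [wr hwr] := choice (fun n => let: ex_intro2 w h1 h2 := wingr _ (TTn n) in ex_intro _ w (conj h1 h2)).
have [wl hwl] := choice (fun n =>
  let: ex_intro2 w h1 h2 := wingl (- (T + n)%:R) ltac:(by rewrite lerN2) in ex_intro _ w (conj h1 h2)).
have nm n n' : (n <= n')%N -> (T + n)%:R <= (T + n')%:R :> R by move=> ?; rewrite ler_nat leq_add2l.
have limr := ray_limit mum0 mup0 mu_lt psi_ana psi_cont psi_growth (u := fun n => X (T + n)%:R) (w := wr) sect mm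
   (fun n n' nn' => Xmono _ _ (nm _ _ nn')) xr (fun n => proj1 (hwr n)).
have liml := ray_limit mum0 mup0 mu_lt psi_ana psi_cont psi_growth (u := fun n => - X (- (T + n)%:R)) (w := wl) sect mm
   (fun n n' nn' => ltac:(by rewrite lerN2; apply: Xmono; rewrite lerN2; exact: nm)) xl (fun n => proj1 (hwl n)).
have {}limr : ccvg \oo (fun n => H (T + n)%:R) (rayint (psi := psi) s m).
  by move: limr; under eq_fun do rewrite -(proj2 (hwr _)).
have {}liml : ccvg \oo (fun n => H (- (T + n)%:R)) (refl (rayint (psi := psi) s m)).
  have HE : (fun n => H (- (T + n)%:R)) =
      (fun n => - (prim g (ray (wl n) (- X (- (T + n)%:R))))^*%C).
    apply/funext => n.
    rewrite -(proj2 (hwl n)) -[RHS]/(refl (prim g (refl (L (- (T + n)%:R))))).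
    rewrite -(prim_lap_refl y (dom_refl (DL (- (T + n)%:R)))).
    by congr (prim g _); apply: eqC; rewrite ?(Re_refl, Im_refl) ?opprK.
  by rewrite HE; apply: ccvgN; exact: ccvg_conj liml.
(* Subtracting the reflection of a number adds its conjugate, whence twice the real part. *)
have lim2 : ccvg \oo (fun n => H (T + n)%:R - H (- (T + n)%:R))
    (rayint (psi := psi) s m - refl (rayint (psi := psi) s m)).
  by apply: ccvgD => //; exact: ccvgN.
rewrite (ccvg_unique _ lim' lim2).
by apply: eqC; rewrite !ReImE ?(Re_refl,Im_refl)/=; ring.
Unshelve. all: by end_near. Qed.

End contours.

(** * The density *)

Section density.
Context {R : realType}.
Implicit Types z w : R[i].
Notation leb := (@lebesgue_measure R).

Lemma powx_le_exp (c : R) n : 0 < c -> exists2 C : R, 0 <= C & forall x, 0 <= x ->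
  x ^+ n <= C * expR (c * x).
Proof.
elim: n c => [c c0|n ih c c0].
  exists 1 => // x x0; rewrite expr0 mul1r -expR0 ler_expR.
  by rewrite mulr_ge0// ltW.
have c20 : 0 < c / 2 by rewrite divr_gt0.
have [C C0 hC] := ih _ c20.
exists (2 / c * C) => [|x x0]; first by rewrite !mulr_ge0// invr_ge0 ltW.
rewrite exprS.
have -> : c * x = c / 2 * x + c / 2 * x by field.
rewrite expRD mulrACA ler_pM ?exprn_ge0 ?hC//.
have h := expR_ge1Dx (c / 2 * x).
rewrite -ler_pdivrMl ?divr_gt0// invf_div (le_trans _ h)//.
by rewrite lerDr.
Qed.

Context {mum mup gm gp : R} {psi : R[i] -> R[i]}.
Hypothesis mum0 : mum <= 0.
Hypothesis mup0 : 0 <= mup.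
Hypothesis mu_lt : mum < mup.
Hypothesis gm0 : gm < 0.
Hypothesis gp0 : 0 < gp.
Let D := dom mum mup gm gp.
Hypothesis psi_cont : ccont_on (D `|` real_line) psi.
Hypothesis psi_growth : forall m1 m2 : R, slope gm gp m1 -> slope gm gp m2 ->
  exists2 C : R, 0 <= C & forall x m, 0 <= x -> m1 <= m <= m2 ->
    normc (psi (ray m x)) <= C * (1 + x ^+ 2).
Local Notation rintp := (@rint R psi).
Local Notation rayintp := (@rayint R psi).
Local Notation lapp := (@lap R psi).

(** The power is what [n] derivatives in [y] bring down from exp(- i y z). *)
Definition rintn n m y x : R := Re ((- ('i%C * ray m x)) ^+ n * rintp ('i%C * y%:C) m x).

Lemma sectorial_imag (m y : R) : slope gm gp m -> y * m < 0 ->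
  @sectorial R gm gp ('i%C * y%:C) m m (- (y * m)).
Proof. by move=> sm ym; split=> //; rewrite ?oppr_gt0// !ReImE/=; lra. Qed.

Lemma rintn_measurable n m y : slope gm gp m ->
  measurable_fun (`[0, +oo[%classic : set (measurableTypeR R)) (rintn n m y).
Proof.
move=> sm.
have h := @measurable_ray R mum mup gm gp mum0 mup0 mu_lt
  (fun z => (- ('i%C * z)) ^+ n * ((1 +i* m) * lapp ('i%C * y%:C) z)) m.
apply: (proj1 (h _ sm)) => z Sz; apply: ccvgM.
  elim: n {h} => [|n ih].
    by rewrite expr0; under [X in ccvg _ X]eq_fun do rewrite expr0; exact: ccvg_cst.
  rewrite exprS; under [X in ccvg _ X]eq_fun do rewrite exprS; apply: ccvgM ih.
  by apply: ccvgN; apply: ccvgM; [exact: ccvg_cst|exact: ccont_on_id Sz].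
apply: ccvgM; first exact: ccvg_cst.
exact: (ccont_on_lap _ psi_cont).
Qed.

(** On the half-line of slope [m], exp(- i v z) has modulus exp(v m x), so that the bound at [y]
    dominates every [v] with [v * m <= y * m]. Differentiation under the integral and the removal of
    the damping both need this uniformity. *)
Lemma rint_imag_decay m y : slope gm gp m -> y * m < 0 ->
  exists C c : R, [/\ 0 <= C, 0 < c & forall x v, 0 <= x -> v * m <= y * m ->
    normc (rintp ('i%C * v%:C) m x) <= C * expR (- (c * x))].
Proof.
move=> sm ym.
have [C C0 hC] := rint_decay psi_growth (sectorial_imag sm ym).
exists C, (- (y * m) / 2); split => // [|x v x0 vm]; first by rewrite divr_gt0 ?oppr_gt0.
have nE u : normc (rintp u m x) = normc (1 +i* m) * (expR (Re (- (u * ray m x))) * normc (psi (ray m x))).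
  by rewrite /rint /lap normcM normcM normc_cexp.
apply: le_trans (hC x m x0 _); last by rewrite lexx.
rewrite !nE ler_wpM2l ?normc_ge0// ler_wpM2r ?normc_ge0// ler_expR !ReImE/=.
by nra.
Qed.

Lemma rintn_decay n m y : slope gm gp m -> y * m < 0 ->
  exists C c : R, [/\ 0 <= C, 0 < c & forall x v, 0 <= x -> v * m <= y * m ->
    `|rintn n m v x| <= C * expR (- (c * x))].
Proof.
move=> sm ym.
have [C [c [C0 c0 hC]]] := rint_imag_decay sm ym.
have c20 : 0 < c / 2 by rewrite divr_gt0.
have [C' C'0 hC'] := powx_le_exp n c20.
exists (C * ((1 + `|m|) ^+ n * C')), (c / 2); split => // [|x v x0 vm].
  by rewrite !mulr_ge0 ?exprn_ge0 ?addr_ge0.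
rewrite (le_trans (normc_Re _))// normcM normcX.
have e1 : normc (- ('i%C * ray m x)) ^+ n <= ((1 + `|m|) * x) ^+ n.
  rewrite lerXn2r ?nnegrE ?normc_ge0 ?mulr_ge0 ?addr_ge0//.
  rewrite (le_trans (normc_leD _))// !ReImE/=.
  rewrite !(mul0r, mul1r, sub0r, add0r, opprK, normrN) normrM (ger0_norm x0).
  by rewrite mulrDl mul1r addrC [x * _]mulrC.
apply: (@le_trans _ _ (((1 + `|m|) ^+ n * (C' * expR (c / 2 * x))) * (C * expR (- (c * x))))).
  apply: ler_pM; rewrite ?exprn_ge0 ?normc_ge0 ?hC//.
  by rewrite (le_trans e1)// exprMn ler_wpM2l ?exprn_ge0 ?addr_ge0 ?hC'.
have -> : - (c / 2 * x) = c / 2 * x + - (c * x) by field.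
by rewrite expRD le_eqVlt; apply/orP; left; apply/eqP; ring.
Qed.

Lemma rintn_integrable n m y : slope gm gp m -> y * m < 0 ->
  leb.-integrable `[0, +oo[ (EFin \o rintn n m y).
Proof.
move=> sm ym; have [C [c [C0 c0 hC]]] := rintn_decay n sm ym.
apply: (@integrable_of_decay _ _ C c) => //; first exact: rintn_measurable.
by move=> x x0; exact: hC.
Qed.

Lemma is_derive_rintn n m (y x : R) : is_derive y 1 (fun v => rintn n m v x) (rintn n.+1 m y x).
Proof.
have h : cder (fun v => (- ('i%C * ray m x)) ^+ n * rintp ('i%C * v%:C) m x) y
   ((- ('i%C * ray m x)) ^+ n.+1 * rintp ('i%C * y%:C) m x).
  have e1 := cder_cexp (cderN (cderM (cderM (cder_cst 'i%C y) (cder_id y)) (cder_cst (ray m x) y))).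
  have e2 := cderM (cder_cst ((- ('i%C * ray m x)) ^+ n) y)
    (cderM (cder_cst (1 +i* m) y) (cderM e1 (cder_cst (psi (ray m x)) y))).
  apply: (cder_ext e2) => // .
  by rewrite /rint /lap exprS; ring.
by case: h.
Qed.

Definition rayintn n m y : R := Rintegral leb `[0, +oo[ (rintn n m y).

Lemma is_derive_rayintn n m (y : R) : slope gm gp m -> y * m < 0 ->
  is_derive y 1 (rayintn n m) (rayintn n.+1 m y).
Proof.
move=> sm ym.
(* The domination is taken at [y / 2], so as to hold on the whole neighbourhood ]a, b[ of [y], whose
   points are on the far side of [y / 2] from 0. *)
have ym2 : (y / 2) * m < 0 by rewrite mulrAC pmulr_llt0.
have [C [c [C0 c0 hC]]] := rintn_decay n.+1 sm ym2.
have y0 : y != 0 by apply: contraTneq ym => ->; rewrite mul0r ltxx.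
have m0I : measurable (`[0, +oo[%classic : set (measurableTypeR R)) by exact: measurable_itv.
pose a := y - `|y| / 2; pose b := y + `|y| / 2.
have ny : 0 < `|y| by rewrite normr_gt0.
have yI : `]a, b[%classic y by rewrite /= in_itv/= /a /b; apply/andP; split; lra.
have Iv v : `]a, b[%classic v -> v * m <= (y / 2) * m.
  rewrite /= in_itv/= /a /b => /andP[]; case: (ltrgt0P y) y0 => // ypos _ h1 h2.
    have mneg : m < 0 by rewrite -(pmulr_rlt0 _ ypos).
    by apply: ler_wnM2r; [exact: ltW|lra].
  have mpos : 0 < m by rewrite -(nmulr_rlt0 _ ypos).
  by apply: ler_wpM2r; [exact: ltW|lra].
have Ivneg v : `]a, b[%classic v -> v * m < 0.
  by move=> /Iv h; apply: le_lt_trans h _.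
have i0x v : `[0, +oo[%classic v -> 0 <= v :> R by rewrite /= in_itv/= andbT.
have pE v x : partial1of2 (rintn n m) v x = rintn n.+1 m v x.
  by rewrite partial1of2E; have h := is_derive_rintn n m v x; exact: derive_val.
have h4 v : `]a, b[%classic v -> leb.-integrable `[0, +oo[ (EFin \o rintn n m v).
  by move=> /Ivneg h; exact: rintn_integrable.
have h5 v x : `]a, b[%classic v -> `[0, +oo[%classic x -> derivable (rintn n m ^~ x) v 1.
  by move=> _ _; have h := is_derive_rintn n m v x; exact: ex_derive.
have h6 v x : `]a, b[%classic v -> `[0, +oo[%classic x -> `|partial1of2 (rintn n m) v x| <= C * expR (- (c * x)).
  by move=> /Iv h /i0x x0; rewrite pE; exact: hC.
have h7 : leb.-integrable `[0, +oo[ (EFin \o (fun x => C * expR (- (c * x)))).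
  exact: (integrableZl m0I C (expR_integrable c0)).
have h8 x : 0 <= C * expR (- (c * x)) by rewrite mulr_ge0// expR_ge0.
have := cvg_differentiation_under_integral m0I yI h4 h5 h8 h7 h6.
have -> : Rintegral leb `[0, +oo[ (partial1of2 (rintn n m) y) = rayintn n.+1 m y.
  by apply: eq_Rintegral => x _; exact: pE.
by move=> h; apply/is_derive_cvgP.
Qed.

Context {m0 : R}.
Hypothesis m00 : 0 < m0.
Hypothesis sm0 : slope gm gp m0.
Hypothesis smN0 : slope gm gp (- m0).

(* The slope of a half-line on which [exp (- i x z)] decays. *)
Definition side (x : R) : R := if 0 < x then - m0 else m0.

Lemma side_lt0 x : x != 0 -> x * side x < 0.
Proof.
by rewrite /side; case: ltrgt0P => // x0 _; [rewrite pmulr_rlt0 ?oppr_lt0|rewrite nmulr_rlt0].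
Qed.

Lemma side_slope x : slope gm gp (side x).
Proof. by rewrite /side; case: ifP. Qed.

(** Only the slopes [m0] and [- m0] occur: off 0 the half-line is locally constant in [x], so that
    the integral can be differentiated with a fixed slope. *)
Definition levy_density (x : R) : R :=
  if x == 0 then 0 else - pi^-1 * rayintn 0 (side x) x.

Lemma near_side (x : R) : x != 0 -> \forall u \near nbhs x, side u = side x /\ u != 0.
Proof.
rewrite /side; case: (ltgtP 0 x) => // x0 _.
  near=> u; have : 0 < u by near: u; exact: lt_nbhsr.
  by move=> u0; rewrite u0 gt_eqF.
near=> u; have u0 : u < 0 by near: u; exact: lt_nbhsl.
by rewrite ltNge (ltW u0) lt_eqF.
Unshelve. all: by end_near. Qed.

Lemma derive1n_levy_density n : forall x, x != 0 ->
  derive1n n levy_density x = - pi^-1 * rayintn n (side x) x.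
Proof.
elim: n => [x /negbTE x0|n ih x x0]; first by rewrite /= /levy_density x0.
have h1 := is_deriveM (is_derive_cst (- pi^-1 : R) x 1)
   (is_derive_rayintn n (side_slope x) (side_lt0 x0)).
have h2 : is_derive x 1 (derive1n n levy_density) (- pi^-1 * rayintn n.+1 (side x) x).
  have h3 : is_derive x 1 (fun u => - pi^-1 * rayintn n (side x) u) (- pi^-1 * rayintn n.+1 (side x) x).
    by apply: (is_derive_ext h1) => [u|] //; rewrite /GRing.scale/= mulr0 addr0.
  apply: (near_eq_is_derive _ h3).
  by apply: filterS (near_side x0) => u [su u0]; rewrite ih// su.
by rewrite derive1nS derive1E; have [_ ->] := h2.
Qed.

Lemma levy_density_smooth : smooth_off_0 levy_density.
Proof.
move=> n x x0.
have h1 := is_deriveM (is_derive_cst (- pi^-1 : R) x 1)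
   (is_derive_rayintn n (side_slope x) (side_lt0 x0)).
have [h2 _] := h1.
apply: (near_eq_derivable _ h2).
by apply: filterS (near_side x0) => u [su u0]; rewrite derive1n_levy_density// su.
Qed.

Lemma levy_densityE x : x != 0 -> levy_density x = - pi^-1 * Re (rayintp ('i%C * x%:C) (side x)).
Proof.
move=> /negbTE x0; rewrite /levy_density x0 /rayintn /rayint /cintegral/=; congr (_ * _).
by apply: eq_Rintegral => u _; rewrite /rintn expr0 mul1r.
Qed.

Lemma levy_density_continuous x : x != 0 -> {for x, continuous levy_density}.
Proof. by move=> x0; apply: differentiable_continuous; apply/derivable1_diffP; exact: (@levy_density_smooth 0%N). Qed.

End density.

(** * Fubini's theorem for dominated kernels *)

Section fubini_bounded.
Context d1 d2 (T1 : measurableType d1) (T2 : measurableType d2) (R : realType).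
Variables (m1 : {sigma_finite_measure set T1 -> \bar R}).
Variables (m2 : {sigma_finite_measure set T2 -> \bar R}).
Variables (D : set T2) (k : T1 -> T2 -> R) (A : T1 -> R) (B : T2 -> R).
Hypothesis mD : measurable D.
Hypothesis mk : measurable_fun setT (fun z => k z.1 z.2).
Hypothesis A0 : forall x, 0 <= A x.
Hypothesis B0 : forall y, D y -> 0 <= B y.
Hypothesis iA : m1.-integrable setT (EFin \o A).
Hypothesis iB : m2.-integrable D (EFin \o B).
Hypothesis kAB : forall x y, D y -> `|k x y| <= A x * B y.

(** Extension by zero, so that Fubini's theorem is applied on the whole product. *)
Let f (z : T1 * T2) : \bar R := (k z.1 z.2 * \1_D z.2)%:E.

Let mf : measurable_fun setT f.
Proof.
apply/measurable_EFinP; apply: measurable_funM => //.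
by apply: measurableT_comp => //; exact: measurable_indic.
Qed.

Let mkx x : measurable_fun setT (k x).
Proof. exact: (measurableT_comp mk (measurable_pair1 x)). Qed.

Let mky y : measurable_fun setT (k ^~ y).
Proof. exact: (measurableT_comp mk (measurable_pair2 y)). Qed.

Let ikx x : m2.-integrable D (EFin \o k x).
Proof.
apply: (le_integrable mD _ _ (integrableZl mD (A x) iB)).
  by apply/measurable_EFinP; exact: measurable_funTS.
move=> y Dy /=; rewrite lee_fin (le_trans (kAB x Dy))// -[leLHS]ger0_norm//.
by rewrite mulr_ge0// B0.
Qed.

Let iky y : D y -> m1.-integrable setT (EFin \o k ^~ y).
Proof.
move=> Dy; apply: (le_integrable measurableT _ _ (integrableZl measurableT (B y) iA)).
  by apply/measurable_EFinP; exact: mky.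
move=> x _ /=; rewrite lee_fin (le_trans (kAB x Dy))// mulrC -[leLHS]ger0_norm//.
by rewrite mulr_ge0// B0.
Qed.

Let FE x : (\int[m2]_y f (x, y) = (Rintegral m2 D (k x))%:E)%E.
Proof.
rewrite /Rintegral fineK; last exact: integrable_fin_num (ikx x).
rewrite [RHS]integral_mkcond epatch_indic.
by apply: eq_integral => y _; rewrite /f /= EFinM.
Qed.

Let GE y : (\int[m1]_x f (x, y) = (((fun y => Rintegral m1 setT (k ^~ y)) \_ D) y)%:E)%E.
Proof.
rewrite patchE; case: ifPn => [|yD]; rewrite ?inE.
  move=> Dy; rewrite /Rintegral fineK; last exact: integrable_fin_num (iky Dy).
  by apply: eq_integral => x _; rewrite /f /= indicE mem_set// mulr1.
apply: integral0_eq => x _; rewrite /f /= indicE (negbTE yD) mulr0//.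
Qed.

Let mB : measurable_fun D (fun y => `|B y|%:E).
Proof. by have /integrableP[] := integrable_abse iB. Qed.

Let imf : (m1 \x m2)%E.-integrable setT f.
Proof.
apply/integrable12ltyP => //.
have iBE : (\int[m2]_(y in D) `|B y|%:E < +oo)%E by case/integrableP : iB.
apply: (@le_lt_trans _ _ (\int[m1]_x ((A x)%:E * \int[m2]_(y in D) `|B y|%:E))%E).
  apply: ge0_le_integral => //.
  - by move=> x _; exact: integral_ge0.
  - exact: (@measurable_fun_fubini_tonelli_F _ _ _ _ _ m2 (abse \o f)
      (measurableT_comp (@abse_measurable _ _) mf) (fun=> abse_ge0 _)).
  - by apply: emeasurable_funM => //; case/integrableP : iA.
  move=> x _; rewrite -ge0_integralZl//=.
  - rewrite [leRHS]integral_mkcond; apply: ge0_le_integral => //.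
    + exact: (measurableT_comp (@abse_measurable _ _) (measurableT_comp mf (measurable_pair1 x))).
    + apply/(measurable_restrictT _ mD); exact: emeasurable_funM.
    move=> y _; rewrite patchE /f /= indicE; case: ifPn => [|_]; last by rewrite mulr0 normr0.
    by rewrite inE => Dy; rewrite mulr1 lee_fin (le_trans (kAB x Dy))// ler_wpM2l// ler_norm.
  - by rewrite lee_fin.
have fB : (\int[m2]_(y in D) `|B y|%:E)%E \is a fin_num.
  by rewrite ge0_fin_numE// integral_ge0.
rewrite -(fineK fB).
have -> : (\int[m1]_x ((A x)%:E * (fine (\int[m2]_(y in D) `|B y|%:E))%:E) =
   \int[m1]_x (`|(fine (\int[m2]_(y in D) `|B y|%:E))%:E * (A x)%:E|))%E.
  apply: eq_integral => x _; rewrite muleC gee0_abs// mule_ge0// lee_fin// fine_ge0//.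
  exact: integral_ge0.
by have /integrableP[_] := integrableZl measurableT (fine (\int[m2]_(y in D) `|B y|%:E)%E) iA.
Qed.

Lemma Rintegral_bounded_le x : `|Rintegral m2 D (k x)| <= A x * Rintegral m2 D B.
Proof.
rewrite (le_trans (le_normr_Rintegral mD (ikx x)))// -RintegralZl//.
apply: le_Rintegral => //; first exact: (integrable_norm (ikx x)).
  exact: (integrableZl mD (A x) iB).
by move=> y Dy; exact: kAB.
Qed.

Lemma integrable_Rintegral_bounded_swap :
  m2.-integrable D (EFin \o (fun y => Rintegral m1 setT (k ^~ y))).
Proof.
apply: (le_integrable mD _ _ (integrableZl mD (Rintegral m1 setT A) iB)).
  have := measurable_funTS (D := D) (measurable_fubini_G imf).
  by apply: eq_measurable_fun => y; rewrite inE => Dy; rewrite /fubini_G GE patchE mem_set.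
move=> y Dy /=; rewrite lee_fin (le_trans (le_normr_Rintegral measurableT (iky Dy)))//.
apply: le_trans (ler_norm _); rewrite mulrC -RintegralZl//.
apply: le_Rintegral => //; first exact: (integrable_norm (iky Dy)).
  exact: (integrableZl measurableT (B y) iA).
by move=> x _; rewrite mulrC; exact: kAB.
Qed.

Lemma Rintegral_swap : Rintegral m1 setT (fun x => Rintegral m2 D (k x)) =
  Rintegral m2 D (fun y => Rintegral m1 setT (k ^~ y)).
Proof.
rewrite /Rintegral; congr fine.
under eq_integral do rewrite -FE.
rewrite (Fubini imf) (integral_mkcond D); apply: eq_integral => y _.
by rewrite GE !patchE; case: ifP.
Qed.

End fubini_bounded.

(** * Laplace transforms *)

Section laplace_transforms.
Context {R : realType}.
Implicit Types z w : R[i].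
Notation leb := (@lebesgue_measure R).

Lemma cintegral_primitive (G k : R -> R[i]) (C c : R) : 0 < c ->
  (forall t : R, cder G t (k t)) -> (forall t : R, ccvg (nbhs t) k (k t)) ->
  (forall t, 0 <= t -> normc (k t) <= C * expR (- (c * t))) ->
  (forall t, 0 <= t -> normc (G t) <= C * expR (- (c * t))) ->
  cintegrable leb `[0, +oo[ k /\ cintegral leb `[0, +oo[ k = - G 0.
Proof.
move=> c0 Gk kc kC GC.
have mRe : measurable_fun (`[0, +oo[%classic : set (measurableTypeR R)) (fun x => Re (k x)).
  by apply: measurable_funTS; apply: continuous_measurable_fun => t; case: (kc t).
have mIm : measurable_fun (`[0, +oo[%classic : set (measurableTypeR R)) (fun x => Im (k x)).
  by apply: measurable_funTS; apply: continuous_measurable_fun => t; case: (kc t).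
have ik : cintegrable leb `[0, +oo[ k.
  split; apply: (@integrable_of_decay _ _ C c) => // x x0.
    by rewrite (le_trans (normc_Re _)) ?kC.
  by rewrite (le_trans (normc_Im _)) ?kC.
split=> //; have [i1 i2] := ik.
pose S n := `[0, n%:R]%classic : set (measurableTypeR R).
have Sle n n' : (n <= n')%N -> S n `<=` S n'.
  move=> nn' x; rewrite /S /= !in_itv/= => /andP[-> xu]; apply: le_trans xu _.
  by rewrite ler_nat.
have SU : \bigcup_n S n = `[0, +oo[%classic :> set R.
  apply/seteqP; split => x /=.
    by move=> [n _]; rewrite /S /= !in_itv/= => /andP[->].
  rewrite in_itv/= andbT => x0; exists (Num.bound x) => //.
  by rewrite /S /= in_itv/= x0 ltW// archi_boundP.
have mS n : measurable (S n) by exact: measurable_itv.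
have c1 : ccvg \oo (fun n => cint 0 n%:R k) (cintegral leb `[0, +oo[ k).
  split; rewrite /cint /cintegral /= -SU.
    by apply: exhaustion_cvg => //; rewrite SU.
  by apply: exhaustion_cvg => //; rewrite SU.
have c2 : ccvg \oo (fun n => cint 0 n%:R k) (- G 0).
  apply/ccvg_normcP => e e0.
  have lim0 : C * expR (- (c * n%:R)) @[n --> \oo] --> 0.
    rewrite -[X in _ --> X](mulr0 C); apply: cvgM; first exact: cvg_cst.
    have cn : (fun n => c * n%:R) @ \oo --> +oo.
      have cid : (fun x : R => c * x) @ +oo --> +oo by apply: gt0_cvgMry => //; exact: cvg_id.
      exact: (cvg_comp _ _ (@cvgr_idn R) cid).
    exact: (cvg_comp _ _ cn (@cvgr_expR R)).
  have /cvgrPdist_lt/(_ _ e0) := lim0.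
  have n1 : \forall n \near \oo, (0 < n)%N by exists 1%N.
  apply: filterS2 n1 => n n0; rewrite sub0r normrN => h.
  rewrite (@cfundamental _ 0 n%:R G k).
  - rewrite opprK subrK (le_lt_trans (GC _ _))//.
    by apply: le_lt_trans h; exact: ler_norm.
  - by rewrite ltr0n.
  - by apply: ccont_itv_cts => t; exact: cder_ccvg (Gk t).
  - by apply: ccont_itv_cts.
  - by move=> t _; exact: Gk.
exact: ccvg_unique c1 c2.
Qed.

Definition damped s a b c (t : R) : R[i] := cexp (- (s * t%:C)) * (a + b * t%:C + c * t%:C ^+ 2).

Lemma damped_decay s a b c : 0 < Re s -> exists2 C : R, 0 <= C &
  forall t, 0 <= t -> normc (damped s a b c t) <= C * expR (- (Re s / 2 * t)).
Proof.
move=> s0; have [C C0 hC] := poly_le_exp s0.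
pose M := normc a + normc b + normc c.
have M0 : 0 <= M by rewrite !addr_ge0 ?normc_ge0.
exists (M * C) => [|t t0]; first exact: mulr_ge0.
rewrite /damped normcM normc_cexp.
have -> : Re (- (s * t%:C)) = - (Re s * t) by rewrite !ReImE/=; ring.
have q1 : normc (a + b * t%:C + c * t%:C ^+ 2) <= M * (1 + t ^+ 2).
  rewrite (le_trans (normc_triangle _ _))//.
  apply: (@le_trans _ _ (normc a + normc b * t + normc c * t ^+ 2)).
    rewrite lerD//; last by rewrite normcM normcX normc_real (ger0_norm t0).
    by rewrite (le_trans (normc_triangle _ _))// normcM normc_real (ger0_norm t0).
  have := normc_ge0 a; have := normc_ge0 b; have := normc_ge0 c; rewrite /M.
  set A := normc a; set B := normc b; set E := normc c => E0 B0 A0.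
  have : 0 <= (t - 1) ^+ 2 by exact: sqr_ge0.
  by have t2 : 0 <= t ^+ 2 by [exact: sqr_ge0]; nra.
have h := ler_wpM2l M0 (hC t t0).
apply: (le_trans (ler_wpM2l (expR_ge0 _) q1)).
by rewrite mulrCA [expR _ * _]mulrC (le_trans h)// mulrA.
Qed.

Lemma damped_cder s a b c (t : R) :
  cder (damped s a b c) t (damped s (b - s * a) (c *+ 2 - s * b) (- s * c) t).
Proof.
have e0 := cder_id t.
have e1 := cder_cexp (cderN (cderM (cder_cst s t) e0)).
have e2 := cderD (cderD (cder_cst a t) (cderM (cder_cst b t) e0)) (cderM (cder_cst c t) (cderM e0 e0)).
apply: (cder_ext (cderM e1 e2)) => [u|]; first by rewrite /damped expr2.
by rewrite /damped mulr2n; ring.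
Qed.

Lemma laplace_quadratic s a b c : 0 < Re s ->
  cintegrable leb `[0, +oo[ (damped s a b c) /\
  cintegral leb `[0, +oo[ (damped s a b c) = a / s + b / s ^+ 2 + c *+ 2 / s ^+ 3.
Proof.
move=> s0.
have sn0 : s != 0 by apply: contraTneq s0 => ->; rewrite ltxx.
(* A primitive is sought in the same family: by [damped_cder] its coefficients solve
   [b' - s a' = a], [2 c' - s b' = b] and [- s c' = c]. *)
pose a' := - (a / s + b / s ^+ 2 + c *+ 2 / s ^+ 3).
pose b' := - (b / s + c *+ 2 / s ^+ 2).
pose c' := - (c / s).
have [C C0 hC] := damped_decay a b c s0.
have [C' C'0 hC'] := damped_decay a' b' c' s0.
have [] := @cintegral_primitive (damped s a' b' c') (damped s a b c) (C + C') (Re s / 2).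
- by rewrite divr_gt0.
- move=> t; apply: (cder_ext (damped_cder s a' b' c' t)) => //.
  by congr (damped s _ _ _ t); rewrite /a' /b' /c'; field.
- by move=> t; exact: cder_ccvg (damped_cder s a b c t).
- by move=> t t0; rewrite (le_trans (hC _ t0))// ler_wpM2r ?expR_ge0 ?lerDl.
- by move=> t t0; rewrite (le_trans (hC' _ t0))// ler_wpM2r ?expR_ge0 ?lerDr.
move=> h1 h2; split => //; rewrite h2 /damped.
have -> : cexp (- (s * 0%:C)) = 1 :> R[i].
  by apply: eqC; rewrite ?(Re_cexp, Im_cexp) !ReImE/= !mulr0 subrr addr0 oppr0 expR0 ?cos0 ?sin0 ?mul1r.
rewrite (_ : 0%:C = 0 :> R[i])// mul1r expr2 !mulr0 !addr0 /a' opprK//.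
Qed.

End laplace_transforms.

(** * The Levy-Khintchine integrand *)

Lemma sigma_finite_pack d (T : measurableType d) (R : realType) (mu : {measure set T -> \bar R}) :
  sigma_finite setT mu ->
  exists mu' : {sigma_finite_measure set T -> \bar R}, (mu' : {measure set T -> \bar R}) = mu.
Proof.
move=> sf.
pose H1 := isSigmaFinite.Build _ _ _ (Measure.sort mu) sf.
pose H2 := isSFinite.Build _ _ _ (Measure.sort mu) (sfinite_measure_sigma_finite sf).
pose mu' := HB.pack_for (SigmaFiniteMeasure.type T R) (Measure.sort mu) H2 H1.
by exists mu'; exact: eq_measure.
Qed.

Section levy_khintchine.
Context {R : realType}.
Implicit Types z w : R[i].
Notation leb := (@lebesgue_measure R).

Lemma mvt_bound (f df : R -> R) (a b M : R) :
  (forall t, `|t - a| <= `|b - a| -> is_derive t 1 f (df t)) ->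
  (forall t, `|t - a| <= `|b - a| -> `|df t| <= M) ->
  `|f b - f a| <= M * `|b - a|.
Proof.
move=> fd dM.
have cont t : `|t - a| <= `|b - a| -> {for t, continuous f}.
  by move=> /fd[/derivable1_diffP h _]; exact: differentiable_continuous.
have [ab|ba|->] := ltgtP a b; last by rewrite !subrr normr0 mulr0.
  have nab t : t \in `[a, b] -> `|t - a| <= `|b - a|.
    by rewrite in_itv/= => /andP[h1 h2]; rewrite !ger0_norm ?subr_ge0 ?(ltW ab)// lerD2r.
  have [|t tI ->] := @MVT _ f df a b ab (fun t tI => fd t (nab t (subset_itv_oo_cc tI))).
    by apply: continuous_in_subspaceT => t; rewrite inE => /nab; exact: cont.
  by rewrite normrM ler_wpM2r// dM// nab// subset_itv_oo_cc.
have nab t : t \in `[b, a] -> `|t - a| <= `|b - a|.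
  rewrite in_itv/= => /andP[h1 h2]; rewrite !ler0_norm ?subr_le0 ?(ltW ba)//.
  by rewrite lerN2 lerD2r.
have [|t tI h] := @MVT _ f df b a ba (fun t tI => fd t (nab t (subset_itv_oo_cc tI))).
  by apply: continuous_in_subspaceT => t; rewrite inE => /nab; exact: cont.
rewrite distrC h (distrC b) normrM ler_wpM2r// dM// nab// subset_itv_oo_cc//.
Qed.

(** Two mean value estimates, the second one for [t |-> f t - df a * t]; hence [M] instead of the
    sharp [M / 2]. *)
Lemma taylor1_bound (f df ddf : R -> R) (a b M : R) : 0 <= M ->
  (forall t, `|t - a| <= `|b - a| -> is_derive t 1 f (df t)) ->
  (forall t, `|t - a| <= `|b - a| -> is_derive t 1 df (ddf t)) ->
  (forall t, `|t - a| <= `|b - a| -> `|ddf t| <= M) ->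
  `|f b - f a - df a * (b - a)| <= M * (b - a) ^+ 2.
Proof.
move=> M0 fd dfd ddM.
have h := @mvt_bound (fun t => f t - df a * t) (fun t => df t - df a) a b (M * `|b - a|).
have -> : f b - f a - df a * (b - a) = (f b - df a * b) - (f a - df a * a) by ring.
apply: (le_trans (h _ _)).
- move=> t ta; have e1 := fd t ta.
  have e2 := is_deriveB e1 (is_deriveM (is_derive_cst (df a) t 1) (is_derive_id t 1)).
  by apply: (is_derive_ext e2) => [u|] //; rewrite /GRing.scale/= mulr0 addr0 mulr1.
- move=> t ta; apply: (le_trans (@mvt_bound df ddf a t M _ _)).
  + by move=> u ua; exact: dfd (le_trans ua ta).
  + by move=> u ua; exact: ddM (le_trans ua ta).
  + by rewrite ler_wpM2l.
- by rewrite -mulrA -normrM -expr2 ger0_norm// sqr_ge0.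
Qed.

Lemma one_sub_cos_le (u : R) : `|1 - cos u| <= u ^+ 2.
Proof.
have h := @taylor1_bound cos (fun t => - sin t) (fun t => - cos t) 0 u 1 ler01.
rewrite distrC -[leRHS]mul1r.
have -> : cos u - 1 = cos u - cos 0 - (- sin 0) * (u - 0) by rewrite cos0 sin0 oppr0 mul0r subr0.
move: (h (fun t _ => is_derive_cos t) (fun t _ => is_deriveN (is_derive_sin t))).
rewrite !subr0; apply=> t _.
by rewrite normrN ler_norml cos_geN1 cos_le1.
Qed.

Lemma sub_sin_le (u : R) : `|u - sin u| <= u ^+ 2.
Proof.
have h := @taylor1_bound sin cos (fun t => - sin t) 0 u 1 ler01.
rewrite distrC -[leRHS]mul1r.
have -> : sin u - u = sin u - sin 0 - cos 0 * (u - 0) by rewrite cos0 sin0 mul1r !subr0.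
move: (h (fun t _ => is_derive_sin t) (fun t _ => is_derive_cos t)).
rewrite !subr0; apply=> t _.
by rewrite normrN ler_norml sin_geN1 sin_le1.
Qed.

Definition small_jump (x : R) : R := if x \in `](-1), 1[ then x else 0.

Definition jump_weight (x : R) : R := Num.min 1 (x ^+ 2).

Lemma small_jump_cases x : (small_jump x = x /\ jump_weight x = x ^+ 2) \/
  (small_jump x = 0 /\ jump_weight x = 1).
Proof.
rewrite /small_jump /jump_weight in_itv/=; case: ifPn => [/andP[h1 h2]|h]; [left|right]; split=> //.
  by apply/min_idPr; nra.
apply/min_idPl; rewrite leNgt; apply: contra h => h.
by apply/andP; split; nra.
Qed.

Lemma jump_weight_ge0 x : 0 <= jump_weight x.
Proof. by rewrite /jump_weight le_min ler01 sqr_ge0. Qed.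

Lemma integrand_Re (t x : R) : Re (levy_khintchine_integrand t x) = 1 - cos (x * t).
Proof.
rewrite /levy_khintchine_integrand ReD ReD ReN Re_cexp !ReImE/= !(mul0r, mul1r, mulr0, subr0, sub0r, oppr0, addr0).
rewrite expR0 mul1r add0r; case: ifP => _; last by rewrite addr0.
by rewrite ReM/= !mul0r mulr0 subrr addr0.
Qed.

Lemma integrand_Im (t x : R) : Im (levy_khintchine_integrand t x) = small_jump x * t - sin (x * t).
Proof.
rewrite /levy_khintchine_integrand ImD ImD ImN Im_cexp !ReImE/=.
rewrite !(mul0r, mul1r, mulr0, subr0, sub0r, oppr0, addr0, add0r).
rewrite expR0 mul1r addrC /small_jump; case: ifP => _; last by rewrite mul0r.
by rewrite ImM/= mul0r mul1r add0r.
Qed.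

(** For [|x| < 1] each component is a Taylor remainder, at most [(x t)^2]; for other [x] the
    components are at most 2 and 1, whence the 3. The variables are separated, as the dominated form
    of Fubini's theorem requires. *)
Lemma integrand_bound (t x : R) :
  normc (levy_khintchine_integrand t x) <= jump_weight x * (3 * (1 + t ^+ 2)).
Proof.
rewrite (le_trans (normc_leD _))// integrand_Re integrand_Im.
case: (small_jump_cases x) => -[-> ->].
  rewrite (le_trans (lerD (one_sub_cos_le _) (sub_sin_le _)))// exprMn -mulrDr.
  by rewrite ler_wpM2l ?sqr_ge0//; have : 0 <= t ^+ 2 by [exact: sqr_ge0]; lra.
rewrite mul0r sub0r normrN mul1r.
have : `|1 - cos (x * t)| <= 2.
  by rewrite ler_norml; have := cos_geN1 (x * t); have := cos_le1 (x * t); lra.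
have : `|sin (x * t)| <= 1 by rewrite ler_norml sin_geN1 sin_le1.
by have : 0 <= t ^+ 2 by [exact: sqr_ge0]; lra.
Qed.

Lemma integrand_at0 (t : R) : levy_khintchine_integrand t 0 = 0.
Proof.
apply: eqC; rewrite ?integrand_Re ?integrand_Im mul0r ?cos0 ?subrr// sin0 subr0.
by rewrite /small_jump; case: ifP; rewrite mul0r.
Qed.

Lemma measurable_small_jump : measurable_fun setT small_jump.
Proof.
apply: measurable_fun_ifT => //.
have -> : (fun x : R => x \in `](-1), 1[) = (fun x => (-1 < x) && (x < 1)).
  by apply/funext => x; rewrite in_itv.
by apply: measurable_and; apply: measurable_fun_ltr.
Qed.

Lemma measurable_jump_weight : measurable_fun setT jump_weight.
Proof. by apply: measurable_minr => //; exact: measurable_funX. Qed.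

Section finite_weight.
Variable F : {measure set (measurableTypeR R) -> \bar R}.
Hypothesis F0 : F [set 0] = 0%E.
Hypothesis Fw : (\int[F]_(x in [set~ 0%R]) (jump_weight x)%:E < +oo)%E.

Lemma integral_off0 (h : R -> \bar R) : h 0 = 0%E ->
  (\int[F]_(x in [set~ 0%R]) h x = \int[F]_x h x)%E.
Proof.
move=> h0; rewrite integral_mkcond; apply: eq_integral => x _; rewrite patchE.
case: ifPn => //; rewrite notin_setE /= => /contrapT ->; exact/esym.
Qed.

Let Fw' : (\int[F]_x (jump_weight x)%:E < +oo)%E.
Proof.
rewrite -integral_off0//; congr EFin.
by rewrite /jump_weight expr0n/=; apply/min_idPr.
Qed.

Lemma jump_weight_integrable : F.-integrable setT (EFin \o jump_weight).
Proof.
apply/integrableP; split; first by apply/measurable_EFinP; exact: measurable_jump_weight.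
by under eq_integral do rewrite /= ger0_norm ?jump_weight_ge0//.
Qed.

(** The sets where [jump_weight] is at least [1 / (n + 1)] have finite measure by Markov's
    inequality and exhaust the complement of 0, which [F] does not charge. Fubini's theorem needs
    this structure on [F]. *)
Lemma levy_sigma_finite : exists F' : {sigma_finite_measure set (measurableTypeR R) -> \bar R},
  (F' : {measure set (measurableTypeR R) -> \bar R}) = F.
Proof.
pose S (n : nat) : set (measurableTypeR R) := [set x | n.+1%:R^-1 <= jump_weight x] `|` [set 0].
have mS1 (n : nat) : measurable ([set x | n.+1%:R^-1 <= jump_weight x] : set (measurableTypeR R)).
  rewrite -[X in measurable X]setTI.
  exact: (measurable_fun_le measurableT (measurable_cst _) measurable_jump_weight).
suff sf : sigma_finite setT F by exact: sigma_finite_pack sf.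
exists S.
  apply/esym; rewrite -subTset => x _.
  have [->|x0] := eqVneq x 0; first by exists 0%N => //; right.
  have w0 : 0 < jump_weight x by rewrite /jump_weight lt_min ltr01 exprn_even_gt0.
  exists (Num.bound (jump_weight x)^-1) => //; left => /=.
  rewrite invf_ple ?posrE ?ltr0n//.
  have h : (jump_weight x)^-1 < (Num.bound (jump_weight x)^-1)%:R.
    by apply: archi_boundP; rewrite invr_ge0 ltW.
  by rewrite (le_trans (ltW h))// ler_nat.
move=> n; split; first by apply: measurableU => //; exact: measurable_set1.
apply: (@le_lt_trans _ _ (F [set x | (n.+1%:R^-1 <= jump_weight x)%R] + F [set 0%R])%E).
  by apply: measureU2 => //; exact: measurable_set1.
rewrite [X in (_ + X)%E](_ : _ = 0%E); last exact: F0.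
rewrite adde0.
have h : ((n.+1%:R^-1)%:E * F [set x | (n.+1%:R^-1 <= jump_weight x)%R] <= \int[F]_x (jump_weight x)%:E)%E.
  rewrite -integral_cst//.
  apply: (@le_trans _ _ (\int[F]_(x in [set x | (n.+1%:R^-1 <= jump_weight x)%R]) (jump_weight x)%:E)%E).
    apply: ge0_le_integral => //.
    - by move=> x _; rewrite lee_fin invr_ge0.
    - by apply/measurable_EFinP; apply: measurable_funTS; exact: measurable_jump_weight.
  apply: ge0_subset_integral => //.
  - by apply/measurable_EFinP; exact: measurable_jump_weight.
  - by move=> x _; rewrite lee_fin jump_weight_ge0.
have := le_lt_trans h Fw'.
case: (F _) => [r _||]; rewrite ?ltry// ?ltNyr//.
by rewrite gt0_muley ?ltxx// lte_fin invr_gt0.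
Qed.

End finite_weight.
End levy_khintchine.

(** * Cauchy kernels *)

Section cauchy_kernels.
Context {R : realType}.
Implicit Types z w : R[i].
Notation leb := (@lebesgue_measure R).

(** The density of the Cauchy law of scale [e], times [pi]; also the real part of
    [1 / (e + i y)]. *)
Definition cauchy (e y : R) : R := e / (e ^+ 2 + y ^+ 2).

(** Minus the derivative of [cauchy e]. *)
Definition dcauchy (e y : R) : R := 2 * e * y / (e ^+ 2 + y ^+ 2) ^+ 2.

(* [Re (1 / s - 1 / (s - i x) + i (small_jump x) / s ^ 2)] with [s = e + i y], the
   Laplace transform at [s] of the integrand of the Levy-Khintchine formula. *)
Definition levy_kernel (e y x : R) : R :=
  cauchy e y - cauchy e (y - x) + small_jump x * dcauchy e y.

(** A primitive of [levy_kernel] in [y]. Its increment from p to q is [- pi] times the K_e of the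
    overview, whose linear term is present for [|x| < 1] only. *)
Definition levy_primitive (e y x : R) : R :=
  atan (y / e) - atan ((y - x) / e) - small_jump x * cauchy e y.

Definition damped_integrand s (x t : R) : R :=
  Re (cexp (- (s * t%:C)) * levy_khintchine_integrand t x).

Lemma denom_gt0 (e y : R) : 0 < e -> 0 < e ^+ 2 + y ^+ 2.
Proof. by move=> e0; rewrite ltr_wpDr ?sqr_ge0// exprn_gt0. Qed.

Lemma Re_invc (e y : R) : Re (1 / (e +i* y)) = cauchy e y.
Proof. by rewrite mul1r /cauchy. Qed.

Lemma invcE (e y : R) : (e +i* y)^-1 = cauchy e y +i* - (y / (e ^+ 2 + y ^+ 2)).
Proof. by apply: eqC. Qed.

Lemma Re_invc2 (e y b : R) : 0 < e -> Re ('i%C * b%:C / (e +i* y) ^+ 2) = b * dcauchy e y.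
Proof.
move=> e0; rewrite -exprVn invcE expr2 !ReImE/= /dcauchy /cauchy.
by field; rewrite gt_eqF// denom_gt0.
Qed.

Lemma damped_integrand_real (e y x t : R) : damped_integrand (e +i* y) x t =
  expR (- (e * t)) * (cos (y * t) - cos ((y - x) * t) + small_jump x * t * sin (y * t)).
Proof.
rewrite /damped_integrand ReM Re_cexp Im_cexp integrand_Re integrand_Im.
have -> : Re (- ((e +i* y) * t%:C)) = - (e * t) by rewrite !ReImE/=; ring.
have -> : Im (- ((e +i* y) * t%:C)) = - (y * t) by rewrite !ReImE/=; ring.
rewrite cosN sinN (mulrBl t y x) cosB; ring.
Qed.

(** The oscillating factor moves the parameter to [s - i x], so that two instances of
    [laplace_quadratic] give the transform. *)
Lemma damped_integrandE s (x t : R) : damped_integrand s x t =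
  Re (damped s 1 ('i%C * (small_jump x)%:C) 0 t) - Re (damped (s - 'i%C * x%:C) 1 0 0 t).
Proof.
rewrite -ReN -ReD /damped_integrand /damped; congr (Re _).
have -> : cexp (- ((s - 'i%C * x%:C) * t%:C)) = cexp (- (s * t%:C)) * cexp ('i%C * (x * t)%:C).
  by rewrite -cexpD; congr cexp; rewrite rmorphM/=; ring.
have -> : levy_khintchine_integrand t x =
    1 - cexp ('i%C * (x * t)%:C) + 'i%C * (small_jump x)%:C * t%:C.
  rewrite /levy_khintchine_integrand /small_jump; congr (_ + _).
  by case: ifP => _; rewrite ?mulr0 ?mul0r// rmorphM/= mulrA.
by ring.
Qed.

Lemma damped_integral (e y x : R) : 0 < e ->
  Rintegral leb `[0, +oo[ (damped_integrand (e +i* y) x) = levy_kernel e y x.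
Proof.
move=> e0.
have [[i1 _] h1] := @laplace_quadratic R (e +i* y) 1 ('i%C * (small_jump x)%:C) 0 e0.
have r2 : 0 < Re (e +i* y - 'i%C * x%:C) by rewrite !ReImE/= !mul0r mulr0 subrr oppr0 addr0.
have [[i2 _] h2] := @laplace_quadratic R (e +i* y - 'i%C * x%:C) 1 0 0 r2.
have -> : Rintegral leb `[0, +oo[ (damped_integrand (e +i* y) x) =
   Rintegral leb `[0, +oo[ (fun t => Re (damped (e +i* y) 1 ('i%C * (small_jump x)%:C) 0 t)
     - Re (damped (e +i* y - 'i%C * x%:C) 1 0 0 t)).
  by apply: eq_Rintegral => t _; exact: damped_integrandE.
rewrite RintegralB//.
have -> : Rintegral leb `[0, +oo[ (fun t => Re (damped (e +i* y) 1 ('i%C * (small_jump x)%:C) 0 t)) =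
   cauchy e y + small_jump x * dcauchy e y.
  rewrite -[LHS]/(Re (cintegral leb `[0, +oo[ (damped (e +i* y) 1 ('i%C * (small_jump x)%:C) 0))) h1.
  by rewrite mul0rn mul0r addr0 ReD Re_invc Re_invc2.
have -> : Rintegral leb `[0, +oo[ (fun t => Re (damped (e +i* y - 'i%C * x%:C) 1 0 0 t)) = cauchy e (y - x).
  rewrite -[LHS]/(Re (cintegral leb `[0, +oo[ (damped (e +i* y - 'i%C * x%:C) 1 0 0))) h2.
  rewrite mul0rn !mul0r !addr0.
  have -> : e +i* y - 'i%C * x%:C = e +i* (y - x).
    by apply: eqC; rewrite !ReImE/=; ring.
  exact: Re_invc.
by rewrite /levy_kernel; ring.
Qed.

Lemma continuous_cauchy (e : R) : 0 < e -> continuous (cauchy e).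
Proof.
move=> e0 y; apply: cvgM; first exact: cvg_cst.
apply: cvgV; first by rewrite gt_eqF// denom_gt0.
by apply: cvgD; [exact: cvg_cst|exact: exprn_continuous].
Qed.

Lemma continuous_dcauchy (e : R) : 0 < e -> continuous (dcauchy e).
Proof.
move=> e0 y; apply: cvgM.
  by apply: cvgM; [exact: cvg_cst|exact: cvg_id].
apply: cvgV; first by rewrite expf_neq0// gt_eqF// denom_gt0.
apply: (cvg_comp (fun y => e ^+ 2 + y ^+ 2) (fun u => u ^+ 2)); last exact: exprn_continuous.
by apply: cvgD; [exact: cvg_cst|exact: exprn_continuous].
Qed.

Lemma measurable_levy_kernel (e : R) : 0 < e ->
  measurable_fun setT (fun z : measurableTypeR R * measurableTypeR R => levy_kernel e z.2 z.1).
Proof.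
move=> e0; apply: measurable_funD.
  apply: measurable_funB; apply: measurableT_comp => //; try exact: (continuous_measurable_fun (continuous_cauchy e0)).
  exact: measurable_funB.
apply: measurable_funM; first by apply: measurableT_comp => //; exact: measurable_small_jump.
by apply: measurableT_comp => //; exact: (continuous_measurable_fun (continuous_dcauchy e0)).
Qed.

Lemma measurable_damped_integrand (e y : R) :
  measurable_fun setT (fun z : measurableTypeR R * measurableTypeR R =>
    damped_integrand (e +i* y) z.1 z.2).
Proof.
under eq_fun do rewrite damped_integrand_real.
apply: measurable_funM.
  apply: measurableT_comp; first exact: measurable_expR.
  by apply: measurableT_comp => //; exact: measurable_funM.
apply: measurable_funD.
  apply: measurable_funB;
    (apply: measurableT_comp; first exact: (continuous_measurable_fun (@continuous_cos R)));
    apply: measurable_funM => //.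
  exact: measurable_funB.
apply: measurable_funM.
  apply: measurable_funM => //.
  by apply: measurableT_comp => //; exact: measurable_small_jump.
apply: measurableT_comp; first exact: (continuous_measurable_fun (@continuous_sin R)).
exact: measurable_funM.
Qed.

Definition damped_weight (e t : R) : R := 3 * (1 + t ^+ 2) * expR (- (e * t)).

Lemma damped_weight_integrable (e : R) : 0 < e -> leb.-integrable `[0, +oo[ (EFin \o damped_weight e).
Proof.
move=> e0; have [C C0 hC] := poly_le_exp e0.
apply: (@integrable_of_decay _ _ (3 * C) (e / 2)); first by rewrite divr_gt0.
  apply: measurable_funTS; apply: measurable_funM.
    by apply: measurable_funM => //; apply: measurable_funD => //; exact: measurable_funX.
  apply: measurableT_comp; first exact: measurable_expR.
  by apply: measurableT_comp => //; exact: measurable_funM.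
move=> t t0; rewrite ger0_norm; last by rewrite !mulr_ge0 ?expR_ge0// addr_ge0 ?sqr_ge0.
by rewrite /damped_weight -2!mulrA ler_wpM2l// hC.
Qed.

Lemma damped_integrand_le (e y x t : R) :
  `|damped_integrand (e +i* y) x t| <= jump_weight x * damped_weight e t.
Proof.
rewrite (le_trans (normc_Re _))// normcM normc_cexp.
have -> : Re (- ((e +i* y) * t%:C)) = - (e * t) by rewrite !ReImE/=; ring.
rewrite mulrC /damped_weight mulrA ler_wpM2r ?expR_ge0//.
exact: integrand_bound.
Qed.

Section levy_fubini.
Variable F : {sigma_finite_measure set (measurableTypeR R) -> \bar R}.
Hypothesis iw : F.-integrable setT (EFin \o (@jump_weight R)).
Variables e p q : R.
Hypothesis e0 : 0 < e.
Hypothesis pq : p <= q.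

Let m0I : measurable (`[0, +oo[%classic : set (measurableTypeR R)). Proof. exact: measurable_itv. Qed.
Let mpq : measurable (`[p, q]%classic : set (measurableTypeR R)). Proof. exact: measurable_itv. Qed.

Let w0 t : 0 <= damped_weight e t.
Proof. by rewrite !mulr_ge0 ?expR_ge0// addr_ge0 ?sqr_ge0. Qed.

Lemma levy_kernel_le y x :
  `|levy_kernel e y x| <= jump_weight x * Rintegral leb `[0, +oo[ (damped_weight e).
Proof.
rewrite -damped_integral//.
exact: (Rintegral_bounded_le m0I (measurable_damped_integrand e y)
  (@jump_weight_ge0 R) (fun t _ => w0 t) (damped_weight_integrable e0) (fun x t _ => damped_integrand_le e y x t)).
Qed.

Lemma damped_integrand_integrable y :
  leb.-integrable `[0, +oo[ (EFin \o (fun t => Rintegral F setT (fun x => damped_integrand (e +i* y) x t))).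
Proof.
exact: (integrable_Rintegral_bounded_swap m0I (measurable_damped_integrand e y)
  (@jump_weight_ge0 R) (fun t _ => w0 t) iw (damped_weight_integrable e0) (fun x t _ => damped_integrand_le e y x t)).
Qed.

Lemma damped_integrand_swap y :
  Rintegral leb `[0, +oo[ (fun t => Rintegral F setT (fun x => damped_integrand (e +i* y) x t)) =
  Rintegral F setT (levy_kernel e y).
Proof.
rewrite -(Rintegral_swap m0I (measurable_damped_integrand e y)
  (@jump_weight_ge0 R) (fun t _ => w0 t) iw (damped_weight_integrable e0) (fun x t _ => damped_integrand_le e y x t)).
by apply: eq_Rintegral => x _; exact: damped_integral.
Qed.

Let M0 (y : R) : `[p, q]%classic y -> 0 <= Rintegral leb `[0, +oo[ (damped_weight e).
Proof. by move=> _; apply: Rintegral_ge0 => t _; exact: w0. Qed.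

Lemma levy_kernel_integrable :
  leb.-integrable `[p, q] (EFin \o (fun y => Rintegral F setT (levy_kernel e y))).
Proof.
exact: (integrable_Rintegral_bounded_swap mpq (measurable_levy_kernel e0)
  (@jump_weight_ge0 R) M0 iw (leb_integrable_cst p q _) (fun x y _ => levy_kernel_le y x)).
Qed.

Lemma is_derive_cauchy (t : R) : is_derive t 1 (cauchy e) (- dcauchy e t).
Proof.
have h1 : is_derive t 1 (fun y : R => e ^+ 2 + y ^+ 2) (2 * t).
  have := is_deriveD (is_derive_cst (e ^+ 2) t 1) (is_deriveM (is_derive_id t 1) (is_derive_id t 1)).
  move/is_derive_ext; apply => [u /=|]; first by rewrite [in RHS]expr2.
  by rewrite /GRing.scale/= mulr1; ring.
have h2 := @is_deriveV _ (fun y : R => e ^+ 2 + y ^+ 2) t _ _ (lt0r_neq0 (denom_gt0 t e0)) h1.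
have := is_deriveM (is_derive_cst e t 1) h2.
move/is_derive_ext; apply => [u //|].
rewrite /GRing.scale/= /dcauchy mulr0 addr0 /GRing.exp/=.
by field; rewrite gt_eqF// denom_gt0.
Qed.

Lemma is_derive_atan_div (t : R) : is_derive t 1 (fun y => atan (y / e)) (cauchy e t).
Proof.
have h1 : is_derive t 1 (fun y : R => y / e) e^-1.
  have := is_deriveM (is_derive_id t 1) (is_derive_cst e^-1 t 1).
  by move/is_derive_ext; apply => [u //|]; rewrite /GRing.scale/= mulr0 add0r mulr1.
have := @is_derive1_comp _ atan (fun y : R => y / e) t _ _ (is_derive1_atan (t / e)) h1.
move/is_derive_ext; apply => [u //|]; rewrite /cauchy.
by field; rewrite gt_eqF ?denom_gt0// gt_eqF.
Qed.

Lemma is_derive_levy_primitive (x t : R) :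
  is_derive t 1 (fun y => levy_primitive e y x) (levy_kernel e t x).
Proof.
have h1 : is_derive t 1 (fun y : R => y - x) 1.
  have := is_deriveB (is_derive_id t 1) (is_derive_cst x t 1).
  by move/is_derive_ext; apply => [u //|]; rewrite subr0.
have h2 := @is_derive1_comp _ (fun y => atan (y / e)) (fun y : R => y - x) t _ _ (is_derive_atan_div (t - x)) h1.
have h3 := is_deriveM (is_derive_cst (small_jump x) t 1) (is_derive_cauchy t).
have := is_deriveB (is_deriveB (is_derive_atan_div t) h2) h3.
move/is_derive_ext; apply => [u //|].
by rewrite /GRing.scale/= /levy_kernel; ring.
Qed.

End levy_fubini.
End cauchy_kernels.

(** * Vanishing damping *)

Section kernel_limit.
Context {R : realType}.
Notation leb := (@lebesgue_measure R).

(** The scale [e] runs through a sequence in ]0, 1], as dominated convergence is applied along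
    sequences. *)
Definition damping (n : nat) : R := n.+1%:R^-1.

Lemma damping_gt0 n : 0 < damping n.
Proof. by rewrite /damping invr_gt0. Qed.

Lemma damping_le1 n : damping n <= 1.
Proof. by rewrite /damping invf_le1// ler1n. Qed.

Lemma cvg_damping : damping @ \oo --> 0.
Proof. exact: cvg_harmonic. Qed.

Lemma Rintegral_dominated d (T : measurableType d) (mu : {measure set T -> \bar R})
    (f_ : nat -> T -> R) (f g : T -> R) :
  (forall n, measurable_fun setT (f_ n)) -> measurable_fun setT f ->
  mu.-integrable setT (EFin \o g) ->
  (forall n x, `|f_ n x| <= g x) -> (forall x, f_ ^~ x @ \oo --> f x) ->
  mu.-integrable setT (EFin \o f) /\
  (fun n => Rintegral mu setT (f_ n)) @ \oo --> Rintegral mu setT f.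
Proof.
move=> mf_ mf ig fg cf.
have [] := @dominated_convergence _ _ R mu setT measurableT (fun n => EFin \o f_ n) (EFin \o f) (EFin \o g).
- by move=> n; exact/measurable_EFinP.
- exact/measurable_EFinP.
- by apply: aeW => x _; apply: cvg_EFin; [exact: nearW|exact: cf].
- by [].
- by apply: aeW => x n _; rewrite /= lee_fin.
move=> h1 _ h2; split => //; apply: fine_cvg.
have <- : (\int[mu]_x (EFin \o f) x = (Rintegral mu setT f)%:E)%E.
  by rewrite /Rintegral fineK//; exact: integrable_fin_num.
exact: h2.
Qed.

(* For small [x], [- levy_primitive e y x] is the second-order Taylor remainder at
   [y] of [t |-> atan (t / e)], whose second derivative is at most [1 / t ^ 2] for
   every [e]. *)
Lemma levy_primitive_le (y : R) : y != 0 -> exists2 C : R, 0 <= C &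
  forall e x, 0 < e -> e <= 1 -> `|levy_primitive e y x| <= C * jump_weight x.
Proof.
move=> y0.
have y20 : 0 < y ^+ 2 by rewrite exprn_even_gt0.
(* A bound for [levy_primitive] when [|x| <= 1]: the arctangents differ by at most [pi], and the
   linear term is at most [cauchy e y], itself bounded by [1 / y^2] for [e <= 1]. *)
pose A := pi + (y ^+ 2)^-1.
have pi0 := pi_gt0 R.
have iy0 : 0 < (y ^+ 2)^-1 by rewrite invr_gt0.
have A0 : 0 < A by rewrite addr_gt0.
have C4 : 0 < 4 / y ^+ 2 by rewrite divr_gt0.
have AC : 0 < A * (4 / y ^+ 2) by rewrite mulr_gt0.
exists (4 / y ^+ 2 + A * (4 / y ^+ 2) + pi) => [|e x e0 e1].
  by apply: addr_ge0 (ltW pi0); apply: addr_ge0; exact: ltW.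
have atb : `|atan (y / e) - atan ((y - x) / e)| <= pi.
  rewrite ler_norml; have := atan_gtNpi2 (y / e); have := atan_ltpi2 (y / e).
  by have := atan_gtNpi2 ((y - x) / e); have := atan_ltpi2 ((y - x) / e); lra.
rewrite /levy_primitive; case: (small_jump_cases x) => -[sE wE]; rewrite sE wE; last first.
  by rewrite mul0r subr0 mulr1 (le_trans atb)//; lra.
have x2 : 0 <= x ^+ 2 by exact: sqr_ge0.
(* If [|x| <= |y| / 2], the points between [y] and [y - x] satisfy [t^2 >= y^2 / 4], and Taylor's
   bound applies with [4 / y^2]. Otherwise [1 <= (4 / y^2) x^2], and the bound [A] is enough. *)
have [xy|xy] := leP (`|x|) (`|y| / 2).
  have t0 t : `|t - y| <= `|y - x - y| -> y ^+ 2 / 4 <= t ^+ 2.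
    have -> : y - x - y = - x by ring.
    rewrite normrN => /le_trans/(_ xy) ty.
    have ty2 : `|y| / 2 <= `|t|.
      have := ler_normD t (y - t); rewrite subrKC distrC => h; lra.
    have : (`|y| / 2) ^+ 2 <= `|t| ^+ 2 by rewrite lerXn2r// nnegrE divr_ge0.
    rewrite exprMn !real_normK ?num_real//.
    by have -> : (2^-1 ^+ 2 : R) = 4^-1 by rewrite exprVn -natrX.
  have h := @taylor1_bound R (fun t => atan (t / e)) (cauchy e) (fun t => - dcauchy e t) y (y - x) (4 / y ^+ 2) (ltW C4)
    (fun t _ => is_derive_atan_div e0 t) (fun t _ => is_derive_cauchy e0 t).
  rewrite -normrN.
  have -> : - (atan (y / e) - atan ((y - x) / e) - x * cauchy e y) =
     atan ((y - x) / e) - atan (y / e) - cauchy e y * (y - x - y) by ring.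
  apply: (le_trans (h _)).
    move=> t /t0 ty; rewrite normrN /dcauchy.
    have d0 := denom_gt0 t e0.
    rewrite normrM normfV [`|_ ^+ 2|]ger0_norm ?sqr_ge0//.
    rewrite ler_pdivrMr ?exprn_gt0//.
    have e2 : 0 < e ^+ 2 by rewrite exprn_gt0.
    have b1 : `|2 * e * t| <= e ^+ 2 + t ^+ 2.
      rewrite ler_norml.
      have s1 : 0 <= (e - t) ^+ 2 by exact: sqr_ge0.
      have s2 : 0 <= (e + t) ^+ 2 by exact: sqr_ge0.
      by apply/andP; split; nra.
    apply: (le_trans b1); rewrite expr2 mulrA -[leLHS]mul1r ler_wpM2r ?(ltW d0)//.
    rewrite mulrAC ler_pdivlMr// mul1r; lra.
  have -> : y - x - y = - x by ring.
  by rewrite sqrrN ler_wpM2r//; lra.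
have xl : y ^+ 2 / 4 <= x ^+ 2.
  have : (`|y| / 2) ^+ 2 <= `|x| ^+ 2 by rewrite lerXn2r ?nnegrE ?divr_ge0// ltW.
  rewrite exprMn !real_normK ?num_real//.
  by have -> : (2^-1 ^+ 2 : R) = 4^-1 by rewrite exprVn -natrX.
have x1 : `|x| <= 1.
  rewrite -(@ler_pXn2r _ 2)// ?nnegrE// real_normK ?num_real// expr1n.
  by rewrite -wE /jump_weight ge_min lexx.
have cb : `|x * cauchy e y| <= (y ^+ 2)^-1.
  rewrite normrM -[leRHS]mul1r ler_pM// /cauchy ger0_norm; last first.
    by rewrite divr_ge0 ?(ltW e0)// ltW// denom_gt0.
  rewrite ler_pdivrMr ?denom_gt0//.
  have : 0 <= e ^+ 2 / y ^+ 2 by rewrite divr_ge0 ?sqr_ge0.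
  have -> : (y ^+ 2)^-1 * (e ^+ 2 + y ^+ 2) = e ^+ 2 / y ^+ 2 + 1 by field.
  lra.
apply: (le_trans (ler_normB _ _)); apply: (@le_trans _ _ A); first by rewrite lerD.
have : A <= A * (4 / y ^+ 2) * x ^+ 2.
  rewrite -mulrA -[leLHS]mulr1 ler_wpM2l ?(ltW A0)// mulrAC ler_pdivlMr// mul1r; lra.
have : 0 <= 4 / y ^+ 2 * x ^+ 2 by rewrite mulr_ge0 ?(ltW C4).
have : 0 <= pi * x ^+ 2 by rewrite mulr_ge0 ?(ltW pi0).
by rewrite !mulrDl; lra.
Qed.

Lemma cvg_atan_damping (u : R) : atan (u / damping n) @[n --> \oo] --> pi / 2 * Num.sg u.
Proof.
have cn : (fun n => n.+1%:R : R) @ \oo --> +oo by rewrite (cvg_shiftS (fun n => n%:R : R)); exact: cvgr_idn.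
have main (v : R) : 0 < v -> atan (v / damping n) @[n --> \oo] --> pi / 2.
  move=> v0; have kid : (fun x : R => v * x) @ +oo --> +oo by apply: gt0_cvgMry => //; exact: cvg_id.
  have -> : (fun n => atan (v / damping n)) = (fun n => atan (v * n.+1%:R)).
    by apply/funext => n; rewrite /damping invrK.
  exact: (cvg_comp _ _ (cvg_comp _ _ cn kid) (@cvgy_atan R)).
have [u0|u0|->] := ltrgt0P u.
- by rewrite gtr0_sg// mulr1; exact: main.
- rewrite ltr0_sg// mulrN1.
  have -> : (fun n => atan (u / damping n)) = (fun n => - atan (- u / damping n)).
    by apply/funext => n; rewrite mulNr atanN opprK.
  by apply: cvgN; apply: main; rewrite oppr_gt0.
- by rewrite sgr0 mulr0; under eq_fun do rewrite mul0r atan0; exact: cvg_cst.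
Qed.

Lemma cvg_cauchy_damping (y : R) : y != 0 -> cauchy (damping n) y @[n --> \oo] --> 0.
Proof.
move=> y0; rewrite (_ : 0 = 0 / (0 ^+ 2 + y ^+ 2)); last by rewrite mul0r.
apply: cvgM; first exact: cvg_damping.
apply: cvgV; first by rewrite expr0n add0r expf_neq0.
apply: cvgD; last exact: cvg_cst.
apply: (cvg_comp damping (fun u => u ^+ 2) cvg_damping); exact: exprn_continuous.
Qed.

Lemma cvg_levy_primitive (y x : R) : y != 0 ->
  levy_primitive (damping n) y x @[n --> \oo] --> pi / 2 * (Num.sg y - Num.sg (y - x)).
Proof.
move=> y0; rewrite -[X in _ --> X](subr0) -(mulr0 (small_jump x)) mulrBr.
apply: cvgB; first by apply: cvgB; exact: cvg_atan_damping.
by apply: cvgM; [exact: cvg_cst|exact: cvg_cauchy_damping].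
Qed.

Lemma measurable_levy_primitive (e y : R) : 0 < e -> measurable_fun setT (levy_primitive e y).
Proof.
move=> e0; apply: measurable_funB; last by apply: measurable_funM => //; exact: measurable_small_jump.
apply: measurable_funB => //.
apply: measurableT_comp; first exact: (continuous_measurable_fun (@continuous_atan R)).
by apply: measurable_funM => //; exact: measurable_funB.
Qed.

Lemma levy_kernel_ftc (e p q x : R) : 0 < e -> p < q ->
  Rintegral leb `[p, q] (levy_kernel e ^~ x) = levy_primitive e q x - levy_primitive e p x.
Proof.
move=> e0 pq.
have dF t := is_derive_levy_primitive e0 x t.
have cF : continuous (fun y => levy_primitive e y x).
  by move=> t; have [/derivable1_diffP h _] := dF t; exact: differentiable_continuous.
have ck : continuous (levy_kernel e ^~ x).
  move=> t; apply: cvgD; last by apply: cvgM; [exact: cvg_cst|exact: continuous_dcauchy].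
  apply: cvgB; first exact: continuous_cauchy.
  apply: (cvg_comp (fun y => y - x) (cauchy e)); last exact: continuous_cauchy.
  by apply: cvgB; [exact: cvg_id|exact: cvg_cst].
rewrite /Rintegral (@continuous_FTC2 _ _ (fun y => levy_primitive e y x) _ _ pq)//.
- exact: continuous_subspaceT.
- split.
  + by move=> t _; have [] := dF t.
  + by apply: cvg_at_right_filter; exact: cF.
  + by apply: cvg_at_left_filter; exact: cF.
- by move=> t _; rewrite derive1E; have [_ ->] := dF t.
Qed.

Section limit.
Variable F : {sigma_finite_measure set (measurableTypeR R) -> \bar R}.
Hypothesis iw : F.-integrable setT (EFin \o (@jump_weight R)).
Variables p q : R.
Hypothesis pq : p < q.
Hypothesis pq0 : 0 < p * q.

(* The indicator function of [p, q], except for the value 1/2 at [p] and [q]. *)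
Definition midpoint_indicator (x : R) : R := (Num.sg (q - x) - Num.sg (p - x)) / 2.

Lemma kernel_limit :
  F.-integrable setT (EFin \o midpoint_indicator) /\
  (fun n => Rintegral leb `[p, q] (fun y => Rintegral F setT (levy_kernel (damping n) y))) @ \oo -->
    - pi * Rintegral F setT midpoint_indicator.
Proof.
have p0 : p != 0 by apply: contraTneq pq0 => ->; rewrite mul0r ltxx.
have q0 : q != 0 by apply: contraTneq pq0 => ->; rewrite mulr0 ltxx.
have [Cp Cp0 hCp] := levy_primitive_le p0.
have [Cq Cq0 hCq] := levy_primitive_le q0.
(* As 0 is outside [p, q], the mass there of the Cauchy law centred at 0 vanishes in the limit. *)
have sE : Num.sg p = Num.sg q.
  have : Num.sg (p * q) = 1 by rewrite gtr0_sg.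
  rewrite sgrM; have [h1|h1|h1] := sgrP p; have [h2|h2|h2] := sgrP q => //; try lra.
pose g x := (Cq + Cp) * jump_weight x.
have ig : F.-integrable setT (EFin \o g) by exact: (integrableZl measurableT _ iw).
pose f_ n x := levy_primitive (damping n) q x - levy_primitive (damping n) p x.
have mf_ n : measurable_fun (setT : set (measurableTypeR R)) (f_ n).
  by apply: measurable_funB; apply: measurable_levy_primitive; exact: damping_gt0.
have fg n x : `|f_ n x| <= g x.
  rewrite (le_trans (ler_normB _ _))// /g mulrDl lerD// ?hCq ?hCp ?damping_gt0 ?damping_le1//.
have fcv x : f_ ^~ x @ \oo --> - pi * midpoint_indicator x.
  have -> : - pi * midpoint_indicator x =
      pi / 2 * (Num.sg q - Num.sg (q - x)) - pi / 2 * (Num.sg p - Num.sg (p - x)).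
    by rewrite /midpoint_indicator sE; field.
  by apply: cvgB; exact: cvg_levy_primitive.
have mlim : measurable_fun (setT : set (measurableTypeR R)) (fun x => - pi * midpoint_indicator x).
  exact: (measurable_fun_cvg mf_ (fun x _ => fcv x)).
have [h1 h2] := Rintegral_dominated mf_ mlim ig fg fcv.
have pi0 := pi_gt0 R.
have iwx : F.-integrable setT (EFin \o midpoint_indicator).
  have := integrableZl measurableT (- pi^-1) h1; apply: eq_integrable => // x _ /=.
  by rewrite -EFinM mulrA mulrNN mulVf ?mul1r// gt_eqF.
split => //; rewrite -RintegralZl//.
apply: cvg_trans h2; apply: near_eq_cvg; apply: nearW => n /=.
have e0 := damping_gt0 n.
have M0 (y : R) : `[p, q]%classic y -> 0 <= Rintegral leb `[0, +oo[ (damped_weight (damping n)).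
  move=> _; apply: Rintegral_ge0 => t _.
  by rewrite !mulr_ge0 ?expR_ge0// addr_ge0 ?sqr_ge0.
have mpq : measurable (`[p, q]%classic : set (measurableTypeR R)) by exact: measurable_itv.
rewrite -(Rintegral_swap (m1 := F) (m2 := leb) mpq (measurable_levy_kernel e0)
  (@jump_weight_ge0 R) M0 iw (leb_integrable_cst p q _) (fun x y _ => levy_kernel_le e0 y x)).
by apply: eq_Rintegral => x _; rewrite /f_ levy_kernel_ftc.
Qed.

End limit.
End kernel_limit.

(** * Identification of the Levy measure *)

Section identification.
Context {R : realType}.
Implicit Types z w : R[i].
Notation leb := (@lebesgue_measure R).

(** The real part of [1 / (e + i y)^3], from the Laplace transform of the Gaussian term. *)
Definition cube_kernel (e y : R) : R :=
  (e ^+ 3 - 3 * e * y ^+ 2) / (e ^+ 2 + y ^+ 2) ^+ 3.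

Lemma Re_invc3 (e y a : R) : 0 < e -> Re (a%:C / (e +i* y) ^+ 3) = a * cube_kernel e y.
Proof.
move=> e0; rewrite -exprVn invcE !exprS expr0 mulr1 !ReImE/= /cube_kernel /cauchy.
by field; rewrite gt_eqF// denom_gt0.
Qed.

Lemma is_derive_dcauchy (e t : R) : 0 < e -> is_derive t 1 (dcauchy e) (2 * cube_kernel e t).
Proof.
move=> e0.
have h1 : is_derive t 1 (fun y : R => e ^+ 2 + y ^+ 2) (2 * t).
  have := is_deriveD (is_derive_cst (e ^+ 2) t 1) (is_deriveM (is_derive_id t 1) (is_derive_id t 1)).
  move/is_derive_ext; apply => [u /=|]; first by rewrite [in RHS]expr2.
  by rewrite /GRing.scale/= mulr1; ring.
have d0 := lt0r_neq0 (denom_gt0 t e0).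
have h2 : is_derive t 1 (fun y : R => (e ^+ 2 + y ^+ 2) ^+ 2) (2 * (e ^+ 2 + t ^+ 2) * (2 * t)).
  move: (is_deriveM h1 h1)=> /is_derive_ext; apply => [u|]; first by rewrite [in RHS]expr2.
  by rewrite /GRing.scale/=; ring.
have h3 := @is_deriveV _ (fun y : R => (e ^+ 2 + y ^+ 2) ^+ 2) t _ _ (expf_neq0 2 d0) h2.
have h4 := is_deriveM (is_derive_cst (2 * e) t 1) (is_derive_id t 1).
move: (is_deriveM h4 h3) => /is_derive_ext; apply => [u //|].
rewrite /GRing.scale/= /cube_kernel mulr0 addr0 -[(cst _ * id) t]/(2 * e * t) mulr1.
by field.
Qed.

(** The contribution of the Gaussian part, [a = sigma ^+ 2 / 2], and of the drift [b]. It is an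
    exact derivative whose primitive tends to 0 off the origin: the o(1) of the overview. *)
Definition poly_part (a b e y : R) : R := - (b * dcauchy e y) + a * 2 * cube_kernel e y.

Lemma poly_part_ftc (a b e p q : R) : 0 < e -> p < q ->
  leb.-integrable `[p, q] (EFin \o poly_part a b e) /\
  Rintegral leb `[p, q] (poly_part a b e) =
    (b * cauchy e q + a * dcauchy e q) - (b * cauchy e p + a * dcauchy e p).
Proof.
move=> e0 pq.
have dF (t : R) : is_derive t 1 (fun y => b * cauchy e y + a * dcauchy e y) (poly_part a b e t).
  have := is_deriveD (is_deriveM (is_derive_cst b t 1) (is_derive_cauchy e0 t))
    (is_deriveM (is_derive_cst a t 1) (is_derive_dcauchy t e0)).
  by move/is_derive_ext; apply => [u //|]; rewrite /GRing.scale/= /poly_part; ring.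
have cF : continuous (fun y => b * cauchy e y + a * dcauchy e y).
  by move=> t; have [/derivable1_diffP h _] := dF t; exact: differentiable_continuous.
have ck : continuous (poly_part a b e).
  move=> y; apply: cvgD; first by apply: cvgN; apply: cvgM; [exact: cvg_cst|exact: continuous_dcauchy].
  apply: cvgM; first exact: cvg_cst.
  apply: cvgM.
    apply: cvgB; first exact: cvg_cst.
    by apply: cvgM; [exact: cvg_cst|exact: exprn_continuous].
  apply: cvgV; first by rewrite expf_neq0// gt_eqF// denom_gt0.
  apply: (cvg_comp (fun y => e ^+ 2 + y ^+ 2) (fun u => u ^+ 3)); last exact: exprn_continuous.
  by apply: cvgD; [exact: cvg_cst|exact: exprn_continuous].
split.
  apply: continuous_compact_integrable; first exact: segment_compact.
  exact: continuous_subspaceT.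
rewrite /Rintegral (@continuous_FTC2 _ _ (fun y => b * cauchy e y + a * dcauchy e y) _ _ pq)//.
- exact: continuous_subspaceT.
- split.
  + by move=> t _; have [] := dF t.
  + by apply: cvg_at_right_filter; exact: cF.
  + by apply: cvg_at_left_filter; exact: cF.
- by move=> t _; rewrite derive1E; have [_ ->] := dF t.
Qed.

Lemma cvg_dcauchy_damping (y : R) : y != 0 -> dcauchy (damping n) y @[n --> \oo] --> 0.
Proof.
move=> y0; rewrite (_ : 0 = (2 * 0 * y) / (0 ^+ 2 + y ^+ 2) ^+ 2); last by rewrite mulr0 !mul0r.
have d1 := @cvg_damping R.
apply: cvgM; first by apply: cvgM; [apply: cvgM; [exact: cvg_cst|exact: d1]|exact: cvg_cst].
apply: cvgV; first by rewrite expr0n add0r !expf_neq0.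
apply: (cvg_comp (fun n => damping n ^+ 2 + y ^+ 2) (fun u => u ^+ 2)); last exact: exprn_continuous.
apply: cvgD; last exact: cvg_cst.
apply: (cvg_comp (@damping R) (fun u => u ^+ 2) d1); exact: exprn_continuous.
Qed.

Lemma poly_part_limit (a b p q : R) : p < q -> p != 0 -> q != 0 ->
  Rintegral leb `[p, q] (poly_part a b (damping n)) @[n --> \oo] --> 0.
Proof.
move=> pq p0 q0.
have -> : (fun n => Rintegral leb `[p, q] (poly_part a b (damping n))) = fun n =>
    (b * cauchy (damping n) q + a * dcauchy (damping n) q) - (b * cauchy (damping n) p + a * dcauchy (damping n) p).
  by apply/funext => n; have [_ ->] := poly_part_ftc a b (@damping_gt0 R n) pq.
rewrite [X in _ --> X](_ : 0 = (b * 0 + a * 0) - (b * 0 + a * 0)); last by rewrite subrr.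
by apply: cvgB; apply: cvgD; apply: cvgM; try exact: cvg_cst;
  [exact: cvg_cauchy_damping|exact: cvg_dcauchy_damping|exact: cvg_cauchy_damping|exact: cvg_dcauchy_damping].
Qed.

Lemma cexp_sub1_le z : Re z <= 0 -> normc (cexp z - 1) <= `|Re z| + 2 * `|Im z|.
Proof.
move=> z0; rewrite (le_trans (normc_leD _))// ReD ImD ReN ImN Re_cexp Im_cexp /= oppr0 addr0.
set a := Re z in z0 *; set b := Im z.
have c1 : `|cos b - 1| <= `|b|.
  have h := @mvt_bound R cos (fun t => - sin t) 0 b 1 (fun t _ => is_derive_cos t).
  move: h; rewrite cos0 subr0 mul1r; apply => t _.
  by rewrite normrN ler_norml sin_geN1 sin_le1.
have c2 : `|sin b| <= `|b|.
  have h := @mvt_bound R sin cos 0 b 1 (fun t _ => is_derive_sin t).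
  move: h; rewrite sin0 !subr0 mul1r; apply => t _.
  by rewrite ler_norml cos_geN1 cos_le1.
have e1 : `|expR a| <= 1 by rewrite ger0_norm ?expR_ge0// expR_le1.
have e2 : `|expR a - 1| <= `|a|.
  rewrite distrC (ler0_norm z0) ger0_norm ?subr_ge0 ?expR_le1//.
  by have := expR_ge1Dx a; lra.
have c3 : `|cos b| <= 1 by rewrite ler_norml cos_geN1 cos_le1.
have -> : expR a * cos b - 1 = (expR a - 1) * cos b + (cos b - 1) by ring.
have h1 : `|(expR a - 1) * cos b| <= `|a| by rewrite normrM -[leRHS]mulr1 ler_pM.
have h2 : `|expR a * sin b| <= `|b| by rewrite normrM -[leRHS]mul1r ler_pM.
have := ler_normD ((expR a - 1) * cos b) (cos b - 1); lra.
Qed.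

Context {mum mup gm gp : R} {psi : R[i] -> R[i]}.
Hypothesis mum0 : mum <= 0.
Hypothesis mup0 : 0 <= mup.
Hypothesis mu_lt : mum < mup.
Hypothesis gm0 : gm < 0.
Hypothesis gp0 : 0 < gp.
Let D := dom mum mup gm gp.
Hypothesis psi_ana : forall z, D z -> analytic_at psi z.
Hypothesis psi_cont : ccont_on (D `|` real_line) psi.
Hypothesis psi_growth : forall m1 m2 : R, slope gm gp m1 -> slope gm gp m2 ->
  exists2 C : R, 0 <= C & forall x m, 0 <= x -> m1 <= m <= m2 ->
    normc (psi (ray m x)) <= C * (1 + x ^+ 2).
Local Notation rintp := (@rint R psi).
Local Notation rayintp := (@rayint R psi).

(** The rate of decay is [e] at slope 0 and [e - v * m > e] at slope [m]: damping puts the real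
    half-line and the tilted one in a common sector. *)
Lemma sectorial_between (e v m : R) : slope gm gp m -> 0 < e -> v * m < 0 ->
  exists m1 m2, [/\ @sectorial R gm gp (e +i* v) m1 m2 e, m1 <= m <= m2 & m1 <= 0 <= m2].
Proof.
move=> sm e0 vm.
have s0 : slope gm gp 0 by rewrite /slope atan0; apply/andP; split.
have [m0|m0] := leP 0 m.
  exists 0, m; split; rewrite ?lexx ?m0//; split => //=; rewrite ?mulr0 ?subr0//.
  by rewrite lerDl oppr_ge0 ltW.
exists m, 0; split; rewrite ?lexx ?(ltW m0)//; split => //=; rewrite ?mulr0 ?subr0//.
by rewrite lerDl oppr_ge0 ltW.
Qed.

(** After rotation to slope [m], the two integrands differ by the factor exp(- e z) - 1, which is
    O(e x); the decay at [y] absorbs the [x] uniformly in [v]. *)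
Lemma rayint_damping (y m : R) : slope gm gp m -> y * m < 0 -> exists2 C : R, 0 <= C &
  forall v e, 0 < e -> v * m <= y * m ->
    `|Re (rayintp (e +i* v) 0) - Re (rayintp ('i%C * v%:C) m)| <= C * e.
Proof.
move=> sm ym.
have [C [c [C0 c0 hC]]] := rint_imag_decay psi_growth sm ym.
have c20 : 0 < c / 2 by rewrite divr_gt0.
have [C' C'0 hC'] := powx_le_exp 1 c20.
pose K := (1 + 2 * `|m|) * (C * C').
have K0 : 0 <= K by rewrite !mulr_ge0// addr_ge0// mulr_ge0.
pose w x := expR (- (c / 2 * x)).
have m0I : measurable (`[0, +oo[%classic : set (measurableTypeR R)) by exact: measurable_itv.
have iw := expR_integrable c20.
exists (K * Rintegral leb `[0, +oo[ w) => [|v e e0 vy].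
  by rewrite mulr_ge0// Rintegral_ge0// => x _; rewrite expR_ge0.
have vm : v * m < 0 := le_lt_trans vy ym.
have [m1 [m2 [sect mm m0]]] := sectorial_between sm e0 vm.
rewrite (rayint_slope mum0 mup0 mu_lt psi_ana psi_cont psi_growth sect m0 mm).
have [i1 _] := rint_integrable mum0 mup0 mu_lt psi_cont psi_growth sect mm.
have mmm : m <= m <= m by rewrite lexx.
have [i2 _] := rint_integrable mum0 mup0 mu_lt psi_cont psi_growth (sectorial_imag sm vm) mmm.
rewrite /rayint /cintegral /= -RintegralB//.
have i3 := integrableB m0I i1 i2.
have ie := integrableZl m0I (K * e) iw.
rewrite (le_trans (le_normr_Rintegral m0I i3))//.
have -> : K * Rintegral leb `[0, +oo[ w * e = Rintegral leb `[0, +oo[ (fun x => K * e * w x).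
  by rewrite RintegralZl//; ring.
apply: le_Rintegral => //; first exact: (integrable_norm i3).
move=> x; rewrite /= in_itv/= andbT => x0.
rewrite -ReN -ReD (le_trans (normc_Re _))//.
have -> : rintp (e +i* v) m x - rintp ('i%C * v%:C) m x =
    (cexp (- (e%:C * ray m x)) - 1) * rintp ('i%C * v%:C) m x.
  rewrite /rint /lap mulrBl mul1r; congr (_ - _).
  have -> : cexp (- ((e +i* v) * ray m x)) = cexp (- (e%:C * ray m x)) * cexp (- ('i%C * v%:C * ray m x)).
    by rewrite -cexpD; congr cexp; apply: eqC; rewrite !ReImE/=; ring.
  by ring.
rewrite normcM.
have b1 : normc (cexp (- (e%:C * ray m x)) - 1) <= e * ((1 + 2 * `|m|) * x).
  have rE : Re (- (e%:C * ray m x)) = - (e * x) by rewrite !ReImE/=; ring.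
  have iE : Im (- (e%:C * ray m x)) = - (e * x * m) by rewrite !ReImE/=; ring.
  have ex0 : 0 <= e * x by rewrite mulr_ge0// ltW.
  apply: (le_trans (cexp_sub1_le _)); first by rewrite rE oppr_le0.
  rewrite rE iE !normrN (ger0_norm ex0) normrM (ger0_norm ex0).
  by rewrite le_eqVlt; apply/orP; left; apply/eqP; ring.
have b2 := hC x v x0 vy.
have b3 := hC' x x0; rewrite expr1 in b3.
apply: (@le_trans _ _ (e * ((1 + 2 * `|m|) * (C' * expR (c / 2 * x))) * (C * expR (- (c * x))))).
  apply: ler_pM; rewrite ?normc_ge0// (le_trans b1)// ler_wpM2l ?(ltW e0)// ler_wpM2l//.
have -> : w x = expR (c / 2 * x) * expR (- (c * x)) by rewrite -expRD /w; congr expR; field.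
by rewrite le_eqVlt; apply/orP; left; apply/eqP; rewrite /K; ring.
Qed.

Section triplet.
Variable F : {sigma_finite_measure set (measurableTypeR R) -> \bar R}.
Hypothesis F0 : F [set 0] = 0%E.
Hypothesis Fw : (\int[F]_(x in [set~ 0%R]) (jump_weight x)%:E < +oo)%E.
Variables sigma b : R.
Hypothesis psiE : forall xi : R, psi xi%:C = (sigma ^+ 2 / 2 * xi ^+ 2)%:C - 'i%C * (b * xi)%:C
          + cintegral F [set~ (0 : R)] (levy_khintchine_integrand xi).

Let iw : F.-integrable setT (EFin \o (@jump_weight R)).
Proof. exact: jump_weight_integrable. Qed.

Lemma levy_integrand_integrable (t : R) : cintegrable F setT (levy_khintchine_integrand t).
Proof.
have ig := integrableZl measurableT (3 * (1 + t ^+ 2)) iw.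
have t0 : 0 <= 3 * (1 + t ^+ 2) by rewrite mulr_ge0// addr_ge0// sqr_ge0.
have g0 x : 0 <= 3 * (1 + t ^+ 2) * jump_weight x by rewrite mulr_ge0// jump_weight_ge0.
split; apply: (le_integrable measurableT _ _ ig).
- apply/measurable_EFinP; under eq_fun do rewrite integrand_Re.
  apply: measurable_funB => //; apply: measurableT_comp; first exact: (continuous_measurable_fun (@continuous_cos R)).
  exact: measurable_funM.
- move=> x _ /=; rewrite lee_fin (ger0_norm (g0 x)) mulrC.
  by rewrite (le_trans (normc_Re _))// integrand_bound.
- apply/measurable_EFinP; under eq_fun do rewrite integrand_Im.
  apply: measurable_funB; first by apply: measurable_funM => //; exact: measurable_small_jump.
  apply: measurableT_comp; first exact: (continuous_measurable_fun (@continuous_sin R)).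
  exact: measurable_funM.
- move=> x _ /=; rewrite lee_fin (ger0_norm (g0 x)) mulrC.
  by rewrite (le_trans (normc_Im _))// integrand_bound.
Qed.

Lemma cintegral_off0 (t : R) : cintegral F [set~ (0 : R)] (levy_khintchine_integrand t) =
  cintegral F setT (levy_khintchine_integrand t).
Proof.
rewrite /cintegral /Rintegral.
by rewrite !integral_off0// integrand_at0.
Qed.

Lemma rint_levy s (t : R) : Re (rintp s 0 t) =
  Re (damped s 0 (- ('i%C * b%:C)) (sigma ^+ 2 / 2)%:C t) +
  Rintegral F setT (fun x => damped_integrand s x t).
Proof.
have [i1 i2] := levy_integrand_integrable t.
have rE : ray 0 t = t%:C :> R[i] by rewrite /ray mulr0.
rewrite /rint /lap rE psiE cintegral_off0.
set E := cexp _.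
have -> : Rintegral F setT (fun x => damped_integrand s x t) =
   Re (E * cintegral F setT (levy_khintchine_integrand t)).
  rewrite ReM /cintegral /= -RintegralZl// -RintegralZl// -RintegralB//.
  - by apply: eq_Rintegral => x _; rewrite /damped_integrand ReM.
  - exact: (integrableZl measurableT _ i1).
  - exact: (integrableZl measurableT _ i2).
rewrite -ReD /damped -/E; congr (Re _).
have -> : (1 +i* 0 : R[i]) = 1 by [].
have -> : (sigma ^+ 2 / 2 * t ^+ 2)%:C = (sigma ^+ 2 / 2)%:C * t%:C ^+ 2 :> R[i] by rewrite !(rmorphM, rmorphXn).
have -> : (b * t)%:C = b%:C * t%:C :> R[i] by rewrite rmorphM.
by ring.
Qed.

(** The bridge from psi to [F]: the Gaussian and drift terms go through [laplace_quadratic], the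
    jumps through Fubini's theorem. *)
Lemma rayint_levy (e y : R) : 0 < e ->
  Re (rayintp (e +i* y) 0) =
  poly_part (sigma ^+ 2 / 2) b e y + Rintegral F setT (levy_kernel e y).
Proof.
move=> e0; rewrite /rayint /cintegral /=.
have m0I : measurable (`[0, +oo[%classic : set (measurableTypeR R)) by exact: measurable_itv.
have [[j1 _] j2] := @laplace_quadratic R (e +i* y) 0 (- ('i%C * b%:C)) (sigma ^+ 2 / 2)%:C e0.
transitivity (Rintegral leb `[0, +oo[ (fun t =>
    Re (damped (e +i* y) 0 (- ('i%C * b%:C)) (sigma ^+ 2 / 2)%:C t) +
    Rintegral F setT (fun x => damped_integrand (e +i* y) x t))).
  by apply: eq_Rintegral => t _; exact: rint_levy.
rewrite RintegralD//; last exact: (damped_integrand_integrable iw e0).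
rewrite (damped_integrand_swap iw e0); congr (_ + _).
rewrite -[LHS]/(Re (cintegral leb `[0, +oo[ (damped (e +i* y) 0 (- ('i%C * b%:C)) (sigma ^+ 2 / 2)%:C))) j2.
rewrite mul0r add0r mulNr ReD ReN Re_invc2// /poly_part; congr (_ + _).
have -> : (sigma ^+ 2 / 2)%:C *+ 2 = (sigma ^+ 2 / 2 * 2)%:C :> R[i] by rewrite -rmorphMn/= mulr_natr.
by rewrite Re_invc3.
Qed.

Context {m0 : R}.
Hypothesis m00 : 0 < m0.
Hypothesis sm0 : slope gm gp m0.
Hypothesis smN0 : slope gm gp (- m0).
Local Notation f := (@levy_density R psi m0).

Lemma levy_density_integrable (p q : R) : p < q -> 0 < p * q -> leb.-integrable `[p, q] (EFin \o f).
Proof.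
move=> pq pq0; apply: continuous_compact_integrable; first exact: segment_compact.
apply: continuous_in_subspaceT => y; rewrite inE /= in_itv/= => /andP[py yq].
apply: (levy_density_continuous mum0 mup0 mu_lt psi_cont psi_growth m00 sm0 smN0).
by apply: contraTneq pq0 => y0; rewrite -leNgt; rewrite y0 in py yq; rewrite mulr_le0_ge0.
Qed.

Lemma levy_density_integral (p q : R) : p < q -> 0 < p * q ->
  F.-integrable setT (EFin \o midpoint_indicator p q) /\
  Rintegral leb `[p, q] f = Rintegral F setT (midpoint_indicator p q).
Proof.
move=> pq pq0.
have [iF lim] := kernel_limit iw pq pq0; split => //.
have p0 : p != 0 by apply: contraTneq pq0 => ->; rewrite mul0r ltxx.
have q0 : q != 0 by apply: contraTneq pq0 => ->; rewrite mulr0 ltxx.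
have pi0 := pi_gt0 R.
have pin0 : pi != 0 :> R by rewrite gt_eqF.
have mpq : measurable (`[p, q]%classic : set (measurableTypeR R)) by exact: measurable_itv.
pose m := @side R m0 p.
(* The end of [p, q] nearest to 0, where [v * m] is largest. *)
pose y := if 0 < p then p else q.
have inI v : `[p, q]%classic v -> @side R m0 v = m /\ v * m <= y * m.
  rewrite /= in_itv/= /m /y /side => /andP[pv vq].
  have [pp|pn] := ltP 0 p; first by rewrite (lt_le_trans pp pv) ler_wnM2r// oppr_le0 ltW.
  have qn : q < 0 by rewrite ltNge; apply/negP => qp; have := mulr_le0_ge0 pn qp; rewrite leNgt pq0.
  by rewrite ltNge (le_trans vq (ltW qn)) /= ler_wpM2r// ltW.
have ym : y * m < 0.
  rewrite /y /m; case: ifP => h; first exact: side_lt0.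
  have [sq _] := inI q ltac:(by rewrite /= in_itv/= lexx (ltW pq)).
  by rewrite -/m -sq; exact: side_lt0.
have [C C0 hC] := rayint_damping (side_slope sm0 smN0 p) ym.
pose h n v := - pi^-1 * (poly_part (sigma ^+ 2 / 2) b (damping n) v + Rintegral F setT (levy_kernel (damping n) v)).
have ih0 n : leb.-integrable `[p, q] (EFin \o (fun v =>
    poly_part (sigma ^+ 2 / 2) b (damping n) v + Rintegral F setT (levy_kernel (damping n) v))).
  have [j1 _] := poly_part_ftc (sigma ^+ 2 / 2) b (@damping_gt0 R n) pq.
  exact: (integrableD mpq j1 (levy_kernel_integrable iw p q (@damping_gt0 R n))).
have ih n : leb.-integrable `[p, q] (EFin \o h n) by exact: (integrableZl mpq _ (ih0 n)).
have lim1 : Rintegral leb `[p, q] (h n) @[n --> \oo] --> Rintegral F setT (midpoint_indicator p q).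
  have -> : Rintegral F setT (midpoint_indicator p q) =
      - pi^-1 * (0 + - pi * Rintegral F setT (midpoint_indicator p q)).
    by rewrite add0r mulrA mulrNN mulVf// mul1r.
  have -> : (fun n => Rintegral leb `[p, q] (h n)) = fun n => - pi^-1 *
    (Rintegral leb `[p, q] (poly_part (sigma ^+ 2 / 2) b (damping n)) +
     Rintegral leb `[p, q] (fun v => Rintegral F setT (levy_kernel (damping n) v))).
    apply/funext => n; rewrite /h RintegralZl//; congr (_ * _).
    have [j1 _] := poly_part_ftc (sigma ^+ 2 / 2) b (@damping_gt0 R n) pq.
    by rewrite RintegralD//; exact: (levy_kernel_integrable iw p q (@damping_gt0 R n)).
  apply: cvgM; first exact: cvg_cst.
  by apply: cvgD; [exact: poly_part_limit|exact: lim].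
have fi := levy_density_integrable pq pq0.
(* By [rayint_damping] the integrands differ on [p, q] by at most a fixed multiple of
   [damping n]. *)
have lim2 : Rintegral leb `[p, q] (h n) @[n --> \oo] --> Rintegral leb `[p, q] f.
  apply/cvgrPdist_le => e e0.
  pose B := 2 * (pi^-1 * C * (q - p)) + 1.
  have pC : 0 <= pi^-1 * C * (q - p) by rewrite !mulr_ge0// ?subr_ge0 ?(ltW pq)// invr_ge0 ltW.
  have B0 : 0 < B by rewrite /B ltr_wpDl// mulr_ge0.
  have /cvgrPdist_lt/(_ (e / B)) := @cvg_damping R.
  move=> /(_ (divr_gt0 e0 B0)); apply: filterS => n; rewrite sub0r normrN.
  rewrite gtr0_norm ?damping_gt0// ltr_pdivlMr// => hn.
  rewrite -RintegralB//; last exact: ih.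
  apply: (@le_trans _ _ (pi^-1 * C * damping n * (q - p))); last first.
    have := @damping_gt0 R n; set d := damping n in hn * => d0.
    have : d * (pi^-1 * C * (q - p)) >= 0 by rewrite mulr_ge0// ltW.
    by rewrite /B in hn; nra.
  apply: Rintegral_bound; first exact: ltW.
    exact: (integrableB mpq fi (ih n)).
  move=> v vI; have [sv vy] := inI v vI.
  have fE : f v = - pi^-1 * Re (rayintp ('i%C * v%:C) (@side R m0 v)).
    apply: levy_densityE; move: vI => /andP[pv vq].
    by apply: contraTneq pq0 => v0; rewrite -leNgt mulr_le0_ge0// -v0.
  rewrite -[X in `|X - _|]/(f v) fE sv.
  have := hC v (damping n) (damping_gt0 n) vy; rewrite (rayint_levy _ (damping_gt0 n)) => hv.
  rewrite -mulrBr normrM normrN normfV (gtr0_norm pi0) -mulrA ler_wpM2l ?invr_ge0 ?(ltW pi0)//.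
  by rewrite distrC.
exact: (cvg_unique _ lim2 lim1).
Qed.

End triplet.
End identification.

(** * From intervals off 0 to all measurable sets *)

Section absolute_continuity.
Context {R : realType}.
Notation leb := (@lebesgue_measure R).
Variable F : {measure set (measurableTypeR R) -> \bar R}.
Variable f : R -> R.
Hypothesis F0 : F [set 0] = 0%E.
Hypothesis fc : forall x, x != 0 -> {for x, continuous f}.
Hypothesis f0 : f 0 = 0.
Hypothesis fF : forall p q : R, p < q -> 0 < p * q ->
  F.-integrable setT (EFin \o midpoint_indicator p q) /\
  Rintegral leb `[p, q] f = Rintegral F setT (midpoint_indicator p q).

Lemma continuous_off0_near (x e : R) : x != 0 -> 0 < e ->
  exists2 d : R, 0 < d < `|x| & forall u, x - d <= u <= x + d -> `|f u - f x| <= e.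
Proof.
move=> x0 e0; have /cvgrPdist_le/(_ _ e0) := fc x0.
move=> /nbhs_ballP[d d0 hd].
have nx : 0 < `|x| by rewrite normr_gt0.
exists (Num.min (d / 2) (`|x| / 2)).
  by apply/andP; split; [rewrite lt_min !divr_gt0|rewrite gt_min; apply/orP; right; lra].
set k := Num.min _ _ => u uk.
have kd : k < d by rewrite gt_min; apply/orP; left; move: d0 => /= d0; lra.
rewrite distrC; apply: hd; rewrite /ball/= distrC.
by apply: le_lt_trans kd; rewrite ler_distl.
Qed.

Lemma same_sign_itv (x d : R) : 0 < d < `|x| -> x - d < x + d /\ 0 < (x - d) * (x + d).
Proof.
move=> /andP[d0 dx]; split; first lra.
rewrite -subr_sqr subr_gt0 -[ltRHS]real_normK ?num_real//.
by rewrite ltrXn2r// ?nnegrE// ltW.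
Qed.

Lemma off0_continuous_itv (p q : R) : 0 < p * q -> {within `[p, q], continuous f}.
Proof.
move=> pq0; apply: continuous_in_subspaceT => y; rewrite inE /= in_itv/= => /andP[py yq].
apply: fc; apply: contraTneq pq0 => y0; rewrite -leNgt.
by rewrite y0 in py yq; rewrite mulr_le0_ge0.
Qed.

Lemma off0_integrable (p q : R) : 0 < p * q -> leb.-integrable `[p, q] (EFin \o f).
Proof.
move=> pq0; apply: continuous_compact_integrable; first exact: segment_compact.
exact: off0_continuous_itv.
Qed.

Lemma midpoint_indicator_bounds (p q x : R) : p < q ->
  (\1_`]p, q[ x : R) <= midpoint_indicator p q x <= (\1_`[p, q] x : R).
Proof.
move=> pq; rewrite !indicE !mem_setE !in_itv/= /midpoint_indicator.
have [h1|h1|h1] := sgrP (q - x); have [h2|h2|h2] := sgrP (p - x);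
  rewrite ?(ltW h1) ?(ltW h2);
  case: (ltrgtP p x) => h3; case: (ltrgtP x q) => h4 /=; try lra.
Qed.

Lemma midpoint_indicator_ge0 (p q x : R) : p < q -> 0 <= midpoint_indicator p q x.
Proof.
by move=> pq; have /andP[h _] := midpoint_indicator_bounds x pq; apply: le_trans h.
Qed.

Lemma density_integral_bounds (p q : R) : p < q -> 0 < p * q ->
  (F `]p, q[%classic <= (Rintegral leb `[p, q] f)%:E <= F `[p, q]%classic)%E.
Proof.
move=> pq pq0; have [iF ->] := fF pq pq0.
rewrite /Rintegral fineK; last exact: integrable_fin_num.
have mE : measurable_fun setT (EFin \o midpoint_indicator p q) by case/integrableP : iF.
have moo : measurable (`]p, q[%classic : set (measurableTypeR R)) by exact: measurable_itv.
have mcc : measurable (`[p, q]%classic : set (measurableTypeR R)) by exact: measurable_itv.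
have := integral_indic F measurableT moo; rewrite setIT => <-.
have := integral_indic F measurableT mcc; rewrite setIT => <-.
apply/andP; split; apply: ge0_le_integral => //.
- by apply/measurable_EFinP; exact: measurable_indic.
- by move=> x _; rewrite lee_fin; have /andP[] := midpoint_indicator_bounds x pq.
- by move=> x _; rewrite lee_fin midpoint_indicator_ge0.
- by apply/measurable_EFinP; exact: measurable_indic.
- by move=> x _; rewrite lee_fin; have /andP[] := midpoint_indicator_bounds x pq.
Qed.

(** By continuity a negative value would make the integral of [f] negative on an interval around
    [x], whereas it equals the integral of a nonnegative function against [F]. *)
Lemma density_ge0 x : 0 <= f x.
Proof.
have [->|x0] := eqVneq x 0; first by rewrite f0.
rewrite leNgt; apply/negP => fx.
have [d dx hd] := @continuous_off0_near x (- (f x) / 2) x0 ltac:(by rewrite divr_gt0// oppr_gt0).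
have [pq pq0] := same_sign_itv dx.
have [iF h] := fF pq pq0.
have : 0 <= Rintegral leb `[x - d, x + d] f.
  by rewrite h; apply: Rintegral_ge0 => u _; exact: midpoint_indicator_ge0.
apply/negP; rewrite -ltNge.
have mcc : measurable (`[x - d, x + d]%classic : set (measurableTypeR R)) by exact: measurable_itv.
apply: (@le_lt_trans _ _ (Rintegral leb `[x - d, x + d] (fun=> f x / 2))).
  apply: le_Rintegral => //; first exact: off0_integrable.
    exact: leb_integrable_cst.
  move=> u; rewrite /= in_itv/= => /hd; rewrite ler_distl => /andP[_]; lra.
rewrite Rintegral_cst// fine_leb_itv ?(ltW pq)//.
move: dx => /andP[d0 _]; rewrite nmulr_rlt0; lra.
Qed.

(** Shrinking intervals around [x] have measure at most [2 k M]. Once [F] has no atoms, the value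
    1/2 of [midpoint_indicator] at the end points no longer matters. *)
Lemma levy_measure_set1 x : F [set x] = 0%E.
Proof.
have [->//|x0] := eqVneq x 0.
have [d /andP[d0 dx] hd] := continuous_off0_near x0 ltr01.
pose M := f x + 1.
have M0 : 0 < M by rewrite /M ltr_wpDl// density_ge0.
have small k : 0 < k <= d -> (F [set x] <= (M * (2 * k))%:E)%E.
  move=> /andP[k0 kd].
  have [pq pq0] := @same_sign_itv x k ltac:(by rewrite k0 (le_lt_trans kd)).
  have /andP[h _] := density_integral_bounds pq pq0.
  apply: (@le_trans _ _ (F `]x - k, x + k[%classic)).
    apply: le_measure; rewrite ?inE//.
    by move=> u /= ->; rewrite in_itv/=; apply/andP; split; lra.
  rewrite (le_trans h)// lee_fin.
  have -> : 2 * k = x + k - (x - k) by ring.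
  have hB := @Rintegral_bound R f (x - k) (x + k) M (ltW pq) (off0_integrable pq0).
  apply: (le_trans (ler_norm _)); apply: hB => u /andP[u1 u2].
  have := hd u ltac:(by apply/andP; split; lra); rewrite (ger0_norm (density_ge0 u)).
  by rewrite ler_distl => /andP[_]; rewrite /M addrC.
have fin : F [set x] \is a fin_num.
  rewrite ge0_fin_numE//; apply: le_lt_trans (small d _) (ltry _).
  by rewrite d0 lexx.
move: small; rewrite -(fineK fin) => small.
have : 0 <= fine (F [set x]) by exact: fine_ge0.
rewrite le_eqVlt => /predU1P[<-//|r0]; exfalso.
set r := fine _ in r0 small.
pose k := Num.min d (r / (4 * M)).
have k0 : 0 < k by rewrite lt_min d0 divr_gt0// mulr_gt0.
have := small k ltac:(by rewrite k0 ge_min lexx).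
rewrite lee_fin => h.
have h2 : k <= r / (4 * M) by rewrite ge_min lexx orbT.
rewrite ler_pdivlMr ?mulr_gt0// in h2; lra.
Qed.

Lemma measurable_density : measurable_fun (setT : set (measurableTypeR R)) f.
Proof.
have mo (A : set R) : open A -> (forall x, A x -> x != 0) ->
   measurable_fun (A : set (measurableTypeR R)) f.
  move=> oA A0; apply: open_continuous_measurable_fun => //.
  by move=> x; rewrite inE => /A0; exact: fc.
have -> : (setT : set (measurableTypeR R)) = [set x | x != 0] `|` [set 0].
  by apply/seteqP; split => x // _; have [->|x0] := eqVneq x 0; [right|left].
have o0 : open ([set x | x != 0] : set R).
  have -> : [set x | x != 0] = ~` [set 0] :> set R.
    by apply/seteqP; split => x /= /eqP.
  exact/closed_openC/closed_eq.
apply/measurable_funU.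
- exact: open_measurable.
- exact: measurable_set1.
- by split; [apply: mo|exact: measurable_fun_set1].
Qed.

Definition density_measure (A : set (measurableTypeR R)) : \bar R :=
  (\int[leb]_(x in A) (f x)%:E)%E.

Let nu0 : density_measure set0 = 0%E.
Proof. exact: integral_set0. Qed.

Let nu_ge0 A : (0 <= density_measure A)%E.
Proof. by apply: integral_ge0 => x _; rewrite lee_fin density_ge0. Qed.

Let nu_sigma_additive : semi_sigma_additive density_measure.
Proof.
apply: semi_sigma_additive_nng_induced; first by apply/measurable_EFinP; exact: measurable_density.
by move=> x; rewrite lee_fin density_ge0.
Qed.

HB.instance Definition _ := isMeasure.Build _ _ _ density_measure nu0 nu_ge0 nu_sigma_additive.

Lemma levy_measure_itv (p q : R) : p < q -> 0 < p * q ->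
  F `]p, q]%classic = density_measure `]p, q]%classic /\ (F `]p, q]%classic < +oo)%E.
Proof.
move=> pq pq0; have /andP[h1 h2] := density_integral_bounds pq pq0.
have moo : measurable (`]p, q[%classic : set (measurableTypeR R)) by exact: measurable_itv.
have moc : measurable (`]p, q]%classic : set (measurableTypeR R)) by exact: measurable_itv.
have e1 : F `]p, q]%classic = F `]p, q[%classic.
  rewrite -(@setUitv1 _ _ (BRight p) q true) ?bnd_simp//.
  rewrite measureU//.
    rewrite [X in (_ + X)%E](_ : _ = 0%E) ?adde0//; exact: levy_measure_set1.
  by apply/seteqP; split => // u /= []; rewrite in_itv/= => /andP[_ uq] uE; rewrite uE ltxx in uq.
have e2 : F `[p, q]%classic = F `]p, q]%classic.
  rewrite -(@setU1itv _ _ (BRight q) p false) ?bnd_simp ?(ltW pq)//.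
  rewrite measureU//.
    rewrite [X in (X + _)%E](_ : _ = 0%E) ?add0e//; exact: levy_measure_set1.
  by apply/seteqP; split => // u /= [->]; rewrite in_itv/= ltxx.
have e3 : F `]p, q]%classic = (Rintegral leb `[p, q] f)%:E.
  by apply/eqP; rewrite eq_le -{2}e2 h2 e1 h1.
rewrite e3 ltry; split=> //; rewrite /density_measure /Rintegral fineK; last first.
  by apply: integrable_fin_num; [exact: measurable_itv|exact: off0_integrable].
rewrite [RHS](integral_itv_obnd_cbnd (r := p) (b := BRight q))//.
by apply/measurable_EFinP; apply: measurable_funTS; exact: measurable_density.
Qed.

(** Both measures may be infinite near 0, so that uniqueness on the pi-system of half-open intervals
    is applied to their restrictions to ]p, q], which are finite. *)
Lemma levy_measure_off0 (p q : R) (A : set (measurableTypeR R)) : p < q -> 0 < p * q ->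
  measurable A -> F (A `&` `]p, q]%classic) = density_measure (A `&` `]p, q]%classic).
Proof.
move=> pq pq0 mA.
have moc : measurable (`]p, q]%classic : set (measurableTypeR R)) by exact: measurable_itv.
have [e1 e2] := levy_measure_itv pq pq0.
pose g (k : nat) : set R := `](- k%:R), k%:R]%classic.
apply: (@measure_unique _ R (measurableTypeR R) (@ocitv R) g _ _ _ _ (mrestr F moc) (mrestr density_measure moc)) => //.
- exact: ocitvI.
- by move=> k; exact: is_ocitv.
- apply/seteqP; split => // x _; exists (Num.bound `|x|) => //=.
  rewrite /g /= in_itv/=; have := @archi_boundP _ `|x| (normr_ge0 x).
  by rewrite ltr_norml => /andP[-> /ltW].
- move=> B [[a b] _ <-] /=; rewrite /mrestr.
  have -> : `]a, b]%classic `&` `]p, q]%classic = `]Num.max a p, Num.min b q]%classic :> set R.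
    apply/seteqP; split => u /=; rewrite !in_itv/= gt_max le_min.
      by move=> [/andP[-> ->] /andP[-> ->]].
    by move=> /andP[/andP[-> ->] /andP[-> ->]].
  have [ab|ab] := ltP (Num.max a p) (Num.min b q); last by rewrite set_itv_ge ?measure0// bnd_simp -leNgt.
  suff pos : 0 < Num.max a p * Num.min b q by have [] := levy_measure_itv ab pos.
  have pm : p <= Num.max a p by rewrite le_max lexx orbT.
  have mq : Num.min b q <= q by rewrite ge_min lexx orbT.
  have [p0|p0] := ltP 0 p.
    by rewrite mulr_gt0// (lt_le_trans p0)// (le_trans pm)// ltW.
  have q0 : q < 0 by rewrite ltNge; apply/negP => q0; have := mulr_le0_ge0 p0 q0; rewrite leNgt pq0.
  by rewrite nmulr_rgt0 ?(le_lt_trans mq)// (lt_trans ab)// (le_lt_trans mq).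
- move=> k; apply: le_lt_trans e2; apply: le_measure; rewrite ?inE//.
  by apply: measurableI => //; exact: measurable_itv.
Qed.

Lemma levy_measure_density (A : set (measurableTypeR R)) : measurable A ->
  F A = density_measure A.
Proof.
move=> mA.
(* With [n + 2] the interval is nonempty from [n = 0] on, as [levy_measure_off0] asks for
   [p < q]. *)
pose P (n : nat) : set (measurableTypeR R) := A `&` `]n.+2%:R^-1, n.+2%:R]%classic.
pose N (n : nat) : set (measurableTypeR R) := A `&` `](- n.+2%:R), (- n.+2%:R^-1)]%classic.
have n0 (n : nat) : 0 < n.+2%:R :> R by [].
have nV (n : nat) : n.+2%:R^-1 < n.+2%:R :> R.
  by rewrite (@lt_trans _ _ 1)// ?invf_lt1// ltr1n.
have mP n : measurable (P n) by apply: measurableI => //; exact: measurable_itv.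
have mN n : measurable (N n) by apply: measurableI => //; exact: measurable_itv.
have le2 (n m : nat) : (n <= m)%N -> n.+2%:R <= m.+2%:R :> R by rewrite ler_nat.
have le2V (n m : nat) : (n <= m)%N -> m.+2%:R^-1 <= n.+2%:R^-1 :> R by move=> /le2 h; rewrite lef_pV2 ?posrE.
have ndP : nondecreasing_seq P.
  move=> n m nm; apply/subsetPset => x [Ax]; rewrite /= !in_itv/= => /andP[h1 h2]; split => //=.
  by rewrite in_itv/= (le_lt_trans (le2V _ _ nm))//= (le_trans h2)// le2.
have ndN : nondecreasing_seq N.
  move=> n m nm; apply/subsetPset => x [Ax]; rewrite /= !in_itv/= => /andP[h1 h2]; split => //=.
  rewrite in_itv/= (@le_lt_trans _ _ (- n.+2%:R))//= ?lerN2 ?le2//.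
  by rewrite (le_trans h2)// lerN2 le2V.
have mUP : measurable (\bigcup_n P n) by exact: bigcup_measurable.
have mUN : measurable (\bigcup_n N n) by exact: bigcup_measurable.
have eP : F (\bigcup_n P n) = density_measure (\bigcup_n P n).
  have h1 := nondecreasing_cvg_mu (mu := F) mP mUP ndP.
  have h2 := nondecreasing_cvg_mu (mu := density_measure) mP mUP ndP.
  have e : F \o P = density_measure \o P.
    by apply/funext => n /=; apply: levy_measure_off0 => //; rewrite mulVf// gt_eqF.
  by rewrite e in h1; exact: (cvg_unique _ h1 h2).
have eN : F (\bigcup_n N n) = density_measure (\bigcup_n N n).
  have h1 := nondecreasing_cvg_mu (mu := F) mN mUN ndN.
  have h2 := nondecreasing_cvg_mu (mu := density_measure) mN mUN ndN.
  have e : F \o N = density_measure \o N.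
    apply/funext => n /=; apply: levy_measure_off0 => //; by rewrite ltrN2.
  by rewrite e in h1; exact: (cvg_unique _ h1 h2).
have inN x : x < 0 -> A x -> (\bigcup_n N n) x.
  move=> x0 Ax; have ix0 : 0 < - x by rewrite oppr_gt0.
  exists (maxn (Num.bound (- x)) (Num.bound (- x)^-1)) => //; split => //=; rewrite in_itv/=.
  have h1 := archi_boundP (ltW ix0).
  have h2 : (- x)^-1 < (Num.bound (- x)^-1)%:R by apply: archi_boundP; rewrite invr_ge0 ltW.
  set k := maxn _ _.
  have k1 : (Num.bound (- x))%:R <= k.+2%:R :> R by rewrite ler_nat !leqW// leq_maxl.
  have k2 : (Num.bound (- x)^-1)%:R <= k.+2%:R :> R by rewrite ler_nat !leqW// leq_maxr.
  rewrite ltrNl (lt_le_trans h1 k1)/= lerNr invf_ple ?posrE//.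
  exact: (le_trans (ltW h2) k2).
have inP x : 0 < x -> A x -> (\bigcup_n P n) x.
  move=> x0 Ax.
  exists (maxn (Num.bound x) (Num.bound x^-1)) => //; split => //=; rewrite in_itv/=.
  have h1 := archi_boundP (ltW x0).
  have h2 : x^-1 < (Num.bound x^-1)%:R by apply: archi_boundP; rewrite invr_ge0 ltW.
  set k := maxn _ _.
  have k1 : (Num.bound x)%:R <= k.+2%:R :> R by rewrite ler_nat !leqW// leq_maxl.
  have k2 : (Num.bound x^-1)%:R <= k.+2%:R :> R by rewrite ler_nat !leqW// leq_maxr.
  rewrite (le_trans (ltW h1) k1) andbT invf_plt ?posrE//.
  exact: (lt_le_trans h2 k2).
have posP x : (\bigcup_n P n) x -> 0 < x /\ A x.
  move=> [n _ [Ax]]; rewrite /= in_itv/= => /andP[h _]; split => //.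
  by apply: lt_trans h; rewrite invr_gt0.
have negN x : (\bigcup_n N n) x -> x < 0 /\ A x.
  move=> [n _ [Ax]]; rewrite /= in_itv/= => /andP[_ h]; split => //.
  by apply: le_lt_trans h _; rewrite oppr_lt0 invr_gt0.
have mA0 : measurable (A `&` [set 0]) by apply: measurableI => //; exact: measurable_set1.
have AE : A = ((\bigcup_n N n) `|` (\bigcup_n P n)) `|` (A `&` [set 0]).
  apply/seteqP; split => x.
    move=> Ax; have [x0|x0|x0] := ltrgt0P x; [left; right|left; left|right].
    - exact: inP.
    - exact: inN.
    - by split.
  by move=> [[/negN[]|/posP[]]|[]].
have d1 : (\bigcup_n N n) `&` (\bigcup_n P n) = set0.
  apply/seteqP; split => // x [/negN[h1 _] /posP[h2 _]].
  by have := lt_trans h1 h2; rewrite ltxx.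
have d2 : ((\bigcup_n N n) `|` (\bigcup_n P n)) `&` (A `&` [set 0]) = set0.
  apply/seteqP; split => // x [h [_ /= x0]]; move: h; rewrite x0.
  by move=> [/negN[]|/posP[]]; rewrite ltxx.
have z1 : F (A `&` [set 0]) = 0%E.
  apply: (subset_measure0 mA0 (measurable_set1 _) _ F0).
  by move=> x [].
have z2 : density_measure (A `&` [set 0]) = 0%E.
  apply: integral0_eq => x [_ ->]; by rewrite f0.
have mNP : measurable ((\bigcup_n N n) `|` (\bigcup_n P n)) by exact: measurableU.
have eqm (m : {measure set (measurableTypeR R) -> \bar R}) : m A =
    (m (\bigcup_n N n) + m (\bigcup_n P n) + m (A `&` [set 0%R]))%E.
  rewrite {1}AE measureU//; congr (_ + _)%E; exact: measureU.
rewrite (eqm F) eN eP z1 -z2; apply/esym; exact: (eqm density_measure).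
Qed.

Lemma levy_measure_null_dominates : F `<< leb.
Proof.
apply/null_content_dominatesP => A mA A0; rewrite levy_measure_density//.
apply: null_set_integral => //.
by apply/measurable_EFinP; apply: measurable_funTS; exact: measurable_density.
Qed.

End absolute_continuity.

(** * Broken lines *)

Section broken_line.
Context {R : realType}.
Implicit Types z w : R[i].

Lemma tan_lt (a b : R) : - (pi / 2) < a -> a < b -> b < pi / 2 -> tan a < tan b.
Proof.
move=> h1 h2 h3; rewrite lt_neqAle tan_le// ?(ltW h2)// andbT.
apply/eqP => /(congr1 atan).
have [_ ->] := @tan_bounds R a ltac:(by apply/andP; split; lra).
have [_ ->] := @tan_bounds R b ltac:(by apply/andP; split; lra).
by move=> ab; rewrite ab ltxx in h2.
Qed.

Lemma atan_tan_le (a b w : R) : - (pi / 2) < a -> a <= b -> b < pi / 2 ->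
  tan a <= w <= tan b -> a <= atan w <= b.
Proof.
move=> h1 h2 h3 /andP[w1 w2].
have [_ {1}<-] := @tan_bounds R a ltac:(by apply/andP; split; lra).
have [_ {1}<-] := @tan_bounds R b ltac:(by apply/andP; split; lra).
by rewrite !le_atan.
Qed.

Lemma closed_cone_of_slope (a b w : R) z : - (pi / 2) < a -> a <= b -> b < pi / 2 ->
  Re z != 0 -> tan a <= w <= tan b -> Im z = `|Re z| * w -> closed_cone a b z.
Proof.
move=> h1 h2 h3 z0 wab zE.
have phi := atan_tan_le h1 h2 h3 wab.
have s0 : 0 < Num.sqrt (1 + w ^+ 2) :> R by rewrite sqrtr_gt0 ltr_wpDr ?sqr_ge0.
exists (`|Re z| * Num.sqrt (1 + w ^+ 2)).
have rho0 : 0 < `|Re z| * Num.sqrt (1 + w ^+ 2) by rewrite mulr_gt0// normr_gt0.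
have rE := ray_polar w `|Re z|.
have [zp|zn] := leP 0 (Re z).
  exists (atan w); split => //; first by left.
  by rewrite -rE (ger0_norm zp); apply: eqC => //; rewrite zE (ger0_norm zp).
exists (pi - atan w); split => //.
  by right; move: phi => /andP[? ?]; apply/andP; split; lra.
have e1 := congr1 (@complex.Re R) rE; have e2 := congr1 (@complex.Im R) rE.
rewrite Re_polar /= in e1; rewrite Im_polar /= in e2.
apply: eqC; rewrite ?Re_polar ?Im_polar.
  rewrite cosB cospi sinpi mulN1r mul0r addr0 mulrN -e1 ltr0_norm// opprK//.
by rewrite sinB cospi sinpi mul0r mulN1r sub0r opprK -e2.
Qed.

Lemma broken_lineE (theta omega t : R) :
  broken_line theta omega t = (t * cos omega) +i* (theta + `|t| * sin omega).
Proof.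
rewrite /broken_line; case: ifPn => [t0|]; last rewrite -ltNge => t0.
  rewrite (ger0_norm t0); apply: eqC; rewrite ReD || rewrite ImD; rewrite ?Re_polar ?Im_polar !ReImE/=; ring.
rewrite (ltr0_norm t0); apply: eqC; rewrite ReD || rewrite ImD; rewrite ?Re_polar ?Im_polar !ReImE/=.
  rewrite cosB cospi sinpi; ring.
rewrite sinB cospi sinpi; ring.
Qed.

Lemma is_derive_affine_abs (c s t : R) : t != 0 ->
  is_derive t 1 (fun u => c + `|u| * s) (Num.sg t * s).
Proof.
move=> t0.
have h : is_derive t 1 (fun u : R => c + (Num.sg t * u) * s) (Num.sg t * s).
  have := is_deriveD (is_derive_cst c t 1)
    (is_deriveM (is_deriveM (is_derive_cst (Num.sg t) t 1) (is_derive_id t 1)) (is_derive_cst s t 1)).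
  move/is_derive_ext; apply => [u //|].
  by rewrite /GRing.scale/=; ring.
apply: (near_eq_is_derive _ h).
have [tp|tn|te] := ltrgt0P t; last by rewrite te eqxx in t0.
  rewrite gtr0_sg//; near=> u; rewrite mul1r ger0_norm//.
  by apply: ltW; near: u; exact: lt_nbhsr.
rewrite ltr0_sg//; near=> u; rewrite mulN1r ler0_norm//.
by apply: ltW; near: u; exact: lt_nbhsl.
Unshelve. all: by end_near. Qed.

Lemma derive1_affine_abs (c s t : R) : t != 0 ->
  derive1 (fun u => c + `|u| * s) t = Num.sg t * s.
Proof. by move=> t0; rewrite derive1E; have [_ ->] := is_derive_affine_abs c s t0. Qed.

Lemma piecewise_C1_linear (c : R) : piecewise_C1 (fun t : R => t * c).
Proof.
have d (t : R) : is_derive t 1 (fun u : R => u * c) c.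
  have := is_deriveM (is_derive_id t 1) (is_derive_cst c t 1).
  by move/is_derive_ext; apply => [u //|]; rewrite /GRing.scale/= mulr0 add0r mulr1.
have dE : derive1 (fun u : R => u * c) = fun=> c.
  by apply/funext => t; rewrite derive1E; have [_ ->] := d t.
split.
- by move=> t; have [/derivable1_diffP h _] := d t; exact: differentiable_continuous.
- exists [::] => t _; split; first by have [] := d t.
  by rewrite dE; exact: cvg_cst.
- by move=> t; rewrite dE; split; exact: is_cvg_cst.
Qed.

Lemma piecewise_C1_affine_abs (c s : R) : piecewise_C1 (fun t : R => c + `|t| * s).
Proof.
have near_gt (F : set_system R) (FF : Filter F) : (\forall u \near F, 0 < u) ->
    derive1 (fun u => c + `|u| * s) @ F --> s.
  move=> h; apply: cvg_trans (cvg_cst s : (fun=> s) @ F --> s); apply: near_eq_cvg.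
  by apply: filterS h => u u0; rewrite derive1_affine_abs ?gt_eqF// gtr0_sg// mul1r.
have near_lt (F : set_system R) (FF : Filter F) : (\forall u \near F, u < 0) ->
    derive1 (fun u => c + `|u| * s) @ F --> - s.
  move=> h; apply: cvg_trans (cvg_cst (- s) : (fun=> - s) @ F --> - s); apply: near_eq_cvg.
  by apply: filterS h => u u0; rewrite derive1_affine_abs ?lt_eqF// ltr0_sg// mulN1r.
split.
- move=> t; apply: cvgD; first exact: cvg_cst.
  by apply: cvgM; [exact: norm_continuous|exact: cvg_cst].
- exists [:: 0] => t; rewrite inE => t0; split; first by have [] := is_derive_affine_abs c s t0.
  rewrite /prop_for /continuous_at (derive1_affine_abs _ _ t0).
  have [tp|tn|te] := ltrgt0P t; last by rewrite te eqxx in t0.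
    by rewrite gtr0_sg// mul1r; apply: near_gt; exact: lt_nbhsr.
  by rewrite ltr0_sg// mulN1r; apply: near_lt; exact: lt_nbhsl.
- move=> t; split.
    have [t0|t0] := leP 0 t.
      apply/cvg_ex; exists s; apply: near_gt; near=> u.
      by apply: le_lt_trans t0 _; near: u; exact: nbhs_right_gt.
    apply/cvg_ex; exists (- s); apply: near_lt; near=> u.
    by near: u; exact: nbhs_right_lt.
  have [t0|t0] := ltP 0 t.
    apply/cvg_ex; exists s; apply: near_gt; near=> u.
    by near: u; exact: nbhs_left_gt.
  apply/cvg_ex; exists (- s); apply: near_lt; near=> u.
  by apply: lt_le_trans t0; near: u; exact: nbhs_left_lt.
Unshelve. all: by end_near. Qed.

(** Seen from 0, the wings shifted by [i theta] have slope [tan omega + theta / (|t| cos omega)],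
    which is not constant; this is why [omega] has to be strictly between [a] and [b]. *)
Lemma broken_line_regular (mum mup gm gp theta omega a b : R) :
  - (pi / 2) <= gm -> gp <= pi / 2 -> mum < theta < mup ->
  gm < a -> a < omega -> omega < b -> b < gp ->
  regular_contour (strip_plus_cone mum mup gm gp) a b (broken_line theta omega).
Proof.
move=> hgm hgp hth ha aw wb hb.
have h1 : - (pi / 2) < a := le_lt_trans hgm ha.
have h2 : b < pi / 2 := lt_le_trans hb hgp.
have wh : omega < pi / 2 := lt_trans wb h2.
have hw : - (pi / 2) < omega := lt_trans h1 aw.
have gw : gm < omega := lt_trans ha aw.
have wg : omega < gp := lt_trans wb hb.
have c0 : 0 < cos omega by have [] := @tan_bounds R omega ltac:(by rewrite hw wh).
have ReE : (fun t => Re (broken_line theta omega t)) = fun t => t * cos omega.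
  by apply/funext => t; rewrite broken_lineE.
have ImE' : (fun t => Im (broken_line theta omega t)) = fun t => theta + `|t| * sin omega.
  by apply/funext => t; rewrite broken_lineE.
split.
- rewrite ReE ImE'; split; [exact: piecewise_C1_linear|exact: piecewise_C1_affine_abs].
- by move=> s t st; rewrite !broken_lineE/= ltr_pM2r.
- rewrite ReE; split; first by apply: gt0_cvgMly => //; exact: cvg_id.
  by apply: gt0_cvgMlNy => //; exact: cvg_id.
- move=> t; exists theta, (if 0 <= t then polar t omega else polar (- t) (pi - omega)); split => //.
  have [t0|t0|->] := ltrgt0P t.
  + by left; exists t, omega; split => //; left; rewrite gw wg.
  + by left; exists (- t), (pi - omega); split; [rewrite oppr_gt0|right; rewrite !ltrD2l !ltrN2 gw wg|].
  + by right; rewrite /polar mul0r.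
- have t1 := tan_lt h1 aw wh; have t2 := tan_lt hw wb h2.
  pose d := Num.min (tan omega - tan a) (tan b - tan omega).
  have d0 : 0 < d by rewrite lt_min !subr_gt0 t1.
  have cd0 : 0 < cos omega * d by rewrite mulr_gt0.
  (* From [t0] on, the perturbation of the slope by [theta] is at most [d], its margin to [tan a]
     and [tan b]; the added 1 keeps [t] off the corner at 0. *)
  pose t0 := `|theta| / (cos omega * d) + 1.
  exists t0, (cos omega)^-1 => t tt.
  have tpos : 0 < `|t| by apply: lt_le_trans tt; rewrite ltr_wpDl// divr_ge0// ltW.
  have tn0 : t != 0 by rewrite -normr_gt0.
  have q0 : `|theta| <= `|t| * (cos omega * d).
    rewrite -ler_pdivrMr//; apply: le_trans tt; rewrite /t0; lra.
  have tc0 : 0 < `|t| * cos omega by rewrite mulr_gt0.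
  split.
    apply: (@closed_cone_of_slope a b (theta / (`|t| * cos omega) + tan omega)) => //.
    + exact: ltW (lt_trans aw wb).
    + by rewrite broken_lineE/= mulf_neq0// gt_eqF.
    + have : `|theta / (`|t| * cos omega)| <= d.
        by rewrite normrM normfV (gtr0_norm tc0) ler_pdivrMr// mulrC -mulrA.
      rewrite ler_norml => /andP[e1 e2].
      have : d <= tan omega - tan a by rewrite ge_min lexx.
      have : d <= tan b - tan omega by rewrite ge_min lexx orbT.
      by move=> ? ?; apply/andP; split; lra.
    + rewrite broken_lineE/= normrM (gtr0_norm c0) /tan.
      by field; rewrite !gt_eqF.
  rewrite /curve_derivative /= ReE ImE' derive1_affine_abs//.
  have -> : derive1 (fun t : R => t * cos omega) t = cos omega.
    have := is_deriveM (is_derive_id t 1) (is_derive_cst (cos omega) t 1).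
    move=> [_]; rewrite /GRing.scale/= mulr0 add0r mulr1 => h.
    by rewrite derive1E.
  rewrite mulVf ?gt_eqF// normrM normr_sg tn0 mul1r ler_norml sin_geN1 sin_le1//.
Qed.

End broken_line.

(** * The theorem *)

Section contour_formula.
Context {R : realType}.
Implicit Types z w : R[i].

Lemma slope_min (gm gp m1 m2 : R) : slope gm gp m1 -> slope gm gp m2 -> slope gm gp (Num.min m1 m2).
Proof. by move=> s1 s2; case: (leP m1 m2). Qed.

Lemma slope_max (gm gp m1 m2 : R) : slope gm gp m1 -> slope gm gp m2 -> slope gm gp (Num.max m1 m2).
Proof. by move=> s1 s2; case: (leP m1 m2). Qed.

Lemma tan_slope (gm gp a : R) : - (pi / 2) <= gm -> gp <= pi / 2 -> gm < a -> a < gp -> slope gm gp (tan a).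
Proof.
move=> h1 h2 ha hb.
have [_ aE] := @tan_bounds R a ltac:(by rewrite (le_lt_trans h1 ha) (lt_le_trans hb h2)).
by rewrite /slope aE ha hb.
Qed.

Lemma levy_exponent_conj (F : {sigma_finite_measure set (measurableTypeR R) -> \bar R})
    (psi : R[i] -> R[i]) (sigma b : R) :
  (\int[F]_(x in [set~ 0%R]) (jump_weight x)%:E < +oo)%E ->
  (forall xi : R, psi xi%:C = (sigma ^+ 2 / 2 * xi ^+ 2)%:C - 'i%C * (b * xi)%:C
          + cintegral F [set~ (0 : R)] (levy_khintchine_integrand xi)) ->
  forall xi : R, psi (- xi)%:C = (psi xi%:C)^*%C.
Proof.
move=> Fw psiE xi.
have [i1 i2] := levy_integrand_integrable Fw xi.
have hR : Re (cintegral F setT (levy_khintchine_integrand (- xi))) =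
    Re (cintegral F setT (levy_khintchine_integrand xi)).
  by rewrite /cintegral/=; apply: eq_Rintegral => x _; rewrite !integrand_Re mulrN cosN.
have hI : Im (cintegral F setT (levy_khintchine_integrand (- xi))) =
    - Im (cintegral F setT (levy_khintchine_integrand xi)).
  rewrite /cintegral/= -[RHS]mulN1r -RintegralZl//; apply: eq_Rintegral => x _.
  by rewrite !integrand_Im !mulrN sinN; ring.
rewrite !psiE !cintegral_off0; move: hR hI.
move: (cintegral _ _ _) => u; move: (cintegral _ _ _) => v uR uI.
apply: eqC; rewrite ?Re_conj ?Im_conj !ReImE/= ?uR ?uI; ring.
Qed.

Context {mum mup gm gp : R} {psi : R[i] -> R[i]}.
Hypothesis mum0 : mum <= 0.
Hypothesis mup0 : 0 <= mup.
Hypothesis mu_lt : mum < mup.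
Hypothesis gm0 : gm < 0.
Hypothesis gp0 : 0 < gp.
Hypothesis hgm : - (pi / 2) <= gm.
Hypothesis hgp : gp <= pi / 2.
Let D := dom mum mup gm gp.
Hypothesis psi_ana : forall z, D z -> analytic_at psi z.
Hypothesis psi_cont : ccont_on (D `|` real_line) psi.
Hypothesis psi_growth : forall m1 m2 : R, slope gm gp m1 -> slope gm gp m2 ->
  exists2 C : R, 0 <= C & forall x m, 0 <= x -> m1 <= m <= m2 ->
    normc (psi (ray m x)) <= C * (1 + x ^+ 2).
Hypothesis psi_conj : forall xi : R, psi (- xi)%:C = (psi xi%:C)^*%C.
Context {m0 : R}.
Hypothesis m00 : 0 < m0.
Hypothesis sm0 : slope gm gp m0.
Hypothesis smN0 : slope gm gp (- m0).

Lemma psi_refl z : (D `|` [set 0]) z -> psi (refl z) = (psi z)^*%C.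
Proof.
move=> [Dz|->]; first exact: (reflection_symmetry mum0 mup0 mu_lt gm0 gp0 psi_ana (fun x _ => psi_conj x)).
have -> : refl (0 : R[i]) = (- 0)%:C by apply: eqC; rewrite ?Re_refl ?Im_refl.
by rewrite psi_conj.
Qed.

Lemma density_contour (L : R -> R[i]) (a b x : R) :
  gm < a -> a <= b -> b < gp -> x * tan a < 0 -> x * tan b < 0 ->
  regular_contour (strip_plus_cone mum mup gm gp) a b L ->
  contour_integrable (lap (psi := psi) ('i%C * x%:C)) L /\
  (levy_density (psi := psi) (m0 := m0) x)%:C =
    - ((2 * pi)^-1)%:C * contour_integral (lap (psi := psi) ('i%C * x%:C)) L.
Proof.
move=> ha ab hb xa xb rc.
have x0 : x != 0 by apply: contraTneq xa => ->; rewrite mul0r ltxx.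
have sa := tan_slope hgm hgp ha (le_lt_trans ab hb).
have sb := tan_slope hgm hgp (lt_le_trans ha ab) hb.
pose m := @side R m0 x.
have sm : slope gm gp m by exact: side_slope.
have xm : x * m < 0 by exact: side_lt0.
(* One sector has to contain the slopes of the wings and the slope [side x] that defines the
   density. *)
pose m1 := Num.min (tan a) m; pose m2 := Num.max (tan b) m.
have xm1 : x * m1 < 0 by rewrite /m1; case: (leP (tan a) m).
have xm2 : x * m2 < 0 by rewrite /m2; case: (leP (tan b) m).
have rE : Re ('i%C * x%:C) = 0 by rewrite ReM/=; ring.
have iE : Im ('i%C * x%:C) = x by rewrite ImM/=; ring.
have sect : @sectorial R gm gp ('i%C * x%:C) m1 m2 (Num.min (- (x * m1)) (- (x * m2))).
  split; [exact: slope_min|exact: slope_max|by rewrite lt_min !oppr_gt0 xm1|..].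
    by rewrite ge_min; apply/orP; left; rewrite rE iE add0r.
  by rewrite ge_min; apply/orP; right; rewrite rE iE add0r.
have SD : strip_plus_cone mum mup gm gp `<=` D.
  have sE z : strip_plus_cone mum mup gm gp z <-> D z by exact: strip_plus_coneP.
  by move=> z /sE.
have [|||h1 h2] := @contour_value R mum mup gm gp psi mum0 mup0 mu_lt psi_ana psi_cont psi_growth psi_refl
  (strip_plus_cone mum mup gm gp) L a b x _ m1 m2 m SD (le_lt_trans hgm ha) ab (lt_le_trans hb hgp) _ _ sect _ rc.
- by rewrite /m1 ge_min lexx.
- by rewrite /m2 le_max lexx.
- by rewrite /m1 /m2 ge_min le_max lexx !orbT.
split => //; rewrite h2 levy_densityE// -rmorphN -rmorphM; congr (_%:C).
by rewrite -/m !mulNr invfM mulrACA mulVf ?mul1r.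
Qed.

End contour_formula.

Theorem lemma3p2 (R : realType) (mum mup gm gp nu : R)
    (d : measure_display) (Omega : measurableType d) (P : probability Omega R)
    (X : R -> {RV P >-> R}) (psi : R[i] -> R[i])
    (F : {measure set (measurableTypeR R) -> \bar R})
    (hmum : mum <= 0) (hmup : 0 <= mup) (hmu : mum < mup)
    (hgm : - (pi / 2) <= gm) (hgm0 : gm < 0)
    (hgp0 : 0 < gp) (hgp : gp <= pi / 2)
    (hX : levy_process X)
    (hpsi : characteristic_exponent X psi)
    (hF : levy_measure_of psi F)
    (hana : analytic_continuation_to (strip_plus_cone mum mup gm gp) psi)
    (hnu : 0 < nu < 2)
    (hbound : forall g1m g1p : R, gm < g1m < 0 -> 0 < g1p < gp ->
      exists C R0 : R, [/\ 0 < C, 0 < R0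
        & forall phi rho : R, g1m <= phi <= g1p -> R0 < rho ->
            `|psi (polar rho phi)| <= (C * rho `^ nu)%:C]) :
  exists f : R -> R,
    [/\ F `<< @lebesgue_measure R /\
        (forall A : set (measurableTypeR R), measurable A ->
          F A = (\int[@lebesgue_measure R]_(x in A) (f x)%:E)%E),
        smooth_off_0 f,
        forall (L : R -> R[i]) (x : R),
          downward_contour mum mup gm gp L -> 0 < x ->
          let g := fun xi => cexp (- ('i%C * x%:C * xi)) * psi xi in
          contour_integrable g L /\
          (f x)%:C = - ((2 * pi)^-1)%:C * contour_integral g L,
        forall (L : R -> R[i]) (x : R),
          upward_contour mum mup gm gp L -> x < 0 ->
          let g := fun xi => cexp (- ('i%C * x%:C * xi)) * psi xi in
          contour_integrable g L /\
          (f x)%:C = - ((2 * pi)^-1)%:C * contour_integral g L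
      & exists2 omega0 : R, 0 < omega0 &
          forall theta omega : R, mum < theta < mup -> 0 < omega < omega0 ->
            upward_contour mum mup gm gp (broken_line theta omega) /\
            downward_contour mum mup gm gp (broken_line theta (- omega))].
Proof.
case: hF => F0 Fw [sigma [b psiE]].
have [F' F'E] := levy_sigma_finite F0 Fw; subst F.
have SE : strip_plus_cone mum mup gm gp = dom mum mup gm gp.
  have sE z : strip_plus_cone mum mup gm gp z <-> dom mum mup gm gp z by exact: strip_plus_coneP.
  by apply/seteqP; split => z /sE.
case: hana; rewrite SE => psi_ana /within_ccont_on psi_cont.
have psi_growth := growth_of_sector_bound hmum hmup hmu hgm0 hgp0 hnu psi_cont hbound.
have psi_conj := levy_exponent_conj Fw psiE.
have s0 : slope gm gp 0 by rewrite /slope atan0 hgm0 hgp0.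
(* As [gm < 0 < gp], all small slopes of either sign are admissible; half of the radius serves as
   [m0]. *)
have [e e0 he] := slope_open s0.
have m00 : 0 < e / 2 by rewrite divr_gt0.
have sm0 : slope gm gp (e / 2) by apply: he; rewrite subr0 gtr0_norm// ltr_pdivrMr// ltr_pMr// ltr1n.
have smN0 : slope gm gp (- (e / 2)).
  by apply: he; rewrite subr0 normrN gtr0_norm// ltr_pdivrMr// ltr_pMr// ltr1n.
have pi20 : 0 < pi / 2 :> R by rewrite divr_gt0// pi_gt0.
pose f := levy_density (psi := psi) (m0 := e / 2).
have fc x : x != 0 -> {for x, continuous f}.
  exact: (levy_density_continuous hmum hmup hmu psi_cont psi_growth m00 sm0 smN0).
have f0 : f 0 = 0 by rewrite /f /levy_density eqxx.
have fF (p q : R) : p < q -> 0 < p * q -> _ :=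
  @levy_density_integral R mum mup gm gp psi hmum hmup hmu hgm0 hgp0 psi_ana psi_cont psi_growth
    F' Fw sigma b psiE (e / 2) m00 sm0 smN0 p q.
exists f; split.
- split; first exact: (levy_measure_null_dominates F0 fc f0 fF).
  by move=> A mA; exact: (levy_measure_density F0 fc f0 fF mA).
- exact: (levy_density_smooth hmum hmup hmu psi_cont psi_growth m00 sm0 smN0).
- move=> L x [a [c [ha ac c0 rc]]] x0 g.
  have ta (u : R) : gm < u -> u < 0 -> x * tan u < 0.
    move=> gu u0; rewrite pmulr_rlt0// -tan0; apply: tan_lt => //; exact: le_lt_trans hgm gu.
  apply: (density_contour hmum hmup hmu hgm0 hgp0 hgm hgp psi_ana psi_cont psi_growth psi_conj
    m00 sm0 smN0 ha ac _ _ _ rc).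
  + exact: lt_trans c0 hgp0.
  + by apply: ta => //; exact: le_lt_trans ac c0.
  + by apply: ta => //; exact: lt_le_trans ha ac.
- move=> L x [a [c [a0 ac hc rc]]] x0 g.
  have ta (u : R) : 0 < u -> u < gp -> x * tan u < 0.
    move=> u0 ug; rewrite nmulr_rlt0// -tan0; apply: tan_lt => //; first by rewrite oppr_lt0.
    exact: lt_le_trans ug hgp.
  apply: (density_contour hmum hmup hmu hgm0 hgp0 hgm hgp psi_ana psi_cont psi_growth psi_conj
    m00 sm0 smN0 _ ac hc _ _ rc).
  + exact: lt_trans hgm0 a0.
  + by apply: ta => //; exact: le_lt_trans ac hc.
  + by apply: ta => //; exact: lt_le_trans a0 ac.
(* Below this bound both [omega] and [- omega] are inside the cone; the sectors required by
   [broken_line_regular] end half-way to 0 and half-way to the side of the cone. *)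
- exists (Num.min gp (- gm)); first by rewrite lt_min hgp0 oppr_gt0.
  move=> theta omega hth /andP[w0]; rewrite lt_min => /andP[wp wm]; split.
    exists (omega / 2), ((omega + gp) / 2); split; [lra..|].
    by apply: broken_line_regular => //; lra.
  exists ((gm - omega) / 2), (- omega / 2); split; [lra..|].
  by apply: broken_line_regular => //; lra.
Qed.
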